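(* Let $n\ge 2$, $N\ge 1$, let $\Omega\subset\mathbb{R}^n$ be open and bounded, let $p\in(1,\infty)$, $\varepsilon\in[0,1]$ and $p'=\frac{p}{p-1}$. Let $a\in\mathcal{E}(\Omega)$ and $F\in L^{p'}(\Omega;\mathbb{C}^{N\times n})$ be given. Then there exists a weak solution $u\in W_0^{1,p}(\Omega;\mathbb{C}^N)$ to $$-\operatorname{div}\big(a(x)(\varepsilon^2+|\nabla u|^2)^{\frac{p-2}{2}}\nabla u\big)=-\operatorname{div}F\quad\text{in }\Omega.$$
   Context: Inner product and norms: for $F=F^R+iF^I,\ G=G^R+iG^I\in\mathbb{C}^{N\times n}$ with rows $F_j,G_j$, set $\langle F,G\rangle=\sum_{j=1}^N\big(F_j^R\cdot G_j^R+F_j^I\cdot G_j^I+i(-F_j^R\cdot G_j^I+F_j^I\cdot G_j^R)\big)=\sum_j F_j\cdot\overline{G_j}$ and $|F|=\langle F,F\rangle^{1/2}$. Complex Sobolev functions are $u=u^R+iu^I$ with real and imaginary parts in the corresponding real Sobolev space, and $\nabla u=\nabla u^R+i\nabla u^I\in\mathbb{C}^{N\times n}$. Convention: for $\varepsilon=0$, expressions such as $(\varepsilon^2+|\xi|^2)^{\frac{p-2}{2}}\xi$ at $\xi=0$, and $(\varepsilon^2+|F|^2+|G|^2)^{\frac{p-2}{2}}|F-G|^k$ ($k=1,2$) at $F=G=0$, are read as $0$. Constants $c_1,c_2$: fixed positive constants depending only on $p$ such that for all $F,G\in\mathbb{C}^{N\times n}$ and $\varepsilon\in[0,1]$ $$c_1(\varepsilon^2+|F|^2+|G|^2)^{\frac{p-2}{2}}|F-G|^2\le\operatorname{Re}\big\langle(\varepsilon^2+|F|^2)^{\frac{p-2}{2}}F-(\varepsilon^2+|G|^2)^{\frac{p-2}{2}}G,\,F-G\big\rangle,$$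 $$\big|(\varepsilon^2+|F|^2)^{\frac{p-2}{2}}F-(\varepsilon^2+|G|^2)^{\frac{p-2}{2}}G\big|\le c_2(\varepsilon^2+|F|^2+|G|^2)^{\frac{p-2}{2}}|F-G|.$$ Class $\mathcal{E}(\Omega)$ (with fixed constants $0<\nu<L$): all $a=a^R+ia^I:\Omega\to\mathbb{C}$ with $a^R,a^I:\Omega\to\mathbb{R}$ bounded and measurable such that for a.e. $x\in\Omega$: $\nu<a^R(x)-|a^I(x)|$, $a^R(x)+|a^I(x)|<L$, and $c_1a^R(x)-c_2|a^I(x)|>\nu$. Weak solution: $u\in W^{1,p}(\Omega;\mathbb{C}^N)$ is a weak solution to the equation if for every $\varphi\in W_0^{1,p}(\Omega;\mathbb{C}^N)$, $$\int_\Omega a(x)(\varepsilon^2+|\nabla u|^2)^{\frac{p-2}{2}}\langle\nabla u,\nabla\varphi\rangle\,dx=\int_\Omega\langle F,\nabla\varphi\rangle\,dx.$$ *)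

(* Defs.v *)
(* Lebesgue measure on R^n, Sobolev spaces of
   C^N-valued functions, and weak solutions of the complex p-Laplace type
   equation - div (a (eps^2 + |grad u|^2)^((p-2)/2) grad u) = - div F. *)
From HB Require Import structures.
From mathcomp Require Import all_boot all_order all_algebra.
From mathcomp Require Import all_classical all_reals all_analysis.
From mathcomp Require Import complex.
Set Implicit Arguments.
Unset Strict Implicit.
Unset Printing Implicit Defensive.
Import Order.TTheory GRing.Theory Num.Theory.
Import numFieldNormedType.Exports.
Local Open Scope classical_set_scope.
Local Open Scope ring_scope.

(* n-fold product of a sigma-finite measure, by recursion on n along the
   bijection T * T^n ~ T^(n+1). *)
Section tuple_measure.
Context d (T : measurableType d) (R : realType).
Variable mu : {sigma_finite_measure set T -> \bar R}.

Definition tuple_cons n (x : T * n.-tuple T) : n.+1.-tuple T :=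
  [tuple of x.1 :: x.2].

Lemma measurable_tuple_cons n : measurable_fun [set: _] (@tuple_cons n).
Proof. exact: measurable_cons. Qed.

Section succ.
Variable n : nat.
Variable m : {sigma_finite_measure set (n.-tuple T) -> \bar R}.

Definition tuple_measureS (A : set (n.+1.-tuple T)) : \bar R :=
  (mu \x m)%E (@tuple_cons n @^-1` A).

Let measurable_preimage_cons (A : set (n.+1.-tuple T)) :
  measurable A -> measurable (@tuple_cons n @^-1` A).
Proof. by move=> mA; rewrite -[X in measurable X]setTI; exact: measurable_tuple_cons. Qed.

Let tuple_measureS0 : tuple_measureS set0 = 0%E.
Proof. by rewrite /tuple_measureS preimage_set0 measure0. Qed.

Let tuple_measureS_ge0 A : (0 <= tuple_measureS A)%E.
Proof. exact: measure_ge0. Qed.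

Let tuple_measureS_sigma_additive : semi_sigma_additive tuple_measureS.
Proof.
move=> F mF tF mUF; rewrite /tuple_measureS preimage_bigcup.
apply: measure_semi_sigma_additive.
- by move=> k; exact: measurable_preimage_cons.
- apply/trivIsetP => /= i j _ _ ij; rewrite -preimage_setI.
  by move/trivIsetP : tF => /(_ _ _ _ _ ij) ->//; rewrite preimage_set0.
- by rewrite -preimage_bigcup; exact: measurable_preimage_cons.
Qed.

HB.instance Definition _ := isMeasure.Build _ _ _ tuple_measureS
  tuple_measureS0 tuple_measureS_ge0 tuple_measureS_sigma_additive.

Let tuple_measureS_sigma_finite : sigma_finite setT tuple_measureS.
Proof.
have /sigma_finiteP[F [TF ndF Foo]] := sigma_finiteT mu.
have /sigma_finiteP[G [TG ndG Goo]] := sigma_finiteT m.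
pose h (t : n.+1.-tuple T) : T * n.-tuple T := (thead t, [tuple of behead t]).
have mh : measurable_fun [set: _] h.
  by apply/measurable_fun_pairP; split; [exact: measurable_tnth|exact: measurable_behead].
have hK : cancel (@tuple_cons n) h.
  by move=> [x t]; rewrite /h theadE; congr pair; exact/val_inj.
exists (fun k => h @^-1` (F k `*` G k)).
  rewrite -preimage_bigcup (_ : \bigcup_k _ = setT) ?preimage_setT//.
  rewrite -subTset => -[x t] _ /=.
  have [i _ Fix] : (\bigcup_k F k) x by rewrite -TF.
  have [j _ Gjt] : (\bigcup_k G k) t by rewrite -TG.
  exists (maxn i j) => //; split => /=.
  - by move: Fix; exact/subsetPset/ndF/leq_maxl.
  - by move: Gjt; exact/subsetPset/ndG/leq_maxr.
move=> k; have [mFk Fk] := Foo k; have [mGk Gk] := Goo k; split.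
  by rewrite -[X in measurable X]setTI; apply: mh => //; exact: measurableX.
rewrite /tuple_measureS -comp_preimage (_ : _ \o _ = id); last first.
  by apply/funext => x /=; rewrite hK.
rewrite preimage_id product_measure1E//.
by rewrite lte_mul_pinfty// ge0_fin_numE.
Qed.

HB.instance Definition _ := Measure_isSigmaFinite.Build _ _ _ tuple_measureS
  tuple_measureS_sigma_finite.

End succ.

Fixpoint tuple_measure n : {sigma_finite_measure set (n.-tuple T) -> \bar R} :=
  match n with
  | 0 => dirac [tuple]
  | n'.+1 => tuple_measureS (tuple_measure n')
  end.

End tuple_measure.

(* 'rV[R]_n carries the norm and the derivatives but no sigma-algebra in the
   library: the Borel one is pulled back from tuples, and the Lebesgue one is
   its Caratheodory extension. Both are aliases of the type 'rV[R]_n, so a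
   function on 'rV[R]_n is also a function on rV_lebesgue R n. *)
Section lebesgue_measure_rV.
Variables (R : realType) (n : nat).

Definition tuple_of_rV (v : 'rV[R]_n) : n.-tuple (measurableTypeR R) :=
  [tuple v 0 i | i < n].

Definition rV_of_tuple (t : n.-tuple (measurableTypeR R)) : 'rV[R]_n :=
  \row_i tnth t i.

Lemma rV_of_tupleK : cancel rV_of_tuple tuple_of_rV.
Proof.
by move=> t; apply: eq_from_tnth => i; rewrite tnth_mktuple mxE.
Qed.

Definition rV_borel : Type := g_sigma_algebra_preimageType tuple_of_rV.

HB.instance Definition _ := Measurable.on rV_borel.

Lemma measurable_preimage_rV_of_tuple (A : set rV_borel) :
  measurable A -> measurable (rV_of_tuple @^-1` A).
Proof.
move=> [B mB <-]; rewrite setTI -comp_preimage (_ : _ \o _ = id) ?preimage_id//.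
by apply/funext => t /=; rewrite rV_of_tupleK.
Qed.

Definition borel_measure (A : set rV_borel) : \bar R :=
  tuple_measure (@lebesgue_measure R) n (rV_of_tuple @^-1` A).

Let borel_measure0 : borel_measure set0 = 0%E.
Proof. by rewrite /borel_measure preimage_set0 measure0. Qed.

Let borel_measure_ge0 A : (0 <= borel_measure A)%E.
Proof. exact: measure_ge0. Qed.

Let borel_measure_sigma_additive : semi_sigma_additive borel_measure.
Proof.
move=> F mF tF mUF; rewrite /borel_measure preimage_bigcup.
apply: measure_semi_sigma_additive.
- by move=> k; exact: measurable_preimage_rV_of_tuple.
- apply/trivIsetP => /= i j _ _ ij; rewrite -preimage_setI.
  by move/trivIsetP : tF => /(_ _ _ _ _ ij) ->//; rewrite preimage_set0.
- by rewrite -preimage_bigcup; exact: measurable_preimage_rV_of_tuple.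
Qed.

HB.instance Definition _ := isMeasure.Build _ _ _ borel_measure
  borel_measure0 borel_measure_ge0 borel_measure_sigma_additive.

Definition rV_lebesgue : Type := caratheodory_type (borel_measure^*)%mu.

HB.instance Definition _ := Measurable.on rV_lebesgue.

Definition lebesgue_measure_rV : set rV_lebesgue -> \bar R :=
  @completed_measure_extension _ rV_borel R borel_measure.

HB.instance Definition _ := Measure.on lebesgue_measure_rV.

End lebesgue_measure_rV.
Arguments lebesgue_measure_rV R n : clear implicits.

Lemma tuple_measure_box (R : realType) n (A : 'I_n -> set (measurableTypeR R)) :
  (forall i, measurable (A i)) ->
  measurable [set t : n.-tuple (measurableTypeR R) | forall i, A i (tnth t i)] /\
  tuple_measure (@lebesgue_measure R) n [set t | forall i, A i (tnth t i)] =
  (\prod_(i < n) lebesgue_measure (A i))%E.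
Proof.
elim: n A => [|n IHn] A mA.
  rewrite big_ord0 (_ : [set _ | _] = setT); last by apply/seteqP; split=> // t _ [].
  by split; [exact: measurableT|rewrite /= diracT].
have [mB muB] := IHn (A \o lift ord0) (fun i => mA _).
set B := [set t | _] in mB muB.
have consE (t : n.+1.-tuple (measurableTypeR R)) :
    (forall i, A i (tnth t i)) <-> A ord0 (thead t) /\ B [tuple of behead t].
  have tE i : tnth t (lift ord0 i) = tnth [tuple of behead t] i.
    by rewrite [t in LHS]tuple_eta tnthS.
  split=> [At|[At0 Bt] i].
    by split=> [|i /=]; [exact: At|rewrite -tE; exact: At].
  by case: (unliftP ord0 i) => [j ->|->]//; rewrite tE; exact: Bt.
split.
  rewrite (_ : [set _ | _] =
      (fun t : n.+1.-tuple (measurableTypeR R) => thead t) @^-1` A ord0 `&`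
      (fun t : n.+1.-tuple (measurableTypeR R) => [tuple of behead t]) @^-1` B);
    last by apply/seteqP; split=> t /consE.
  apply: measurableI; rewrite -[X in measurable X]setTI.
    by apply: measurable_tnth => //; exact: mA.
  exact: measurable_behead.
rewrite big_ord_recl -muB -product_measure1E//=.
rewrite /tuple_measureS; congr product_measure1; apply/seteqP; split=> -[x t] /=.
  by move=> /consE[Ax Bt]; split=> // i; have := Bt i; rewrite !(tnth_nth x).
by move=> [Ax Bt]; apply/consE; split=> // i; have := Bt i; rewrite /= !(tnth_nth x).
Qed.

Lemma lebesgue_measure_rV_box (R : realType) n
    (A : 'I_n -> set (measurableTypeR R)) :
  (forall i, measurable (A i)) ->
  lebesgue_measure_rV R n [set v | forall i, A i (v 0 i)] =
  (\prod_(i < n) lebesgue_measure (A i))%E.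
Proof.
move=> mA; have [mB <-] := tuple_measure_box mA.
rewrite /lebesgue_measure_rV /completed_measure_extension measurable_mu_extE/=.
  rewrite /borel_measure; congr (tuple_measure _ _ _).
  by apply/seteqP; split=> t /= At i; have := At i; rewrite mxE.
exists [set t | forall i, A i (tnth t i)] => //; rewrite setTI.
by apply/seteqP; split=> v /= Av i; have := Av i; rewrite tnth_mktuple.
Qed.

Section lp_spaces.
Variables (R : realType) (n : nat).
Implicit Types (Omega : set 'rV[R]_n) (p : R) (f g : 'rV[R]_n -> R).
Local Notation mu := (lebesgue_measure_rV R n).

Definition in_Lp Omega p f : Prop := f \_ Omega \in Lfun mu p%:E.

Definition Lp_dist Omega p f g : \bar R :=
  Lnorm mu p%:E (EFin \o ((f \- g) \_ Omega)).

Definition partial (i : 'I_n) f : 'rV[R]_n -> R :=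
  fun x => 'D_(delta_mx 0 i) f x.

Definition iter_partial (s : seq 'I_n) f : 'rV[R]_n -> R := foldr partial f s.

Definition smooth f : Prop := forall s : seq 'I_n,
  continuous (iter_partial s f) /\
  forall i x, derivable (iter_partial s f) x (delta_mx 0 i).

Definition fsupport f : set 'rV[R]_n := closure [set x | f x != 0].

Definition test_function Omega f : Prop :=
  [/\ smooth f, compact (fsupport f) & fsupport f `<=` Omega].

Definition weak_partial Omega (i : 'I_n) f g : Prop :=
  forall phi, test_function Omega phi ->
    \int[mu]_(x in Omega) (f x * partial i phi x) =
    - \int[mu]_(x in Omega) (g x * phi x).

(* [Df] is a weak gradient of [f]; it is determined by [f] a.e. on [Omega] *)
Definition in_W1p Omega p f (Df : 'I_n -> 'rV[R]_n -> R) : Prop :=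
  [/\ in_Lp Omega p f, forall i, in_Lp Omega p (Df i)
    & forall i, weak_partial Omega i f (Df i)].

Definition in_W01p Omega p f (Df : 'I_n -> 'rV[R]_n -> R) : Prop :=
  in_W1p Omega p f Df /\
  exists phi : nat -> 'rV[R]_n -> R,
    [/\ forall k, test_function Omega (phi k),
        Lp_dist Omega p (phi k) f @[k --> \oo] --> 0%E
      & forall i, Lp_dist Omega p (partial i (phi k)) (Df i) @[k --> \oo] --> 0%E].

End lp_spaces.

Section complex_matrices.
Variables (R : realType).

Definition cinner N n (A B : 'M[R[i]]_(N, n)) : R[i] :=
  \sum_(j < N) \sum_(k < n) A j k * conjc (B j k).

Definition cnorm N n (A : 'M[R[i]]_(N, n)) : R :=
  Num.sqrt (complex.Re (cinner A A)).

(* As 0 `^ r is 0 for r != 0 and 1 for r = 0, the products of such a power with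
   A, |A - B| or |A - B|^2 vanish for eps = 0 and A = B = 0. *)
Definition weight (p eps : R) N n (A : 'M[R[i]]_(N, n)) : R :=
  (eps ^+ 2 + cnorm A ^+ 2) `^ ((p - 2) / 2).

Definition weight2 (p eps : R) N n (A B : 'M[R[i]]_(N, n)) : R :=
  (eps ^+ 2 + cnorm A ^+ 2 + cnorm B ^+ 2) `^ ((p - 2) / 2).

Definition flux (p eps : R) N n (A : 'M[R[i]]_(N, n)) : 'M[R[i]]_(N, n) :=
  (weight p eps A)%:C%C *: A.

Definition structure_constants (p c1 c2 : R) : Prop :=
  [/\ 0 < c1, 0 < c2 &
    forall (N n : nat) (A B : 'M[R[i]]_(N, n)) (eps : R), 0 <= eps <= 1 ->
      c1 * weight2 p eps A B * cnorm (A - B) ^+ 2 <=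
        complex.Re (cinner (flux p eps A - flux p eps B) (A - B)) /\
      cnorm (flux p eps A - flux p eps B) <=
        c2 * weight2 p eps A B * cnorm (A - B)].

End complex_matrices.

Section weak_solutions.
Variables (R : realType) (n : nat).
Implicit Types (Omega : set 'rV[R]_n) (p : R).
Local Notation mu := (lebesgue_measure_rV R n).

Definition coefficient_class (nu L c1 c2 : R) Omega (a : 'rV[R]_n -> R[i]) :
    Prop :=
  let aR x := complex.Re (a x) in
  let aI x := complex.Im (a x) in
  [/\ measurable_fun (Omega : set (rV_lebesgue R n)) aR,
      measurable_fun (Omega : set (rV_lebesgue R n)) aI,
      exists M : R, forall x, Omega x -> `|aR x| <= M /\ `|aI x| <= M
    & {ae mu, forall x, Omega x ->
        [/\ nu < aR x - `|aI x|, aR x + `|aI x| < L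
          & nu < c1 * aR x - c2 * `|aI x|]}].

Definition in_Lp_cmx Omega p N m (F : 'rV[R]_n -> 'M[R[i]]_(N, m)) : Prop :=
  forall j k, in_Lp Omega p (fun x => complex.Re (F x j k)) /\
              in_Lp Omega p (fun x => complex.Im (F x j k)).

(* W^{1,p}(Omega; C^N), each function coming with a representative of its
   (a.e. unique) weak gradient *)
Record sobolev Omega p N := Sobolev {
  sobolev_fun :> 'rV[R]_n -> 'cV[R[i]]_N;
  grad : 'rV[R]_n -> 'M[R[i]]_(N, n);
  sobolev_Re : forall j,
    in_W1p Omega p (fun x => complex.Re (sobolev_fun x j 0))
                   (fun k x => complex.Re (grad x j k));
  sobolev_Im : forall j,
    in_W1p Omega p (fun x => complex.Im (sobolev_fun x j 0))
                   (fun k x => complex.Im (grad x j k)) }.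

Definition sobolev0 Omega p N (u : sobolev Omega p N) : Prop := forall j,
  in_W01p Omega p (fun x => complex.Re (u x j 0))
                  (fun k x => complex.Re (grad u x j k)) /\
  in_W01p Omega p (fun x => complex.Im (u x j 0))
                  (fun k x => complex.Im (grad u x j k)).

Definition cintegral Omega (f : 'rV[R]_n -> R[i]) : R[i] :=
  ((\int[mu]_(x in Omega) complex.Re (f x)) +i*
   (\int[mu]_(x in Omega) complex.Im (f x)))%C.

Definition weak_solution Omega p (eps : R) N (a : 'rV[R]_n -> R[i])
    (F : 'rV[R]_n -> 'M[R[i]]_(N, n)) (u : sobolev Omega p N) : Prop :=
  forall phi : sobolev Omega p N, sobolev0 phi ->
    cintegral Omega (fun x =>
      a x * (weight p eps (grad u x))%:C%C * cinner (grad u x) (grad phi x)) =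
    cintegral Omega (fun x => cinner (F x) (grad phi x)).

End weak_solutions.

(* Main.v *)
Require Import Defs.
From mathcomp Require Import all_boot all_order all_algebra.
From mathcomp Require Import all_classical all_reals all_analysis.
From mathcomp Require Import complex.
From mathcomp Require Import ring lra.
From mathcomp Require Import measurable_realfun.

(** Why a solution exists.

Write U for a gradient field and T(U)[G] for the integral over Omega of the
real part of the product of a * flux U - F with G. A function u solves the
equation as soon as T(grad u)[G] = 0 for every gradient G of an element of
W_0^(1,p): the real parts of the weak equation are these identities, and the
imaginary parts are the same identities for i G. So only a real functional has
to be made to vanish.

T is monotone. The structure inequalities bound the real part of the product of
flux A - flux B with A - B from below by c1, and its size by c2; multiplying by
a costs c2 |Im a| and gains c1 Re a, and the coefficient class makes the gain
win ([flux_monotone]). T is coercive because Re a - |Im a| > nu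
([flux_coercive]), and the second structure inequality makes it uniformly
continuous on bounded sets ([flux_ucontinuous]).

The existence argument is the one of Minty and Browder, carried out on the bare
space of gradients of test functions, which is not complete, with uniform
convexity of the energy playing the part of weak compactness ([minty_browder]).
In a ball of gradients, call U good for phi if T(phi)[U - phi] <= 0. For finitely
many phi a good convex combination exists: monotonicity gives the relevant
matrix game a nonpositive value, and such a game is solved by minimising a sum
of squares over a simplex ([matrix_game_nonpos]), with no fixed point theorem.
The sets of good points are convex and shrink as the finite set grows. Points of
nearly minimal energy in them form a Cauchy sequence by uniform convexity, and in
the limit they are good for every phi. Testing with phi close to U (the trick of
Minty) turns this into a variational inequality for T(U) itself, coercivity keeps
U inside the ball, and therefore T(U)[g] tends to 0 for each g.

What remains is to let the Cauchy sequence of gradients converge to the gradient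
of a function. Completeness of L^p ([pint_complete]) gives the limit field. The
functions converge too, by the Poincare inequality ([poincare]), and integration
by parts against test functions ([test_integration_by_parts]) survives the limit
([in_W01p_limit]). Both rest on the vanishing of the integral of a partial
derivative of a function with bounded support ([integral_partial_eq0]), which is
the invariance of Lebesgue measure under translations applied to difference
quotients. *)

Set Implicit Arguments.
Unset Strict Implicit.
Unset Printing Implicit Defensive.
Import Order.TTheory GRing.Theory Num.Theory.
Import numFieldNormedType.Exports.
Local Open Scope classical_set_scope.
Local Open Scope ring_scope.

(** * Solving a monotone matrix game *)

(** Expansion of the squared positive part around x: the coefficient of the
    linear term is 2 max(x, 0), as for a differentiable function, and the
    remainder is at most y ^+ 2. *)
Lemma max0_sqr_le (R : realDomainType) (x y : R) :
  Num.max (x + y) 0 ^+ 2 <= (Num.max x 0 + y) ^+ 2.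
Proof.
have [xy0|xy0] := leP (x + y) 0; first by rewrite expr0n/= sqr_ge0.
by rewrite !expr2; have [x0|x0] := leP x 0; nra.
Qed.

(** The first-order condition at a minimum reached at t = 0. *)
Lemma ge0_of_quadratic (R : realFieldType) (b c : R) :
  (forall t, 0 < t <= 1 -> 0 <= b * t + c * t ^+ 2) -> 0 <= b.
Proof.
move=> h; rewrite leNgt; apply/negP => b0.
have c0 : 0 < `|c| + 1 - b by have := normr_ge0 c; lra.
pose t := - b / (`|c| + 1 - b).
have t1 : 0 < t <= 1.
  rewrite /t divr_gt0 ?oppr_gt0//= ler_pdivrMr//; have := normr_ge0 c; lra.
have tE : t * (`|c| + 1 - b) = - b by rewrite /t divfK// gt_eqF.
have := h t t1; have := ler_norm c; move: t1 => /andP[t0 t1].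
have -> : b * t + c * t ^+ 2 = t * (b + c * t) by ring.
by rewrite pmulr_rge0// => ? ?; nra.
Qed.

(** Minimise over the simplex the sum theta of the squared positive parts of the
    payoffs. The first-order conditions at a minimiser, in the directions of the
    vertices, added up with the violations mu_i as weights, give that
    \sum mu_i mu_j G_ij is at least (\sum mu_i) (\sum mu_i^2). The hypothesis
    makes the left side nonpositive, so all violations vanish. *)
Lemma matrix_game_nonpos (R : realType) (m : nat) (G : 'I_m.+1 -> 'I_m.+1 -> R) :
  (forall mu : 'I_m.+1 -> R, (forall i, 0 <= mu i) ->
    \sum_i \sum_j mu i * mu j * G i j <= 0) ->
  exists lam : 'I_m.+1 -> R, [/\ forall i, 0 <= lam i, \sum_i lam i = 1 &
    forall i, \sum_j lam j * G i j <= 0].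
Proof.
move=> Gneg.
pose D := [set v : 'rV[R]_m.+1 | (forall i, 0 <= v 0 i) /\ \sum_i v 0 i = 1].
pose g i (v : 'rV[R]_m.+1) := \sum_j v 0 j * G i j.
pose theta v : R := \sum_i Num.max (g i v) 0 ^+ 2.
have cts_sum (f : 'I_m.+1 -> 'rV[R]_m.+1 -> R) :
    (forall i, continuous (f i)) -> continuous (fun v => \sum_i f i v).
  move=> cf; elim: (index_enum 'I_m.+1) => [|i s IHs].
    by rewrite (_ : (fun _ => _) = cst 0); [exact: cst_continuous|
      apply/funext => v; rewrite big_nil].
  rewrite (_ : (fun _ => _) = f i \+ (fun v => \sum_(j <- s) f j v)); last first.
    by apply/funext => v; rewrite big_cons.
  by move=> v; apply: continuousD; [exact: cf|exact: IHs].
have cg i : continuous (g i).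
  apply: (cts_sum (fun j v => v 0 j * G i j)) => j v.
  by apply: continuousM; [exact: coord_continuous|exact: cst_continuous].
have ctheta : continuous theta.
  apply: (cts_sum (fun i v => Num.max (g i v) 0 ^+ 2)) => i v.
  have cmax : {for v, continuous (fun v => Num.max (g i v) 0)}.
    by apply: (@continuous_max _ _ (g i) (cst 0)); [exact: cg|exact: cst_continuous].
  exact: (continuousM cmax cmax).
have cD : compact D.
  apply: bounded_closed_compact.
    exists 1; split=> // M M1 v [v0 v1]; rewrite /Num.norm/= mx_normrE.
    apply: (bigmax_le) => [|[i j] _]; first by rewrite (le_trans _ (ltW M1)).
    rewrite ord1 ger0_norm//= (le_trans _ (ltW M1))// -v1 (bigD1 j)//= lerDl.
    by rewrite sumr_ge0.
  rewrite (_ : D = \bigcap_(i : 'I_m.+1) [set v | 0 <= v 0 i] `&`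
      [set v | \sum_i v 0 i = 1]); last first.
    by apply/seteqP; split => v /= [v0 v1]; split => // i; [move=> _|]; apply: v0.
  apply: closedI.
    apply: closed_bigI => i _.
    apply: ((continuous_closedP (fun v : 'rV[R]_m.+1 => v 0 i)).1 _ [set x | 0 <= x]).
      exact: coord_continuous.
    exact: closed_ge.
  apply: ((continuous_closedP (fun v : 'rV[R]_m.+1 => \sum_i v 0 i)).1 _ [set x | x = 1]).
    by apply: (cts_sum (fun i v => v 0 i)) => i; exact: coord_continuous.
  exact: closed_eq.
have D0 : D !=set0.
  exists (delta_mx 0 0); split => [i|]; first by rewrite mxE; case: eqP.
  rewrite (bigD1 ord0)//= mxE eqxx big1 ?addr0// => i i0.
  by rewrite mxE (negbTE i0).
have [lam /set_mem[lam0 lam1] lam_min] :=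
  EVT_min_rV D0 cD (continuous_subspaceT ctheta).
exists (fun i => lam 0 i); split => //.
pose mu i := Num.max (g i lam) 0.
have mu0 i : 0 <= mu i by rewrite le_max lexx orbT.
(* moving from the minimiser lam towards the vertex j *)
have first_order j : 0 <= \sum_i mu i * (G i j - g i lam).
  suff : 0 <= 2 * \sum_i mu i * (G i j - g i lam) by rewrite pmulr_rge0.
  apply: (@ge0_of_quadratic _ _ (\sum_i (G i j - g i lam) ^+ 2)) => t /andP[t0 t1].
  pose v := lam + t *: (delta_mx 0 j - lam).
  have vE k : v 0 k = lam 0 k + t * ((k == j)%:R - lam 0 k) by rewrite !mxE.
  have gv i : g i v = g i lam + t * (G i j - g i lam).
    have -> : G i j = \sum_k (k == j)%:R * G i k.
      by rewrite (bigD1 j)//= eqxx mul1r big1 ?addr0// => k /negbTE->; rewrite mul0r.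
    rewrite /g -sumrB mulr_sumr -big_split/=; apply: eq_bigr => k _.
    by rewrite vE; ring.
  have Dv : D v.
    split => [k|]; first by rewrite vE; have := lam0 k; case: eqP => _ /=; nra.
    under eq_bigr do rewrite vE.
    rewrite big_split/= lam1 -mulr_sumr sumrB lam1.
    rewrite (bigD1 j)//= eqxx big1 ?addr0 ?subrr ?mulr0 ?addr0// => k /negbTE->.
    by [].
  have := lam_min v (mem_set Dv); rewrite -subr_ge0 => /le_trans; apply.
  rewrite lerBlDr -mulrA mulr_suml mulr_suml mulr_sumr -!big_split/=.
  apply: ler_sum => i _; rewrite gv (le_trans (max0_sqr_le _ _))//.
  by rewrite -/(mu i) le_eqVlt; apply/orP; left; apply/eqP; ring.
move=> i; rewrite leNgt; apply/negP => gi0.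
have mui0 : 0 < mu i by rewrite lt_max gi0.
have mugE k : mu k * g k lam = mu k ^+ 2.
  by rewrite /mu; case: leP => // _; rewrite !(mul0r,expr0n).
have := Gneg mu mu0; apply/negP; rewrite -ltNge.
have : 0 <= \sum_j mu j * \sum_i mu i * (G i j - g i lam).
  by apply: sumr_ge0 => j _; rewrite mulr_ge0.
have -> : \sum_j mu j * \sum_i mu i * (G i j - g i lam) =
    \sum_i \sum_j mu i * mu j * G i j - (\sum_j mu j) * \sum_i mu i ^+ 2.
  rewrite exchange_big mulr_suml -sumrB/=; apply: eq_bigr => j _.
  rewrite !mulr_sumr -sumrB; apply: eq_bigr => k _.
  by rewrite -mugE; ring.
rewrite subr_ge0; apply: lt_le_trans; apply: mulr_gt0.
  by rewrite (lt_le_trans mui0)// (bigD1 i)//= lerDl sumr_ge0.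
rewrite (@lt_le_trans _ _ (mu i ^+ 2)) ?exprn_gt0//.
by rewrite (bigD1 i)//= lerDl sumr_ge0// => k _; rewrite sqr_ge0.
Qed.

(** * Monotone functionals and uniformly convex energies *)

Section Minty.
Variables (R : realType) (V : lmodType R) (P : V -> Prop).
Variables (psi : V -> R) (T : V -> V -> R) (K r0 : R).
Hypothesis P0 : P 0.
Hypothesis Pcomb : forall a b U W, P U -> P W -> P (a *: U + b *: W).
Hypothesis psi_ge0 : forall U, P U -> 0 <= psi U.
Hypothesis psi0 : psi 0 = 0.
Hypothesis psiN : forall U, P U -> psi (- U) = psi U.
Hypothesis psi_convex : forall U W (t : R), P U -> P W -> 0 <= t <= 1 ->
  psi ((1 - t) *: U + t *: W) <= (1 - t) * psi U + t * psi W.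
Hypothesis K0 : 0 <= K.
Hypothesis psi_double : forall U, P U -> psi (2 *: U) <= K * psi U.
Hypothesis psi_uconvex : forall r eta : R, 0 < eta -> exists2 delta : R, 0 < delta &
  forall U W, P U -> P W -> psi U <= r -> psi W <= r ->
  psi U / 2 + psi W / 2 - psi (2^-1 *: U + 2^-1 *: W) <= delta ->
  psi (U - W) <= eta.
Hypothesis T_linear : forall U g h a b, P U -> P g -> P h ->
  T U (a *: g + b *: h) = a * T U g + b * T U h.
Hypothesis T_monotone : forall U W, P U -> P W -> T W (U - W) <= T U (U - W).
Hypothesis T_bounded : forall r eta : R, 0 < eta -> exists2 delta : R, 0 < delta &
  forall U h, P U -> P h -> psi U <= r -> psi h <= delta -> `|T U h| <= eta.
Hypothesis T_ucontinuous : forall r eta : R, 0 < eta -> exists2 delta : R, 0 < delta &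
  forall U W h, P U -> P W -> P h -> psi U <= r -> psi W <= r -> psi h <= r ->
  psi (U - W) <= delta -> `|T U h - T W h| <= eta.
Hypothesis T_coercive : forall U, P U -> r0 <= psi U -> 1 <= T U U.

Let PZ a U : P U -> P (a *: U).
Proof. by move=> PU; have := @Pcomb a 0 _ _ PU PU; rewrite scale0r addr0. Qed.
Let PD U W : P U -> P W -> P (U + W).
Proof. by move=> PU PW; have := @Pcomb 1 1 _ _ PU PW; rewrite !scale1r. Qed.
Let PB U W : P U -> P W -> P (U - W).
Proof. by move=> PU PW; have := @Pcomb 1 (-1) _ _ PU PW; rewrite scale1r scaleN1r. Qed.
Let TZ U a g : P U -> P g -> T U (a *: g) = a * T U g.
Proof.
by move=> PU Pg; have := @T_linear _ _ _ a 0 PU Pg Pg; rewrite scale0r addr0 mul0r addr0.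
Qed.
Let TB U g h : P U -> P g -> P h -> T U (g - h) = T U g - T U h.
Proof.
move=> PU Pg Ph; have := @T_linear _ _ _ 1 (-1) PU Pg Ph.
by rewrite scale1r scaleN1r mul1r mulN1r.
Qed.
Let TN U g : P U -> P g -> T U (- g) = - T U g.
Proof. by move=> PU Pg; rewrite -scaleN1r TZ// mulN1r. Qed.

(* The ball is chosen one unit larger than the level r0 of coercivity, so that
   the solution will be found away from its boundary. *)
Let R0 : R := `|r0| + 1.
Let B U := P U /\ psi U <= R0.
Let R0_ge0 : 0 <= R0. Proof. by rewrite /R0 addr_ge0. Qed.
Let B0 : B 0. Proof. by split; rewrite ?psi0. Qed.

Let B_convex U W (t : R) : B U -> B W -> 0 <= t <= 1 -> B ((1 - t) *: U + t *: W).
Proof.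
move=> [PU BU] [PW BW] t01; split; first exact: Pcomb.
by rewrite (le_trans (psi_convex PU PW t01))//; move: t01 => /andP[? ?]; nra.
Qed.

(** The total weight stays a factor, so that the induction on s covers weights
    that do not add up to one. *)
Let B_sum (I : Type) (s : seq I) (w : I -> R) (S : I -> V) :
  (forall i, 0 <= w i) -> (forall i, B (S i)) ->
  exists2 X, B X & \sum_(i <- s) w i *: S i = (\sum_(i <- s) w i) *: X.
Proof.
move=> w0 BS; elim: s => [|i s [X BX XE]].
  by exists 0 => //; rewrite !big_nil scale0r.
rewrite !big_cons XE; set W := \sum_(_ <- s) _.
have W0 : 0 <= W by apply: sumr_ge0.
have [wW0|wW0] := eqVneq (w i + W) 0.
  have [-> ->] : w i = 0 /\ W = 0 by have := w0 i; split; lra.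
  by exists 0; [exact: B0|rewrite addr0 !scale0r addr0].
have wWp : 0 < w i + W by rewrite lt_neqAle eq_sym wW0 addr_ge0.
exists ((1 - W / (w i + W)) *: S i + (W / (w i + W)) *: X).
  apply: B_convex => //; rewrite divr_ge0 ?(ltW wWp)//=.
  by rewrite ler_pdivrMr// mul1r lerDr.
rewrite scalerDr !scalerA; congr (_ *: _ + _ *: _); field; exact: wW0.
Qed.

(* By monotonicity a zero of T satisfies the inequalities in C; unlike T U = 0,
   they are affine in U, hence stable under convex combinations and limits. *)
Let C (S : seq V) U := B U /\ forall phi, phi \in S -> T phi (U - phi) <= 0.
Let good (S : seq V) := forall phi, phi \in S -> B phi.

(** For the game with payoffs T (e i) (e j - e i), the entries (i, j) and (j, i)
    add up to - (T (e j) - T (e i)) (e j - e i), which is nonpositive by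
    monotonicity. The optimal weights give the convex combination. *)
Let C_nonempty S : good S -> exists U, C S U.
Proof.
case: S => [|s0 s] BS; first by exists 0; split.
set S := s0 :: s in BS *.
pose e (i : 'I_(size s).+1) := S`_i.
have Be i : B (e i) by apply: BS; rewrite mem_nth.
have Pe i : P (e i) by have [] := Be i.
have [|lam [lam0 lam1 lamC]] := @matrix_game_nonpos R (size s)
    (fun i j => T (e i) (e j - e i)).
  move=> mu mu0; rewrite -(@pmulr_rle0 _ 2)// mulrDl mul1r.
  rewrite [X in _ + X]exchange_big -big_split/=; apply: sumr_le0 => i _.
  rewrite -big_split/=; apply: sumr_le0 => j _.
  have := T_monotone (Pe j) (Pe i); have := TN (Pe j) (PB (Pe j) (Pe i)).
  rewrite opprB => ->; have := mulr_ge0 (mu0 i) (mu0 j); nra.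
have [X BX] := B_sum (index_enum _) lam0 Be.
rewrite lam1 scale1r => XE; exists X; split => // phi phiS.
have [i ->] : exists i, phi = e i.
  have iS : (index phi S < (size s).+1)%N by rewrite index_mem.
  by exists (Ordinal iS); rewrite /e/= nth_index.
apply: le_trans (lamC i); rewrite -XE le_eqVlt; apply/orP; left; apply/eqP.
rewrite -[X in _ - X]scale1r -lam1 scaler_suml -sumrB.
transitivity (T (e i) (\sum_j lam j *: (e j - e i))).
  by congr (T _ _); apply: eq_bigr => j _; rewrite scalerBr.
pose Q x y := P x /\ T (e i) x = y.
suff : Q (\sum_j lam j *: (e j - e i)) (\sum_j lam j * T (e i) (e j - e i)) by case.
apply: big_rec2 => [|j x y _ [Px <-]]; first split=> //.
  by have := TB (Pe i) P0 P0; rewrite !subrr.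
split; first by rewrite -[x]scale1r; apply: Pcomb => //; exact: PB.
by rewrite -[x in LHS]scale1r T_linear ?mul1r//; exact: PB.
Qed.

Let C_mid S U W : good S -> C S U -> C S W -> C S (2^-1 *: U + 2^-1 *: W).
Proof.
move=> gS [[PU BU] CU] [[PW BW] CW]; split.
  have -> : 2^-1 *: U = (1 - 2^-1) *: U by congr (_ *: _); lra.
  by apply: B_convex; rewrite //; lra.
move=> phi phiS; have [Pphi _] := gS _ phiS.
have -> : 2^-1 *: U + 2^-1 *: W - phi = 2^-1 *: (U - phi) + 2^-1 *: (W - phi).
  rewrite !scalerBr addrACA -opprD -scalerDl; congr (_ - _).
  by rewrite -[LHS]scale1r; congr (_ *: _); lra.
rewrite T_linear//; [|exact: PB|exact: PB].
by have := CU _ phiS; have := CW _ phiS; lra.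
Qed.

(* Isup is the least energy compatible with all the Minty inequalities at once,
   computed through finitely many of them at a time. *)
Let m S := inf [set psi U | U in C S].
Let Isup := sup [set m S | S in good].

Let m_le S U : C S U -> m S <= psi U.
Proof.
move=> CU; apply: ge_inf; last by exists U.
by exists 0 => _ [W [[PW _] _] <-]; exact: psi_ge0.
Qed.

Let m_le_Isup S : good S -> m S <= Isup.
Proof.
move=> gS; apply: ub_le_sup; last by exists S.
exists R0 => _ [S' gS' <-]; have [U CU] := C_nonempty gS'.
by rewrite (le_trans (m_le CU))//; case: CU => -[].
Qed.

Let near_min S (delta : R) : good S -> 0 < delta ->
  exists2 U, C S U & psi U <= Isup + delta.
Proof.
move=> gS d0.
have hi : has_inf [set psi U | U in C S].
  split; first by have [U CU] := C_nonempty gS; exists (psi U), U.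
  by exists 0 => _ [W [[PW _] _] <-]; exact: psi_ge0.
have [_ [U CU <-] /ltW UE] := inf_adherent d0 hi.
by exists U => //; rewrite (le_trans UE)// lerD2r m_le_Isup.
Qed.

(** For a finite set S with m S close to Isup, the midpoint of two near-minimisers
    over C S lies in C S, so its energy is almost Isup as well: the convexity
    defect is small, and uniform convexity brings the two points together. *)
Let near_min_close eta : 0 < eta -> exists S (delta : R), [/\ good S, 0 < delta &
  forall U W, C S U -> C S W -> psi U <= Isup + delta -> psi W <= Isup + delta ->
    psi (U - W) <= eta].
Proof.
move=> eta0; have [delta d0 dP] := psi_uconvex R0 eta0.
have d20 : 0 < delta / 2 by rewrite divr_gt0.
have hs : has_sup [set m S | S in good].
  split; first by exists (m [::]), [::].
  exists R0 => _ [S' gS' <-]; have [U CU] := C_nonempty gS'.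
  by rewrite (le_trans (m_le CU))//; case: CU => -[].
have [_ [S gS <-] SE] := sup_adherent d20 hs.
exists S, (delta / 2); split => // U W CU CW UI WI.
have := m_le (C_mid gS CU CW); move: (CU) (CW) => [[PU BU] _] [[PW BW] _] mid.
by apply: dP => //; rewrite -/Isup in SE; lra.
Qed.

Let psi_sub U W : P U -> P W -> psi (U - W) <= K * (psi U / 2 + psi W / 2).
Proof.
move=> PU PW.
have -> : U - W = 2 *: ((1 - 2^-1) *: U + 2^-1 *: (- W)).
  rewrite scalerDr !scalerA; have -> : 2 * (1 - 2^-1) = 1 :> R by lra.
  by rewrite mulfV// !scale1r.
have PNW : P (- W) by rewrite -scaleN1r; exact: PZ.
apply: (le_trans (psi_double _)); first exact: Pcomb.
apply: ler_wpM2l => //; have := @psi_convex U (- W) 2^-1 PU PNW; rewrite psiN//.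
by move=> /(_ _)/le_trans; apply; lra.
Qed.

Let gap_le U zeta := forall phi, B phi -> T phi (U - phi) <= zeta.

(** The trick of Minty: test with phi = (1 - s) U + s h. Since U - phi is
    s (U - h), the inequality at phi can be divided by s; it then bounds T phi from
    below in the direction h - U, and T phi is close to T U. *)
Let gap_variational eta : 0 < eta -> exists2 zeta : R, 0 < zeta &
  forall U, B U -> gap_le U zeta -> forall h, B h -> - eta <= T U (h - U).
Proof.
move=> eta0; have eta20 : 0 < eta / 2 by rewrite divr_gt0.
have KR0 : 0 <= K * R0 by rewrite mulr_ge0.
have [delta d0 dP] := T_ucontinuous (R0 + K * R0) eta20.
pose s := Num.min 1 (delta / (K * R0 + 1)).
have s0 : 0 < s by rewrite lt_min ltr01/= divr_gt0// ltr_wpDl.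
have s1 : s <= 1 by rewrite ge_min lexx.
(* K * R0 bounds the energy of h - U, so s makes phi and U delta-close *)
have sK : s * (K * R0) <= delta.
  have : s <= delta / (K * R0 + 1) by rewrite ge_min lexx orbT.
  by rewrite ler_pdivlMr ?ltr_wpDl//; nra.
exists (s * (eta / 2)) => [|U [PU BU] gU h [Ph Bh]]; first by rewrite mulr_gt0.
have PhU := PB Ph PU.
have psihU : psi (h - U) <= K * R0.
  apply: (le_trans (psi_sub Ph PU)); apply: ler_wpM2l => //.
  by move: Bh BU; lra.
pose phi := (1 - s) *: U + s *: h.
have Bphi : B phi by apply: B_convex => //; rewrite (ltW s0).
have [Pphi psiphi] := Bphi.
have phiU : phi - U = s *: (h - U).
  apply/eqP; rewrite subr_eq /phi scalerBl scale1r scalerBr.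
  by rewrite [X in _ == X]addrC addrA [X in _ == X]addrAC.
have : T phi (U - phi) <= s * (eta / 2) by apply: gU.
rewrite -opprB phiU TN ?TZ//; last exact: PZ.
rewrite -mulrN ler_pM2l// => T1.
have : `|T phi (h - U) - T U (h - U)| <= eta / 2.
  apply: dP => //.
  - by rewrite (le_trans psiphi)// lerDl.
  - by rewrite (le_trans BU)// lerDl.
  - by rewrite (le_trans psihU)// lerDr.
  have s01 : 0 <= s <= 1 by rewrite (ltW s0).
  have := psi_convex P0 PhU s01; rewrite scaler0 add0r psi0 mulr0 add0r phiU.
  by move=> /le_trans; apply; apply: le_trans sK; rewrite ler_pM2l.
by rewrite ler_norml => /andP[]; lra.
Qed.

(** Taking h = 0 in the variational inequality gives T U U < 1, so that by
    coercivity U is not near the boundary of the ball. Both U + t g and U - t g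
    are then admissible, and the inequality becomes an equation in the limit. *)
Let gap_residual g eta : P g -> 0 < eta -> exists2 zeta : R, 0 < zeta &
  forall U, B U -> gap_le U zeta -> `|T U g| <= eta.
Proof.
move=> Pg eta0; pose Q := K * (R0 + psi g) + 1.
have pg := psi_ge0 Pg.
have Q0 : 0 < Q by rewrite /Q ltr_wpDl// mulr_ge0// addr_ge0.
pose t := Num.min 1 Q^-1.
have t0 : 0 < t by rewrite lt_min ltr01 invr_gt0.
have t01 : 0 <= t <= 1 by rewrite (ltW t0) ge_min lexx.
have tQ : t * Q <= 1 by rewrite -ler_pdivlMr// div1r ge_min lexx orbT.
have [z1 z10 z1P] := @gap_variational 2^-1 ltac:(by rewrite invr_gt0).
have [z2 z20 z2P] := @gap_variational (t * eta) ltac:(by rewrite mulr_gt0).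
exists (Num.min z1 z2) => [|U BU gU]; first by rewrite lt_min z10.
have {}z1P : - 2^-1 <= T U (0 - U).
  by apply: z1P => // phi Bphi; have := gU _ Bphi; rewrite le_min => /andP[].
have {}z2P h : B h -> - (t * eta) <= T U (h - U).
  by apply: z2P => // phi Bphi; have := gU _ Bphi; rewrite le_min => /andP[].
have [PU psiU] := BU.
have psiUr : psi U <= R0 - 1.
  rewrite /R0 addrK leNgt; apply/negP => r0U.
  have : 1 <= T U U by apply: T_coercive => //; rewrite (le_trans (ler_norm _))// ltW.
  by rewrite sub0r TN// in z1P; lra.
have half f : P f -> psi f = psi g -> - eta <= T U f.
  move=> Pf fg.
  have BUf : B (U + t *: f).
    split; first by apply: PD => //; exact: PZ.
    have -> : U + t *: f = (1 - t) *: U + t *: (U - - f).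
      by rewrite opprK scalerBl scale1r scalerDr addrA addrNK.
    have PNf : P (- f) by rewrite -scaleN1r; exact: PZ.
    apply: (le_trans (psi_convex PU (PB PU PNf) t01)).
    have := psi_sub PU PNf; rewrite psiN// fg => psiUf.
    have : psi (U - - f) <= Q.
      apply: (le_trans psiUf); rewrite /Q.
      have : psi U / 2 + psi g / 2 <= R0 + psi g by move: psi_ge0 R0_ge0; lra.
      by move=> /(ler_wpM2l K0); lra.
    have := psi_ge0 PU; move: t01 => /andP[? ?]; nra.
  have := z2P _ BUf; rewrite addrAC subrr add0r TZ//.
  by rewrite -mulrN ler_pM2l.
have := half _ Pg erefl; have := half (- g).
rewrite psiN// TN// => /(_ _ erefl) h1 h2; rewrite ler_norml h2/= -lerN2.
by apply: h1; rewrite -scaleN1r; exact: PZ.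
Qed.

(** U k is a near-minimiser of the energy for the first k + 1 of the finite sets
    of [near_min_close], which makes the sequence Cauchy. Adding one more test
    point phi to these sets gives a W close to U k that satisfies the Minty
    inequality at phi exactly; so U k satisfies it up to an error uniform in phi,
    and [gap_residual] applies. *)
Lemma minty_browder : exists U : nat -> V,
  [/\ forall k, P (U k),
      exists r, forall k, psi (U k) <= r,
      forall eta : R, 0 < eta -> exists k0, forall k l, (k0 <= k)%N -> (k0 <= l)%N ->
        psi (U k - U l) <= eta &
      forall g, P g -> forall eta : R, 0 < eta -> exists k0, forall k, (k0 <= k)%N ->
        `|T (U k) g| <= eta].
Proof.
have inv_gt0 k : 0 < k.+1%:R^-1 :> R by rewrite invr_gt0.
have inv_small (eta : R) : 0 < eta ->
    exists k0, forall k, (k0 <= k)%N -> k.+1%:R^-1 <= eta.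
  move=> eta0; have [k0 _ k0P] := near_infty_natSinv_lt (PosNum eta0).
  by exists k0 => k kk; apply: ltW; exact: k0P.
have /choice[Sd SdP] : forall k, exists Sd : seq V * R, [/\ good Sd.1, 0 < Sd.2 &
    forall U W, C Sd.1 U -> C Sd.1 W -> psi U <= Isup + Sd.2 ->
      psi W <= Isup + Sd.2 -> psi (U - W) <= k.+1%:R^-1].
  by move=> k; have [S [d SdP]] := near_min_close (inv_gt0 k); exists (S, d).
pose E k U := B U /\
  forall i, (i <= k)%N -> C (Sd i).1 U /\ psi U <= Isup + (Sd i).2.
have E_ex k S : good S -> exists2 U, E k U & C S U.
  move=> gS.
  have [S' [gS' SS' SkS']] : exists S', [/\ good S', {subset S <= S'} &
      forall i, (i <= k)%N -> {subset (Sd i).1 <= S'}].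
    exists (S ++ flatten [seq (Sd i).1 | i <- iota 0 k.+1]); split.
    - move=> phi; rewrite mem_cat => /orP[/gS//|/flatten_mapP[i _]].
      by have [+ _ _] := SdP i => /[apply].
    - by move=> phi; rewrite mem_cat => ->.
    - move=> i ik phi phiS; rewrite mem_cat; apply/orP; right.
      by apply/flatten_mapP; exists i => //; rewrite mem_iota.
  have [d d0 dP] : exists2 d, 0 < d & forall i, (i <= k)%N -> d <= (Sd i).2.
    elim: k {SkS'} => [|k [d d0 dP]].
      by exists (Sd 0).2 => [|i]; [have [] := SdP 0|rewrite leqn0 => /eqP->].
    exists (Num.min d (Sd k.+1).2); first by rewrite lt_min d0; have [] := SdP k.+1.
    move=> i; rewrite leq_eqVlt => /orP[/eqP->|ik]; first by rewrite ge_min lexx orbT.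
    by rewrite ge_min dP.
  have [U [BU CU] UI] := near_min gS' d0.
  exists U; last by split => // phi /SS'; exact: CU.
  split => // i ik.
  split; first by split => // phi /(SkS' _ ik); exact: CU.
  by rewrite (le_trans UI)// lerD2l dP.
have /choice[U UP] : forall k, exists U, E k U.
  by move=> k; have [//|U EU _] := @E_ex k [::]; exists U.
have E_close k U1 U2 : E k U1 -> E k U2 -> psi (U1 - U2) <= k.+1%:R^-1.
  move=> [_ /(_ _ (leqnn k))[C1 I1]] [_ /(_ _ (leqnn k))[C2 I2]].
  by have [_ _] := SdP k; apply.
have E_le k l U1 : (k <= l)%N -> E l U1 -> E k U1.
  by move=> kl [BU EU]; split => // i ik; apply: EU; exact: leq_trans kl.
have PUk k : P (U k) by have [[]] := UP k.
exists U; split => //.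
- by exists R0 => k; have [[]] := UP k.
- move=> eta /inv_small[k0 k0P]; exists k0 => k l k0k k0l.
  by rewrite (le_trans _ (k0P _ (leqnn k0)))// E_close//; apply: E_le (UP _).
move=> g Pg eta eta0; have [zeta z0 zP] := gap_residual Pg eta0.
have [d d0 dP] := T_bounded R0 z0.
have [k0 k0P] := inv_small _ d0; exists k0 => k k0k.
apply: zP; first by have [] := UP k.
move=> phi Bphi; have [Pphi psiphi] := Bphi.
have gphi : good [:: phi] by move=> f; rewrite inE => /eqP->.
have [W EW [[PW _] /(_ phi (mem_head _ _))TW]] := E_ex k _ gphi.
have -> : U k - phi = 1 *: (U k - W) + 1 *: (W - phi) by rewrite !scale1r addrA addrNK.
rewrite T_linear ?mul1r//; [|exact: PB|exact: PB].
have : `|T phi (U k - W)| <= zeta.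
  apply: dP => //; first exact: PB.
  by rewrite (le_trans (E_close _ _ _ (UP k) EW))// k0P.
by rewrite ler_norml => /andP[_]; lra.
Qed.
End Minty.

(** * Inequalities for real powers *)

Section real_powers.
Context {R : realType}.
Implicit Types x y s t p k : R.

(** The inequality of Young with the weights needed below; either x <= k y, and
    the first term dominates, or y < x / k, and the second one does. *)
Lemma powR_young p k x y : 1 < p -> 0 < k -> 0 <= x -> 0 <= y ->
  x `^ (p - 1) * y <= k `^ (p - 1) * y `^ p + k^-1 * x `^ p.
Proof.
move=> p1 k0 x0 y0; have p0 : 0 < p by lra.
have kx : 0 <= k^-1 * x `^ p by rewrite mulr_ge0 ?powR_ge0// invr_ge0 ltW.
have ky : 0 <= k `^ (p - 1) * y `^ p by rewrite mulr_ge0 ?powR_ge0.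
have [xky|kyx] := leP x (k * y).
  apply: (@le_trans _ _ ((k * y) `^ (p - 1) * y)).
    apply: ler_wpM2r => //; apply: ge0_ler_powR; rewrite ?nnegrE//; first lra.
    by rewrite mulr_ge0// ltW.
  by rewrite powRM ?(ltW k0)// -mulrA [_ * y]mulrC mulr_powRB1// lerDl.
apply: (@le_trans _ _ (x `^ (p - 1) * (k^-1 * x))).
  by apply: ler_wpM2l; rewrite ?powR_ge0// ler_pdivlMl// ltW.
by rewrite mulrCA [_ * x]mulrC mulr_powRB1// lerDr.
Qed.

Lemma powR_add_le p x y : 0 < p -> 0 <= x -> 0 <= y ->
  (x + y) `^ p <= 2 `^ p * (x `^ p + y `^ p).
Proof.
move=> p0; wlog xy : x y / x <= y => [hw x0 y0|x0 y0].
  have [xy|/ltW yx] := leP x y; first exact: hw.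
  by rewrite addrC [X in _ * X]addrC; exact: hw.
apply: (@le_trans _ _ ((2 * y) `^ p)).
  by apply: ge0_ler_powR; rewrite ?nnegrE; lra.
by rewrite powRM// ler_wpM2l ?powR_ge0// lerDr powR_ge0.
Qed.

Lemma powR_add1_le p x y : 0 < p -> 0 <= x -> 0 <= y ->
  (1 + (x + y)) `^ p <= (1 + 2 `^ p * 2 `^ p) * (1 + x `^ p + y `^ p).
Proof.
move=> p0 x0 y0.
have h2 := powR_add_le p0 ler01 (addr_ge0 x0 y0); rewrite powR1 in h2.
have h3 := ler_wpM2l (powR_ge0 2 p) (powR_add_le p0 x0 y0).
have p21 : 1 <= 2 `^ p by rewrite -[leLHS](powRr0 2) ler_powR ?ler1n// ltW.
have TT : 2 `^ p <= 2 `^ p * 2 `^ p by rewrite ler_peMr// powR_ge0.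
move: h2 h3 TT (powR_ge0 x p) (powR_ge0 y p); clear; rewrite mulrA.
by move: (2 `^ p * 2 `^ p) => U; nra.
Qed.

Lemma norm_powR_convex p x y t : 1 <= p -> 0 <= t <= 1 ->
  `|(1 - t) * x + t * y| `^ p <= (1 - t) * `|x| `^ p + t * `|y| `^ p.
Proof.
move=> p1 t01; have [t0 t1] := andP t01.
have p0 : 0 <= p by lra.
apply: (@le_trans _ _ (((1 - t) * `|x| + t * `|y|) `^ p)).
  apply: ge0_ler_powR; rewrite ?nnegrE// ?addr_ge0 ?mulr_ge0 ?subr_ge0//.
  by rewrite (le_trans (ler_normD _ _))// !normrM ger0_norm ?subr_ge0// (ger0_norm t0).
have := @convex_powR _ p p1 (Itv01 t0 t1) `|y| `|x|.
rewrite !inE/= !in_itv/= !normr_ge0 => /(_ isT isT).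
rewrite addrC [X in _ <= X]addrC; exact.
Qed.

(** With y = ln x, the power is x e^((p - 1) y), the second factor exceeds
    1 + (p - 1) y, and x - 1 <= y x. *)
Lemma bernoulli_powR_lt p x : 1 < p -> 0 <= x -> x != 1 -> 1 + p * (x - 1) < x `^ p.
Proof.
move=> p1; rewrite le_eqVlt => /predU1P[<- _|x0 x1].
  by rewrite powR0; [lra|rewrite gt_eqF//; lra].
have lnx0 : ln x != 0.
  by apply: contra x1 => /eqP lnx; rewrite -(lnK x0) lnx expR0.
pose y := ln x; have xE : x = expR y by rewrite /y lnK.
have xp : x `^ p = x * expR ((p - 1) * y).
  by rewrite /powR gt_eqF// {2}xE -expRD; congr expR; rewrite /y; ring.
have h1 : 1 + (p - 1) * y < expR ((p - 1) * y).
  by apply: expR_gt1Dx; rewrite mulf_neq0// subr_eq0 gt_eqF.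
have h2 : x - 1 <= y * x.
  have := expR_ge1Dx (- y); rewrite expRN -xE.
  by rewrite -(ler_pM2l x0) mulfV ?gt_eqF//; lra.
by rewrite xp; nra.
Qed.

(** The strict inequality of Bernoulli at 1 / m and at a / m, where m is the
    midpoint: the first-order terms cancel. *)
Lemma powR_mid_lt p a : 1 < p -> 0 <= a -> a < 1 ->
  ((1 + a) / 2) `^ p < (1 + a `^ p) / 2.
Proof.
move=> p1 a0 a1; set m := (1 + a) / 2.
have m0 : 0 < m by rewrite /m; lra.
have mV : m * m^-1 = 1 by rewrite mulfV// gt_eqF.
have mp0 : 0 < m `^ p by rewrite powR_gt0.
have h1 : 1 + p * (m^-1 - 1) < m^-1 `^ p.
  apply: bernoulli_powR_lt; rewrite ?invr_ge0 ?(ltW m0)//.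
  by rewrite invr_eq1 lt_eqF// /m; lra.
have am0 : 0 <= a / m by rewrite mulr_ge0 ?invr_ge0 ?(ltW m0).
have h2 : 1 + p * (a / m - 1) < (a / m) `^ p.
  apply: bernoulli_powR_lt => //.
  by rewrite lt_eqF// ltr_pdivrMr// mul1r /m; lra.
have Vp : m `^ p * m^-1 `^ p = 1.
  by rewrite -powRM ?invr_ge0 ?(ltW m0)// mV powR1.
have ap : m `^ p * (a / m) `^ p = a `^ p.
  by rewrite -powRM ?(ltW m0)// mulrC divfK// gt_eqF.
have : m `^ p * 2 < m `^ p * (m^-1 `^ p + (a / m) `^ p).
  rewrite ltr_pM2l//; apply: le_lt_trans (ltrD h1 h2).
  have -> : 1 + p * (m^-1 - 1) + (1 + p * (a / m - 1)) = 2 + p * ((1 + a) / m - 2).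
    by ring.
  by rewrite (_ : (1 + a) / m = 2) ?subrr ?mulr0 ?addr0// /m; field; rewrite gt_eqF//; lra.
by rewrite [X in _ < X]mulrDr Vp ap; lra.
Qed.

(** At 0 the difference quotient is, up to sign, |h| ^ (p - 1), which tends to 0
    because p > 1. *)
Lemma is_derive1_norm_powR p x : 1 < p ->
  is_derive x 1 (fun x => `|x| `^ p) (p * (Num.sg x * `|x| `^ (p - 1))).
Proof.
move=> p1; have p0 : 0 < p - 1 by lra.
case: (ltgtP 0 x) => [x0|x0|<-].
- rewrite (gtr0_norm x0) gtr0_sg// mul1r.
  apply: near_eq_is_derive (is_derive1_powR p x0).
  by near=> y; rewrite gtr0_norm//; near: y; exact: lt_nbhsr.
- rewrite (ltr0_norm x0) ltr0_sg// mulN1r mulrN.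
  have Nx0 : 0 < - x by rewrite oppr_gt0.
  apply: (@near_eq_is_derive _ _ _ (fun x => (- x) `^ p)).
    by near=> y; rewrite ltr0_norm//; near: y; exact: lt_nbhsl.
  have := @is_derive1_comp _ (fun x => x `^ p) -%R x _ _ (is_derive1_powR p Nx0) _.
  by move=> /(_ _ (is_deriveN _)) /is_derive_eq; apply; rewrite mulrN1.
- rewrite sgr0 mul0r mulr0.
  suff H : (h^-1 *: (((fun x => `|x| `^ p) \o shift 0) (h *: (1 : R)) - `|0 : R| `^ p))
      @[h --> 0^'] --> (0 : R).
    by apply: DeriveDef; [exact: cvgP H|exact: cvg_lim H].
  apply/cvgrPdist_lt => e e0; near=> h.
  have h0 : h != 0 by near: h; exact: nbhs_dnbhs_neq.
  rewrite sub0r normrN /= addr0 normr0 powR0 ?subr0; last by rewrite gt_eqF//; lra.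
  rewrite /GRing.scale/= mulr1 normrM normfV ger0_norm ?powR_ge0//.
  rewrite -(@mulr_powRB1 _ `|h|)//; last lra.
  have eE : e = (e `^ (p - 1)^-1) `^ (p - 1).
    by rewrite -powRrM mulVf ?gt_eqF// powRr1// ltW.
  rewrite mulKf ?normr_eq0// [ltRHS]eE.
  apply: gt0_ltr_powR; rewrite ?nnegrE ?powR_ge0//.
  near: h; apply: dnbhs0_lt; exact: powR_gt0.
Unshelve. all: end_near. Qed.

Lemma continuous_norm_powR p : 1 < p -> continuous (fun x => `|x| `^ p).
Proof.
move=> p1 x; apply: differentiable_continuous; apply/derivable1_diffP.
by have [] := is_derive1_norm_powR x p1.
Qed.

(** Uniform convexity on the line. By symmetry and homogeneity it suffices to take
    the points 1 and t with |t| <= 1. The convexity defect is continuous and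
    positive on [-1, 1 - tau], hence bounded below there, while for t in
    [1 - tau, 1] the left side is at most eta. *)
Lemma powR_uconvex p eta : 1 < p -> 0 < eta -> exists2 C, 0 < C & forall x y,
  `|x - y| `^ p <= eta * (`|x| `^ p + `|y| `^ p) +
    C * (`|x| `^ p / 2 + `|y| `^ p / 2 - `|(x + y) / 2| `^ p).
Proof.
move=> p1 eta0; have p0 : 0 < p by lra.
(* the convexity defect *)
pose D x y := `|x| `^ p / 2 + `|y| `^ p / 2 - `|(x + y) / 2| `^ p.
have D0 x y : 0 <= D x y.
  have := @norm_powR_convex p x y 2^-1 (ltW p1).
  have -> : (1 - 2^-1) * x + 2^-1 * y = (x + y) / 2 by field.
  by move=> /(_ ltac:(lra)); rewrite /D; lra.
pose tau := Num.min 1 (eta `^ p^-1).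
have tau0 : 0 < tau by rewrite lt_min ltr01 powR_gt0.
have tau1 : tau <= 1 by rewrite ge_min lexx.
have taup : tau `^ p <= eta.
  apply: (@le_trans _ _ ((eta `^ p^-1) `^ p)).
    by apply: ge0_ler_powR; rewrite ?nnegrE ?powR_ge0 ?(ltW tau0) ?(ltW p0)// ge_min lexx orbT.
  by rewrite -powRrM mulVf ?gt_eqF// powRr1// ltW.
have Dpos t : -1 <= t -> t < 1 -> 0 < D 1 t.
  move=> t1 t2; rewrite /D normr1 powR1.
  have [t0|t0] := leP 0 t.
    rewrite !ger0_norm// ?divr_ge0 ?addr_ge0// -mulrDl subr_gt0.
    exact: powR_mid_lt.
  have [->|tN1] := eqVneq t (-1).
    by rewrite normrN1 powR1 subrr mul0r normr0 powR0 ?gt_eqF//; lra.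
  have tlt : -1 < t by rewrite lt_neqAle eq_sym tN1.
  have := @powR_mid_lt p (- t) p1 ltac:(lra) ltac:(lra).
  rewrite (ltr0_norm t0) [`|_ / _|]ger0_norm; last lra.
  suff : ((1 + t) / 2) `^ p <= ((1 + - t) / 2) `^ p by lra.
  by apply: ge0_ler_powR; rewrite ?nnegrE; lra.
have cD : continuous (D 1).
  move=> t; apply: cvgB.
    by apply: cvgD; [exact: cvg_cst|apply: cvgMl; exact: continuous_norm_powR].
  apply: (@continuous_comp _ _ _ (fun t => (1 + t) / 2) (fun x => `|x| `^ p)).
    by apply: cvgMl; apply: cvgD; [exact: cvg_cst|exact: cvg_id].
  exact: continuous_norm_powR.
have [t0 + Dt0] := @EVT_min _ (D 1) (-1) (1 - tau) ltac:(lra) (continuous_subspaceT cD).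
rewrite in_itv/= => /andP[t0l t0r].
set m := D 1 t0 in Dt0; have m0 : 0 < m by apply: Dpos => //; lra.
exists (2 `^ p / m) => [|x y]; first by rewrite divr_gt0// powR_gt0.
rewrite -/(D x y).
wlog yx : x y / `|y| <= `|x|.
  move=> hw; have [|/ltW xy] := leP `|y| `|x|; first exact: hw.
  have -> : D x y = D y x by rewrite /D [y + x]addrC; ring.
  by rewrite distrC [_ `^ p + _]addrC; exact: hw.
have [x0|x0] := eqVneq x 0.
  have y0 : y = 0 by apply/eqP; move: yx; rewrite x0 normr0 normr_le0.
  have -> : x - y = 0 by rewrite x0 y0 subrr.
  rewrite normr0 powR0 ?gt_eqF// addr_ge0//; apply: mulr_ge0 => //.
  - exact: ltW.
  - by rewrite mulr_ge0 ?powR_ge0// invr_ge0 ltW.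
pose t := y / x.
have yE : y = x * t by rewrite /t mulrC divfK.
have xp : 0 < `|x| `^ p by apply: powR_gt0; rewrite normr_gt0.
have DE : D x y = `|x| `^ p * D 1 t.
  rewrite /D yE -{3}[x]mulr1 -mulrDr -mulrA !normrM !powRM// normr1 powR1; ring.
have -> : x - y = x * (1 - t) by rewrite yE; ring.
have yN : `|y| = `|x| * `|t| by rewrite -normrM -yE.
rewrite DE yN normrM !powRM//.
have -> : eta * (`|x| `^ p + `|x| `^ p * `|t| `^ p) + 2 `^ p / m * (`|x| `^ p * D 1 t) =
  `|x| `^ p * (eta * (1 + `|t| `^ p) + 2 `^ p / m * D 1 t) by ring.
rewrite ler_pM2l//.
have t11 : -1 <= t <= 1.
  by rewrite -ler_norml /t normrM normfV ler_pdivrMr ?normr_gt0// mul1r.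
have [t1 t2] := andP t11.
have tp0 : 0 <= `|t| `^ p by rewrite powR_ge0.
have [ttau|ttau] := leP (1 - t) tau.
  have : `|1 - t| `^ p <= eta.
    apply: le_trans taup; apply: ge0_ler_powR; rewrite ?nnegrE//; try lra.
    by rewrite ger0_norm//; lra.
  have : 0 <= 2 `^ p / m * D 1 t by rewrite mulr_ge0// divr_ge0 ?powR_ge0// ltW.
  nra.
have mD : m <= D 1 t by apply: Dt0; rewrite in_itv/=; lra.
have : 2 `^ p <= 2 `^ p / m * D 1 t.
  by rewrite -mulrA ler_peMr ?powR_ge0// mulrC ler_pdivlMr// mul1r.
have : `|1 - t| `^ p <= 2 `^ p.
  by apply: ge0_ler_powR; rewrite ?nnegrE//; try lra; rewrite ger0_norm; lra.
have : 0 <= eta * (1 + `|t| `^ p) by rewrite mulr_ge0 ?addr_ge0// ltW.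
by lra.
Qed.

(** Evaluation at the vertex - b / c of the parabola. *)
Lemma discriminant_le (a b c : R) : 0 <= c -> (forall t, 0 <= a + 2 * b * t + c * t ^+ 2) ->
  b ^+ 2 <= a * c.
Proof.
move=> c_ge0 h.
have [c0|c0] := eqVneq c 0.
  have [->|b0] := eqVneq b 0; first by rewrite c0 mulr0 expr0n.
  have := h (- (a + 1) / (2 * b)); rewrite c0 mul0r addr0.
  have -> : 2 * b * (- (a + 1) / (2 * b)) = - (a + 1) by field.
  by lra.
have cp : 0 < c by rewrite lt_neqAle eq_sym c0.
have := h (- b / c).
have -> : a + 2 * b * (- b / c) + c * (- b / c) ^+ 2 = (a * c - b ^+ 2) / c by field.
by rewrite pmulr_lge0 ?invr_gt0// subr_ge0.
Qed.

(** If d <= tau m, the factor m ^ (p - 2) d is at most tau m ^ (p - 1). Otherwise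
    m <= d / tau, and d <= 2 m is used instead to bound m ^ (p - 2) d by
    2 m ^ (p - 1); this also disposes of the singularity at m = 0 when p < 2. *)
Lemma powR_split p tau : 1 < p -> 0 < tau -> exists2 C, 0 <= C & forall m d h,
  0 <= m -> 0 <= d -> 0 <= h -> d <= 2 * m ->
  m `^ (p - 2) * d * h <= tau * (m `^ p + h `^ p) + C * d `^ p.
Proof.
move=> p1 tau0; have p10 : 0 < p - 1 by lra.
pose k := (tau / 2) `^ (p - 1)^-1.
have k0 : 0 < k by rewrite powR_gt0 ?divr_gt0.
have kp : k `^ (p - 1) = tau / 2.
  by rewrite /k -powRrM mulVf ?gt_eqF// powRr1// divr_ge0// ltW.
exists (2 * (k^-1 * tau^-1 `^ p)) => [|m d h m0 d0 h0 dm].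
  by rewrite !mulr_ge0 ?powR_ge0 ?invr_ge0 ?(ltW k0).
have mp := powR_ge0 m p; have hp := powR_ge0 h p; have dp := powR_ge0 d p.
have Cd : 0 <= 2 * (k^-1 * tau^-1 `^ p) * d `^ p.
  by rewrite !mulr_ge0 ?powR_ge0 ?invr_ge0 ?(ltW k0).
have [md0|mn0] := eqVneq m 0.
  have -> : d = 0 by lra.
  by rewrite mulr0 mul0r addr_ge0 ?mulr_ge0 ?addr_ge0 ?invr_ge0 ?powR_ge0 ?ltW.
have mE : m `^ (p - 2) * m = m `^ (p - 1).
  rewrite -[X in _ * X](@powRr1 R)// -powRD; last by rewrite mn0 implybT.
  by congr powR; lra.
have [dtm|tmd] := leP d (tau * m).
  apply: (@le_trans _ _ (tau * (m `^ (p - 1) * h))).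
    rewrite -mE mulrA; apply: ler_wpM2r => //.
    by rewrite mulrCA; apply: ler_wpM2l; rewrite ?powR_ge0.
  have := powR_young p1 ltr01 m0 h0; rewrite powR1 invr1 !mul1r => hy.
  by have := ler_wpM2l (ltW tau0) hy; lra.
have mdt : m <= d / tau by rewrite ler_pdivlMr// mulrC ltW.
have dt0 : 0 <= d / tau by rewrite divr_ge0// ltW.
apply: (@le_trans _ _ (2 * ((d / tau) `^ (p - 1) * h))).
  rewrite mulrA; apply: ler_wpM2r => //.
  apply: (@le_trans _ _ (2 * m `^ (p - 1))).
    by rewrite -mE mulrCA; apply: ler_wpM2l; rewrite ?powR_ge0.
  by apply: ler_wpM2l => //; apply: ge0_ler_powR; rewrite ?nnegrE// ltW.
have dtp : (d / tau) `^ p = d `^ p * tau^-1 `^ p.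
  by rewrite powRM// invr_ge0 ltW.
have := powR_young p1 k0 dt0 h0; rewrite kp dtp => hy.
have : 2 * ((d / tau) `^ (p - 1) * h) <=
    tau * h `^ p + 2 * (k^-1 * tau^-1 `^ p) * d `^ p by lra.
have := mulr_ge0 (ltW tau0) mp; lra.
Qed.

Lemma sum_powR_le (I : Type) (r : seq I) p : 0 < p -> exists2 C, 0 <= C &
  forall f : I -> R, (forall i, 0 <= f i) ->
    (\sum_(i <- r) f i) `^ p <= C * \sum_(i <- r) f i `^ p.
Proof.
move=> p0; elim: r => [|i r [C C0 IH]].
  by exists 0 => // f f0; rewrite !big_nil powR0 ?gt_eqF// mulr0.
exists (2 `^ p * (1 + C)) => [|f f0]; first by rewrite mulr_ge0 ?powR_ge0 ?addr_ge0.
rewrite !big_cons; apply: le_trans (powR_add_le p0 (f0 i) _) _; first exact: sumr_ge0.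
rewrite -mulrA; apply: ler_wpM2l; first exact: powR_ge0.
have := IH f f0; have : 0 <= \sum_(j <- r) f j `^ p.
  by apply: sumr_ge0 => j _; exact: powR_ge0.
by have := powR_ge0 (f i) p; nra.
Qed.
End real_powers.

(** * The flux as a function of a complex matrix *)

Section complex_matrices.
Context {R : realType}.
Variables (N n : nat).
Implicit Types (A B H X : 'M[R[i]]_(N, n)) (p eps M tau : R).

(** The Euclidean inner product of C^(N x n) as a real vector space. *)
Definition reinner A B : R := complex.Re (cinner A B).

Lemma Re_sum (I : Type) (r : seq I) (f : I -> R[i]) :
  complex.Re (\sum_(i <- r) f i) = \sum_(i <- r) complex.Re (f i).
Proof. by elim/big_rec2 : _ => // i _ y _ <-; case: (f i) y => ? ? []. Qed.

Lemma Im_sum (I : Type) (r : seq I) (f : I -> R[i]) :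
  complex.Im (\sum_(i <- r) f i) = \sum_(i <- r) complex.Im (f i).
Proof. by elim/big_rec2 : _ => // i _ y _ <-; case: (f i) y => ? ? []. Qed.

Lemma reinnerE A B : reinner A B = \sum_j \sum_k
  (complex.Re (A j k) * complex.Re (B j k) + complex.Im (A j k) * complex.Im (B j k)).
Proof.
rewrite /reinner /cinner Re_sum; apply: eq_bigr => j _; rewrite Re_sum.
apply: eq_bigr => k _; case: (A j k) (B j k) => [a b] [c d] /=.
by rewrite mulrN opprK.
Qed.

Lemma reinner_ge0 A : 0 <= reinner A A.
Proof.
rewrite reinnerE; apply: sumr_ge0 => j _; apply: sumr_ge0 => k _.
by rewrite -!expr2 addr_ge0 ?sqr_ge0.
Qed.

Lemma cnorm_ge0 A : 0 <= cnorm A.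
Proof. exact: sqrtr_ge0. Qed.

Lemma cnorm_sqr A : cnorm A ^+ 2 = reinner A A.
Proof. by rewrite sqr_sqrtr// reinner_ge0. Qed.

Lemma reinnerC A B : reinner A B = reinner B A.
Proof.
rewrite !reinnerE; apply: eq_bigr => j _; apply: eq_bigr => k _.
by rewrite [X in X + _]mulrC [X in _ + X]mulrC.
Qed.

Lemma reinner_combl (a b : R) A B H :
  reinner (a%:C%C *: A + b%:C%C *: B) H = a * reinner A H + b * reinner B H.
Proof.
rewrite !reinnerE !mulr_sumr -big_split; apply: eq_bigr => j _ /=.
rewrite !mulr_sumr -big_split; apply: eq_bigr => k _ /=; rewrite !mxE.
by case: (A j k) (B j k) (H j k) => [? ?] [? ?] [? ?] /=; ring.
Qed.

Lemma reinner_combr (a b : R) A B H :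
  reinner H (a%:C%C *: A + b%:C%C *: B) = a * reinner H A + b * reinner H B.
Proof. by rewrite !(reinnerC H) reinner_combl. Qed.

Lemma reinnerBl A B H : reinner (A - B) H = reinner A H - reinner B H.
Proof.
have := reinner_combl 1 (-1) A B H; rewrite mul1r mulN1r => <-.
by rewrite rmorph1 rmorphN1 scale1r scaleN1r.
Qed.

Lemma reinnerBr A B H : reinner H (A - B) = reinner H A - reinner H B.
Proof. by rewrite !(reinnerC H) reinnerBl. Qed.

Lemma normr_reinner_le A B : `|reinner A B| <= cnorm A * cnorm B.
Proof.
rewrite -(@ler_pXn2r _ 2) ?nnegrE ?mulr_ge0 ?cnorm_ge0//.
rewrite real_normK ?num_real// exprMn !cnorm_sqr.
apply: discriminant_le => [|t]; first exact: reinner_ge0.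
have := reinner_ge0 (1%:C%C *: A + t%:C%C *: B).
rewrite reinner_combl !reinner_combr (reinnerC B A).
by move=> /le_trans; apply; rewrite le_eqVlt; apply/orP; left; apply/eqP; ring.
Qed.

Lemma cnormB_le A B : cnorm (A - B) <= cnorm A + cnorm B.
Proof.
rewrite -(@ler_pXn2r _ 2) ?nnegrE ?addr_ge0 ?cnorm_ge0//.
rewrite cnorm_sqr reinnerBl !reinnerBr (reinnerC B A) sqrrD !cnorm_sqr.
have := normr_reinner_le A B; rewrite ler_norml => /andP[]; lra.
Qed.

Lemma cnorm0 : cnorm (0 : 'M[R[i]]_(N, n)) = 0.
Proof.
have := reinner_combl 0 0 0 0 (0 : 'M[R[i]]_(N, n)); rewrite !mul0r addr0.
rewrite rmorph0 !scale0r addr0 -cnorm_sqr => /eqP.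
by rewrite sqrf_eq0 => /eqP.
Qed.

Lemma cnormZ (w : R) A : 0 <= w -> cnorm (w%:C%C *: A) = w * cnorm A.
Proof.
move=> w0; apply/eqP; rewrite -(@eqrXn2 _ 2) ?mulr_ge0 ?cnorm_ge0//.
rewrite exprMn !cnorm_sqr; have := reinner_combl w 0 A 0 (w%:C%C *: A).
rewrite mul0r !scaler0 !addr0 => ->.
have := reinner_combr w 0 A 0 A; rewrite mul0r !scaler0 !addr0 => ->.
by apply/eqP; ring.
Qed.

(** This is why real parts suffice: the imaginary part of the weak equation for B
    is its real part for i B. *)
Lemma Im_cinnerE A B : complex.Im (cinner A B) = reinner A ('i%C *: B).
Proof.
rewrite /reinner /cinner Im_sum Re_sum; apply: eq_bigr => j _.
rewrite Im_sum Re_sum; apply: eq_bigr => k _; rewrite mxE.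
by case: (A j k) (B j k) => [a b] [c d] /=; ring.
Qed.

Lemma reinner_iscale A B : reinner ('i%C *: A) ('i%C *: B) = reinner A B.
Proof.
rewrite !reinnerE; apply: eq_bigr => j _; apply: eq_bigr => k _; rewrite !mxE.
by case: (A j k) (B j k) => [? ?] [? ?] /=; ring.
Qed.

Lemma cnorm_iscale A : cnorm ('i%C *: A) = cnorm A.
Proof.
by apply/eqP; rewrite -(@eqrXn2 _ 2) ?cnorm_ge0// !cnorm_sqr reinner_iscale.
Qed.

Lemma reinnerZl (z : R[i]) A B :
  reinner (z *: A) B = complex.Re z * reinner A B - complex.Im z * reinner A ('i%C *: B).
Proof.
rewrite !reinnerE !mulr_sumr -sumrB; apply: eq_bigr => j _ /=.
rewrite !mulr_sumr -sumrB; apply: eq_bigr => k _ /=; rewrite !mxE.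
by case: z (A j k) (B j k) => [? ?] [? ?] [? ?] /=; ring.
Qed.

(** The imaginary part of z rotates A by a right angle, so it can take away at
    most |Im z| |A| |B|. *)
Lemma reinnerZl_ge (z : R[i]) A B :
  complex.Re z * reinner A B - `|complex.Im z| * (cnorm A * cnorm B) <=
  reinner (z *: A) B.
Proof.
rewrite reinnerZl lerD2l lerN2; apply: le_trans (ler_norm _) _.
by rewrite normrM ler_wpM2l// -(cnorm_iscale B) normr_reinner_le.
Qed.

Lemma normr_reinnerZl_le M (z : R[i]) A B :
  `|complex.Re z| <= M -> `|complex.Im z| <= M ->
  `|reinner (z *: A) B| <= 2 * M * (cnorm A * cnorm B).
Proof.
move=> zr zi; rewrite reinnerZl; apply: le_trans (ler_normB _ _) _.
rewrite !normrM; have -> : 2 * M * (cnorm A * cnorm B) =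
  M * (cnorm A * cnorm B) + M * (cnorm A * cnorm B) by ring.
apply: lerD; apply: ler_pM => //; first exact: normr_reinner_le.
by rewrite -(cnorm_iscale B) normr_reinner_le.
Qed.

Lemma reinner_flux p eps A B : reinner (flux p eps A) B = weight p eps A * reinner A B.
Proof.
by have := reinner_combl (weight p eps A) 0 A 0 B; rewrite mul0r !scaler0 !addr0.
Qed.

Let weightE p m : 0 <= m -> (m ^+ 2) `^ ((p - 2) / 2) = m `^ (p - 2).
Proof.
by move=> m0; rewrite -powR_mulrn// -powRrM; congr powR; field.
Qed.

(** The flux has size at most m ^ (p - 1) with m^2 = eps^2 + |A|^2, and
    m <= 1 + |A|. *)
Lemma flux_young p eps tau : 1 < p -> 0 <= eps <= 1 -> 0 < tau ->
  exists2 C, 0 <= C & forall A H, cnorm (flux p eps A) * cnorm H <=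
    tau * (1 + cnorm A `^ p) + C * cnorm H `^ p.
Proof.
move=> p1 /andP[e0 e1] tau0; have p0 : 0 < p by lra.
have k0 : 0 < 2 `^ p / tau by rewrite divr_gt0 ?powR_gt0.
exists ((2 `^ p / tau) `^ (p - 1)) => [|A H]; first exact: powR_ge0.
have x0 := cnorm_ge0 A; have h0 := cnorm_ge0 H.
pose m := Num.sqrt (eps ^+ 2 + cnorm A ^+ 2).
have m2 : m ^+ 2 = eps ^+ 2 + cnorm A ^+ 2 by rewrite sqr_sqrtr// addr_ge0 ?sqr_ge0.
have m0 : 0 <= m by exact: sqrtr_ge0.
have xm : cnorm A <= m.
  by rewrite -(@ler_pXn2r _ 2) ?nnegrE// m2 lerDr sqr_ge0.
have m1 : m <= 1 + cnorm A.
  by rewrite -(@ler_pXn2r _ 2) ?nnegrE// ?addr_ge0// m2; nra.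
rewrite /flux /weight -m2 weightE// cnormZ ?powR_ge0//.
have mx : m `^ (p - 2) * cnorm A <= m `^ (p - 1).
  have [mz|mn0] := eqVneq m 0; first by rewrite (_ : cnorm A = 0) ?mulr0 ?powR_ge0//; lra.
  apply: (@le_trans _ _ (m `^ (p - 2) * m)); first by rewrite ler_wpM2l ?powR_ge0.
  rewrite -[X in _ * X](@powRr1 R)// -powRD; last by rewrite mn0 implybT.
  by rewrite (_ : p - 2 + 1 = p - 1)//; lra.
apply: (@le_trans _ _ (m `^ (p - 1) * cnorm H)); first by rewrite ler_wpM2r.
apply: (le_trans (powR_young p1 k0 m0 h0)); rewrite addrC lerD2r invf_div.
rewrite mulrAC ler_pdivrMr ?powR_gt0// -mulrA ler_pM2l// mulrC.
apply: (@le_trans _ _ ((1 + cnorm A) `^ p)).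
  by apply: ge0_ler_powR; rewrite ?nnegrE ?addr_ge0// ltW.
by have := powR_add_le p0 ler01 x0; rewrite powR1.
Qed.

(** With m^2 = eps^2 + |A|^2 + |B|^2 and d = |A - B| <= 2 m, the second structure
    inequality bounds the difference by c2 m ^ (p - 2) d, and [powR_split]
    applies. *)
Lemma flux_ucontinuous p eps c1 c2 tau : 1 < p -> 0 <= eps <= 1 ->
  structure_constants p c1 c2 -> 0 < tau ->
  exists2 C, 0 <= C & forall A B H, cnorm (flux p eps A - flux p eps B) * cnorm H <=
    tau * (1 + cnorm A `^ p + cnorm B `^ p + cnorm H `^ p) + C * cnorm (A - B) `^ p.
Proof.
move=> p1 e01 [c10 c20 hc] tau0; have p0 : 0 < p by lra.
have [e0 e1] := andP e01.
pose K := 1 + 2 `^ p * 2 `^ p; have K1 : 1 <= K by rewrite lerDl mulr_ge0 ?powR_ge0.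
have K0 : 0 < K by lra.
have t0 : 0 < tau / K / c2 by rewrite !divr_gt0.
have [C C0 CP] := powR_split p1 t0.
exists (c2 * C) => [|A B H]; first by rewrite mulr_ge0// ltW.
have [_ hcAB] := hc _ _ A B eps e01.
have x0 := cnorm_ge0 A; have y0 := cnorm_ge0 B; have h0 := cnorm_ge0 H.
have d0 := cnorm_ge0 (A - B).
pose m := Num.sqrt (eps ^+ 2 + cnorm A ^+ 2 + cnorm B ^+ 2).
have m2 : m ^+ 2 = eps ^+ 2 + cnorm A ^+ 2 + cnorm B ^+ 2.
  by rewrite sqr_sqrtr// !addr_ge0 ?sqr_ge0.
have m0 : 0 <= m by exact: sqrtr_ge0.
have e2 : 0 <= eps ^+ 2 by rewrite sqr_ge0.
have xm : cnorm A <= m.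
  by rewrite -(@ler_pXn2r _ 2) ?nnegrE// m2; have := sqr_ge0 (cnorm B); lra.
have ym : cnorm B <= m.
  by rewrite -(@ler_pXn2r _ 2) ?nnegrE// m2; have := sqr_ge0 (cnorm A); lra.
have m1 : m <= 1 + (cnorm A + cnorm B).
  by rewrite -(@ler_pXn2r _ 2) ?nnegrE// ?addr_ge0// m2; nra.
have dm : cnorm (A - B) <= 2 * m by have := cnormB_le A B; lra.
have mp : m `^ p <= K * (1 + cnorm A `^ p + cnorm B `^ p).
  have h1 : m `^ p <= (1 + (cnorm A + cnorm B)) `^ p.
    by apply: ge0_ler_powR; rewrite ?nnegrE ?addr_ge0// ltW.
  exact: le_trans h1 (powR_add1_le p0 x0 y0).
apply: (@le_trans _ _ (c2 * (m `^ (p - 2) * cnorm (A - B) * cnorm H))).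
  by rewrite -weightE// m2 !mulrA; apply: ler_wpM2r.
have := ler_wpM2l (ltW c20) (CP _ _ _ m0 d0 h0 dm) => /le_trans; apply.
rewrite mulrDr [X in _ + X]mulrA lerD2r.
have -> : c2 * (tau / K / c2 * (m `^ p + cnorm H `^ p)) =
    tau * ((m `^ p + cnorm H `^ p) / K) by field; rewrite !gt_eqF.
rewrite ler_pM2l// ler_pdivrMr//.
have hK : cnorm H `^ p <= K * cnorm H `^ p by rewrite ler_peMl// powR_ge0.
by apply: le_trans (lerD mp hK) _; rewrite -mulrDr mulrC.
Qed.

(** For p >= 2 the weight is at least |A| ^ (p - 2). For p < 2 it is decreasing in
    eps: if |A| >= 1 >= eps it is at least (2 |A|^2) ^ ((p - 2) / 2), and if
    |A| < 1 the term - 1 makes the left side nonpositive. *)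
Lemma flux_coercive p eps : 1 < p -> 0 <= eps <= 1 -> exists2 c0, 0 < c0 &
  forall A, c0 * cnorm A `^ p - 1 <= reinner (flux p eps A) A.
Proof.
move=> p1 /andP[e0 e1]; have p0 : 0 < p by lra.
exists (Num.min 1 (2 `^ ((p - 2) / 2))) => [|A].
  by rewrite lt_min ltr01 powR_gt0.
have x0 := cnorm_ge0 A.
rewrite reinner_flux -cnorm_sqr.
have w0 : 0 <= weight p eps A by exact: powR_ge0.
have xp0 := powR_ge0 (cnorm A) p.
have powE : cnorm A `^ p = cnorm A `^ (p - 2) * cnorm A ^+ 2.
  have [->|xn0] := eqVneq (cnorm A) 0.
    by rewrite powR0 ?gt_eqF// expr0n mulr0.
  rewrite -powR_mulrn// -powRD; last by rewrite xn0 implybT.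
  by congr powR; lra.
have [p2|p2] := leP 2 p.
  apply: (@le_trans _ _ (cnorm A `^ p)).
    have : Num.min 1 (2 `^ ((p - 2) / 2)) <= 1 :> R by rewrite ge_min lexx.
    nra.
  rewrite powE; apply: ler_wpM2r; first exact: sqr_ge0.
  rewrite -weightE//; apply: ge0_ler_powR; rewrite ?nnegrE ?addr_ge0 ?sqr_ge0//; first lra.
  by rewrite lerDr sqr_ge0.
have [x1|x1] := leP 1 (cnorm A); last first.
  apply: (@le_trans _ _ 0); last by rewrite mulr_ge0 ?sqr_ge0.
  have : Num.min 1 (2 `^ ((p - 2) / 2)) <= 1 :> R by rewrite ge_min lexx.
  have : cnorm A `^ p <= 1 `^ p.
    by apply: ge0_ler_powR; rewrite ?nnegrE// ltW.
  rewrite powR1; nra.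
apply: (@le_trans _ _ (2 `^ ((p - 2) / 2) * cnorm A `^ p)).
  have : Num.min 1 (2 `^ ((p - 2) / 2)) <= 2 `^ ((p - 2) / 2) :> R.
    by rewrite ge_min lexx orbT.
  nra.
rewrite powE mulrA; apply: ler_wpM2r; first exact: sqr_ge0.
rewrite -weightE// -powRM ?sqr_ge0// /weight.
have -> : (p - 2) / 2 = - ((2 - p) / 2) by field.
have x20 : 0 < cnorm A ^+ 2 by rewrite exprn_gt0//; lra.
rewrite !powRN lef_pV2 ?posrE; first last.
- by apply: powR_gt0; rewrite ltr_wpDl ?sqr_ge0.
- by apply: powR_gt0; rewrite mulr_gt0.
apply: ge0_ler_powR; rewrite ?nnegrE ?addr_ge0 ?mulr_ge0 ?sqr_ge0//; first lra.
rewrite mulrDl mul1r lerD2r; apply: (@le_trans _ _ 1).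
  by rewrite expr_le1.
by rewrite expr_ge1.
Qed.

(** The real part of z gains c1 times weight2 |A - B|^2, the imaginary part costs
    at most c2 times the same quantity. *)
Lemma flux_monotone p eps c1 c2 (z : R[i]) A B : 0 <= eps <= 1 ->
  structure_constants p c1 c2 -> 0 <= complex.Re z ->
  c2 * `|complex.Im z| <= c1 * complex.Re z ->
  0 <= reinner (z *: (flux p eps A - flux p eps B)) (A - B).
Proof.
move=> e01 [c10 c20 hc] z0 cz; have [h1 h2] := hc _ _ A B eps e01.
apply: le_trans (reinnerZl_ge _ _ _); rewrite subr_ge0.
have d0 := cnorm_ge0 (A - B); have w0 : 0 <= weight2 p eps A B by exact: powR_ge0.
have := ler_wpM2l z0 h1; apply: le_trans.
have := ler_wpM2l (normr_ge0 (complex.Im z)) (ler_wpM2r d0 h2) => /le_trans; apply.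
have := ler_wpM2r (mulr_ge0 w0 (sqr_ge0 (cnorm (A - B)))) cz.
by rewrite -/(reinner _ _); congr (_ <= _); ring.
Qed.
End complex_matrices.

(** * Lebesgue measure on row vectors and translations *)

Lemma measurable_scaleB d (T : measurableType d) (R : realType) (c : R) (u v : T -> R) :
  measurable_fun setT u -> measurable_fun setT v ->
  measurable_fun setT (fun x => c * (u x - v x)).
Proof. by move=> mu mv; apply: measurable_funM => //; exact: measurable_funB. Qed.

Section finite_support.
Context d {T : measurableType d} {R : realType} (mu : {measure set T -> \bar R}).
Variables (D : set T) (mD : measurable D) (muD : (mu D < +oo)%E).

Lemma integrable_bounded (c : R) (g : T -> R) : measurable_fun D g ->
  (forall x, D x -> `|g x| <= c) -> mu.-integrable D (EFin \o g).
Proof.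
move=> mg gc; apply/integrableP; split; first exact/measurable_EFinP.
apply: (@le_lt_trans _ _ (\int[mu]_(x in D) (cst `|c|%:E) x)%E).
  apply: ge0_le_integral => //.
  - by do 2 apply: measurableT_comp => //.
  - by move=> x Dx; rewrite /= lee_fin (le_trans (gc _ Dx))// ler_norm.
by rewrite integral_cst// lte_mul_pinfty.
Qed.

Lemma integrable_bounded_support (c : R) (g : T -> R) : measurable_fun setT g ->
  (forall x, `|g x| <= c) -> (forall x, ~ D x -> g x = 0) ->
  mu.-integrable setT (EFin \o g).
Proof.
move=> mg gc g0; have -> : EFin \o g = (EFin \o g) \_ D.
  apply/funext => x; rewrite /patch; case: ifPn => //.
  by rewrite notin_setE => /g0 /= ->.
apply/(integrable_mkcond _ mD); apply: (@integrable_bounded c) => //.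
exact: measurable_funTS.
Qed.

(** Bounded convergence on a set of finite measure. *)
Lemma Rintegral_lim_eq0 (f : nat -> T -> R) (g : T -> R) (c : R) :
  (forall k, measurable_fun setT (f k)) ->
  (forall k x, `|f k x| <= c) -> (forall k x, ~ D x -> f k x = 0) ->
  (forall x, f k x @[k --> \oo] --> g x) ->
  (forall k, \int[mu]_x f k x = 0) -> \int[mu]_x g x = 0.
Proof.
move=> mf fc f0 fg intf.
have mg : measurable_fun setT g by apply: (measurable_fun_cvg mf) => x _; exact: fg.
have ic : mu.-integrable setT (EFin \o (cst c \_ D)).
  rewrite -restrict_EFin; apply/(integrable_mkcond _ mD).
  by apply: (@integrable_bounded `|c|) => //; exact: measurable_cst.
have fle k x : `|f k x| <= (cst c \_ D) x.
  rewrite /patch; case: ifPn => [_|]; first exact: fc.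
  by rewrite notin_setE => /f0 ->; rewrite normr0.
have [] := @dominated_convergence _ _ _ mu setT measurableT (fun k => EFin \o f k)
  (EFin \o g) (EFin \o (cst c \_ D)).
- by move=> k; exact: measurableT_comp.
- exact: measurableT_comp.
- by apply: aeW => x _; apply: cvg_EFin; [near=> k|exact: fg].
- exact: ic.
- by apply: aeW => x k _; rewrite /= lee_fin.
move=> _ _ lim_f.
have intf0 k : (\int[mu]_x (EFin \o f k) x = 0)%E.
  rewrite -[LHS]fineK; first by rewrite [fine _]intf.
  apply: integrable_fin_num => //.
  by apply: (integrable_bounded_support (mf k) (fc k)) => x; exact: f0.
have {}lim_f : (\int[mu]_x (EFin \o f k) x)%E @[k --> \oo] -->
  (\int[mu]_x (EFin \o g) x)%E by exact: lim_f.
rewrite /Rintegral; have -> : (\int[mu]_x (g x)%:E = 0)%E; last by [].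
apply: (cvg_unique (@ereal_hausdorff R) lim_f).
by rewrite (funext intf0); exact: cvg_cst.
Unshelve. all: end_near.
Qed.
End finite_support.

Section rV_measure.
Context {R : realType} {n : nat}.
Notation borel := (rV_borel R n).
Notation leb := (rV_lebesgue R n).
Local Notation mu := (lebesgue_measure_rV R n).

Lemma measurable_borel_lebesgue (A : set 'rV[R]_n) :
  measurable (A : set borel) -> measurable (A : set leb).
Proof. by move=> mA; apply: sub_caratheodory; exact: sub_sigma_algebra. Qed.

Lemma measurable_box (A : 'I_n -> set (measurableTypeR R)) :
  (forall i, measurable (A i)) ->
  measurable ([set v : 'rV[R]_n | forall i, A i (v 0 i)] : set borel).
Proof.
move=> mA; exists [set t | forall i, A i (tnth t i)].
  by have [] := tuple_measure_box mA.
by rewrite setTI; apply/seteqP; split => v /= h i; have := h i; rewrite tnth_mktuple.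
Qed.

(** An open set is a countable union of boxes with rational centres. *)
Lemma open_measurable_borel (U : set 'rV[R]_n) : open U -> measurable (U : set borel).
Proof.
move=> oU.
pose box (q : n.-tuple rat * nat) := [set v : 'rV[R]_n | forall i,
  `](ratr (tnth q.1 i) - q.2.+1%:R^-1), (ratr (tnth q.1 i) + q.2.+1%:R^-1)[%classic (v 0 i)].
have -> : U = \bigcup_(q in [set q | box q `<=` U]) box q.
  apply/seteqP; split => [v Uv|v [q qU]]; last exact: qU.
  have /nbhs_ballP[e /= e0 eU] : nbhs v U by apply: open_nbhs_nbhs.
  have e20 : 0 < e / 2 by rewrite divr_gt0.
  have [k _ kP] := near_infty_natSinv_lt (PosNum e20).
  have {kP} := kP k (leqnn k); set d := k.+1%:R^-1 => /= de.
  have d0 : 0 < d by rewrite invr_gt0.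
  have /choice[q qP] : forall i, exists q : rat, ratr q \in `](v 0 i - d), (v 0 i + d)[.
    by move=> i; apply: rat_in_itvoo; lra.
  exists ([tuple q i | i < n], k) => /=; last first.
    move=> i; rewrite /= tnth_mktuple; have := qP i; rewrite !in_itv/= -/d.
    by move=> /andP[? ?]; lra.
  move=> w wq; apply: eU; split=> // i j; rewrite (ord1 i){i}.
  have := wq j; rewrite /= tnth_mktuple; have := qP j; rewrite !in_itv/=.
  rewrite -/d => /andP[? ?] /andP[? ?]; rewrite /ball/= ltr_norml; lra.
rewrite bigcup_mkcond; apply: countable_bigcupT_measurable => // q.
case: ifPn => _; last exact: measurable0.
apply: (measurable_box (A := fun i => `](ratr (tnth q.1 i) - q.2.+1%:R^-1),
  (ratr (tnth q.1 i) + q.2.+1%:R^-1)[%classic)) => i.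
exact: measurable_itv.
Qed.

Lemma open_measurable_lebesgue (U : set 'rV[R]_n) : open U -> measurable (U : set leb).
Proof. by move=> /open_measurable_borel; exact: measurable_borel_lebesgue. Qed.

Lemma continuous_measurable_borel (f : 'rV[R]_n -> R) : continuous f ->
  measurable_fun [set: borel] f.
Proof.
move=> /continuousP cf; apply: (measurability _ (RGenOpens.measurableE R)).
move=> _ [_ [a [b ->] <-]]; rewrite setTI; apply: open_measurable_borel.
exact/cf/interval_open.
Qed.

Lemma continuous_measurable_lebesgue (f : 'rV[R]_n -> R) : continuous f ->
  measurable_fun [set: leb] f.
Proof.
move=> /continuous_measurable_borel mf _ B mB.
by apply: measurable_borel_lebesgue; exact: mf.
Qed.

Lemma bounded_lebesgue_lty (D : set 'rV[R]_n) M : (forall x, D x -> `|x| <= M) ->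
  measurable (D : set leb) -> (mu D < +oo)%E.
Proof.
move=> DM mD.
have mA (i : 'I_n) : measurable (`[- M, M]%classic : set (measurableTypeR R)).
  exact: measurable_itv.
apply: (@le_lt_trans _ _ (mu [set v | forall i : 'I_n, `[- M, M]%classic (v 0 i)])).
  apply: le_measure; rewrite ?inE//.
    exact: (measurable_borel_lebesgue (measurable_box mA)).
  move=> v /DM vM i; rewrite /= in_itv/= -ler_norml; apply: le_trans vM.
  by rewrite /Num.norm/= mx_normrE; apply: (le_bigmax _ (fun ij => `|v ij.1 ij.2|) (0, i)).
rewrite (lebesgue_measure_rV_box mA).
have [r ->] : exists r : R, lebesgue_measure `[- M, M]%classic = r%:E.
  by rewrite lebesgue_measure_itv/=; case: ifP => _; [exists (M - - M)|exists 0].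
by rewrite -(big_morph EFin (@EFinM R) erefl) ltry.
Qed.

Lemma lebesgue_borelE (A : set 'rV[R]_n) : measurable (A : set borel) ->
  mu A = borel_measure A.
Proof. exact: measurable_mu_extE. Qed.
End rV_measure.

Section translation.
Context {R : realType}.
Local Notation T := (measurableTypeR R).

(** The translated measure agrees with Lebesgue measure on intervals. *)
Lemma lebesgue_measure_shift (h : R) (A : set T) : measurable A ->
  lebesgue_measure ((fun x : R => x + h) @^-1` A) = lebesgue_measure A.
Proof.
move=> mA; have mh : measurable_fun [set: T] (fun x : T => x + h : T).
  exact: measurable_funD.
have := @lebesgue_measure_unique R (pushforward (@lebesgue_measure R) (fun x : T => x + h : T)).
move=> /(_ mh) H; apply/esym; apply: H mA => X [[a b] _ <-] /=; rewrite /pushforward.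
rewrite (_ : _ @^-1` _ = `](a - h), (b - h)]%classic); last first.
  by apply/seteqP; split => x /=; rewrite !in_itv/= ltrBlDr lerBrDr.
rewrite !lebesgue_measure_itv/= !lte_fin ltrD2r; case: ifP => // _.
by rewrite -!EFinD; congr EFin; ring.
Qed.

Definition tuple_shift n (h s : n.-tuple T) : n.-tuple T :=
  [tuple tnth s i + tnth h i | i < n].

Lemma measurable_tuple_shift n (h : n.-tuple T) :
  measurable_fun [set: n.-tuple T] (tuple_shift h).
Proof.
apply/measurable_fun_tnthP => i.
rewrite (_ : _ \o _ = fun s => tnth s i + tnth h i); last first.
  by apply/funext => s /=; rewrite tnth_mktuple.
by apply: measurable_funD; [exact: measurable_tnth|exact: measurable_cst].
Qed.

(** By induction on n: a translation of the product acts factor by factor, and a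
    product measure is determined by its values on rectangles. *)
Lemma tuple_measure_shift n (h : n.-tuple T) (A : set (n.-tuple T)) : measurable A ->
  tuple_measure (@lebesgue_measure R) n (tuple_shift h @^-1` A) =
  tuple_measure (@lebesgue_measure R) n A.
Proof.
elim: n h A => [|n IHn] h A mA.
  rewrite (_ : tuple_shift h = id) ?preimage_id//; apply/funext => s.
  by rewrite (tuple0 s) (tuple0 (tuple_shift _ _)).
pose h' : n.-tuple T := [tuple of behead h].
pose f (x : T * n.-tuple T) := (x.1 + thead h : T, tuple_shift h' x.2).
have mf : measurable_fun [set: T * n.-tuple T] f.
  apply/measurable_fun_pairP; split => /=.
    by apply: measurable_funD; [exact: measurable_fst|exact: measurable_cst].
  exact: (measurableT_comp (measurable_tuple_shift h') measurable_snd).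
rewrite /= /tuple_measureS.
have fE x : tuple_shift h (tuple_cons x) = tuple_cons (f x).
  case: x => x s; apply: eq_from_tnth => i; rewrite tnth_mktuple.
  case: (unliftP ord0 i) => [j ->|->]; last by rewrite [h]tuple_eta !tnth0.
  by rewrite [h in LHS]tuple_eta !tnthS tnth_mktuple.
have -> : @tuple_cons _ T n @^-1` (tuple_shift h @^-1` A) =
    f @^-1` (@tuple_cons _ T n @^-1` A).
  by apply/seteqP; split => x; rewrite /preimage/= fE.
have mcA : measurable (@tuple_cons _ T n @^-1` A).
  by rewrite -[X in measurable X]setTI; exact: measurable_tuple_cons.
rewrite -[LHS]/(pushforward (lebesgue_measure \x tuple_measure lebesgue_measure n)%E f _).
apply/esym; apply: product_measure_unique => // B C mB mC.
transitivity ((lebesgue_measure \x tuple_measure lebesgue_measure n)%E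
  (((fun x : T => x + thead h : T) @^-1` B) `*` (tuple_shift h' @^-1` C))) => //.
rewrite product_measure1E//; last 2 first.
- by rewrite -[X in measurable X]setTI; apply: measurable_funD => //; exact: measurable_cst.
- by rewrite -[X in measurable X]setTI; exact: measurable_tuple_shift.
by congr (_ * _)%E; [exact: lebesgue_measure_shift|exact: IHn].
Qed.

Variable n : nat.
Notation borel := (rV_borel R n).
Notation leb := (rV_lebesgue R n).
Local Notation mu := (lebesgue_measure_rV R n).

Lemma measurable_shift_borel (v : 'rV[R]_n) :
  measurable_fun [set: borel] (fun x : borel => (x : 'rV[R]_n) + v : borel).
Proof.
move=> _ B [A mA AB]; rewrite setTI in AB; rewrite setTI.
exists (tuple_shift (tuple_of_rV v) @^-1` A).
  by rewrite -[X in measurable X]setTI; exact: measurable_tuple_shift.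
rewrite setTI -AB; apply/seteqP; split => x;
  rewrite /preimage/= (_ : tuple_of_rV (x + v) = tuple_shift (tuple_of_rV v) (tuple_of_rV x))//;
  by apply: eq_from_tnth => i; rewrite !tnth_mktuple mxE.
Qed.

(** From the Lebesgue to the Borel structure, a translation is measurable for the
    elementary reason that it pulls Borel sets back to Borel sets. *)
Definition rV_shift (v : 'rV[R]_n) : leb -> borel := fun x => (x : 'rV[R]_n) + v.

Lemma measurable_rV_shift (v : 'rV[R]_n) : measurable_fun [set: leb] (rV_shift v).
Proof.
by move=> _ B mB; apply: measurable_borel_lebesgue; exact: measurable_shift_borel.
Qed.

Lemma lebesgue_rV_shift (v : 'rV[R]_n) (A : set 'rV[R]_n) : measurable (A : set borel) ->
  mu ((fun x => x + v) @^-1` A) = mu A.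
Proof.
move=> mA; rewrite !lebesgue_borelE//; last first.
  by rewrite -[X in measurable X]setTI; exact: measurable_shift_borel.
rewrite /borel_measure -[RHS](tuple_measure_shift (tuple_of_rV v)); last first.
  exact: measurable_preimage_rV_of_tuple.
congr (tuple_measure _ _ _); apply/seteqP; split => t;
  rewrite /preimage/= (_ : rV_of_tuple (tuple_shift (tuple_of_rV v) t) = rV_of_tuple t + v)//;
  by apply/rowP => i; rewrite !mxE !tnth_mktuple.
Qed.

Let pushforward_shift (v : 'rV[R]_n) (f : borel -> \bar R) :
  (\int[pushforward mu (rV_shift v)]_x f x = \int[pushforward mu (rV_shift 0)]_x f x)%E.
Proof.
pose m w := measure_function_pushforward__canonical__measure_function_Measure mu
    (measurable_rV_shift w).
have := @eq_measure_integral _ _ _ setT (m 0) (m v) f.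
apply => A mA _.
by rewrite /= /pushforward /rV_shift !lebesgue_rV_shift.
Qed.

(** Compare the image measures of the translations by v and by 0, which agree on
    Borel sets. *)
Lemma integral_shift (v : 'rV[R]_n) (g : 'rV[R]_n -> R) :
  measurable_fun [set: borel] g -> mu.-integrable [set: leb] (EFin \o g) ->
  mu.-integrable [set: leb] (EFin \o (fun x => g (x + v))) /\
  \int[mu]_x g (x + v) = \int[mu]_x g x.
Proof.
move=> mg ig.
have mEg : measurable_fun [set: borel] (EFin \o g) by exact: measurableT_comp.
have g0 : EFin \o g = (EFin \o g) \o rV_shift 0.
  by apply/funext => x; rewrite /= /rV_shift addr0.
have msh w : measurable_fun [set: leb] (rV_shift w) := measurable_rV_shift w.
have igv : mu.-integrable [set: leb] (EFin \o (fun x => g (x + v))).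
  apply/integrableP; split.
    by apply: (measurableT_comp mEg (msh v)).
  have /integrableP[_] := ig; apply: le_lt_trans.
  have mag : measurable_fun [set: borel] (fun x => `|(g x)%:E|%E).
    exact: measurableT_comp.
  have ag0 : {in [set: borel], forall x, (0 <= `|(g x)%:E|)%E} by [].
  have hv := ge0_integral_pushforward (msh v) mu measurableT mag ag0.
  have h0 := ge0_integral_pushforward (msh 0) mu measurableT mag ag0.
  rewrite !preimage_setT in h0 hv.
  have -> : (\int[mu]_x `|(EFin \o (fun x => g (x + v)%R)) x| =
      \int[pushforward mu (rV_shift v)]_y `|(g y)%:E|)%E by rewrite hv.
  rewrite pushforward_shift h0 le_eqVlt; apply/orP; left; apply/eqP.
  by apply: eq_integral => x _; rewrite /= /rV_shift addr0.
split => //; rewrite /Rintegral; congr fine.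
have := integral_pushforward (msh v) mEg igv measurableT.
have ig0 : mu.-integrable (rV_shift 0 @^-1` [set: borel]) ((EFin \o g) \o rV_shift 0).
  by rewrite -g0 preimage_setT.
have := integral_pushforward (msh 0) mEg ig0 measurableT.
rewrite !preimage_setT -g0 => h0 hv; rewrite pushforward_shift in hv.
by apply: (etrans (esym hv)); exact: h0.
Qed.

Section partial_integral.
Variables (g : 'rV[R]_n -> R) (i : 'I_n) (B C M : R).
Hypothesis cg : continuous g.
Hypothesis dg : forall x, derivable g x (delta_mx 0 i).
Hypothesis gB : forall x, `|g x| <= B.
Hypothesis gC : forall x, `|partial i g x| <= C.
Hypothesis gM : forall x, M < `|x| -> g x = 0.

Let e : 'rV[R]_n := delta_mx 0 i.

(** A partial derivative is the ordinary derivative along a coordinate line. *)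
Lemma is_derive_line (x : 'rV[R]_n) (s : R) :
  is_derive s (1 : R) (fun t : R => g (x + t *: e)) (partial i g (x + s *: e)).
Proof.
have E : (fun h : R => h^-1 *: (((fun t : R => g (x + t *: e)) \o shift s) (h *: (1 : R)) -
      g (x + s *: e))) =
    (fun h : R => h^-1 *: ((g \o shift (x + s *: e)) (h *: e) - g (x + s *: e))).
  apply/funext => h /=; congr (_ *: (g _ - _)).
  by rewrite [h *: 1]mulr1 scalerDl addrCA.
by apply: DeriveDef; rewrite /derivable /derive E //; exact: dg.
Qed.

Lemma increment_le (x : 'rV[R]_n) (h : R) : 0 < h -> `|g (x + h *: e) - g x| <= C * h.
Proof.
move=> h0.
have cl : {within `[0, h], continuous (fun t : R => g (x + t *: e))}.
  apply: derivable_within_continuous => s _.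
  by have [] := is_derive_line x s.
have [c _] := MVT h0 (fun s _ => is_derive_line x s) cl.
rewrite scale0r addr0 subr0 => ->.
by rewrite normrM (gtr0_norm h0) ler_wpM2r// ltW.
Qed.

(** The difference quotients of g have integral zero by invariance under
    translations; they are bounded by C, vanish outside a fixed ball, and converge
    to the partial derivative. *)
Lemma integral_partial_eq0 : \int[mu]_x partial i g x = 0.
Proof.
(* steps 1 / (k + 1) are at most 1, hence the radius M + 1 *)
pose D := [set x : 'rV[R]_n | `|x| <= M + 1].
have mD : measurable (D : set leb).
  rewrite -[D]setCK; apply: measurableC; apply: open_measurable_lebesgue.
  apply: closed_openC; apply: ((continuous_closedP (@Num.norm R 'rV[R]_n)).1 _
    [set y | y <= M + 1]); [exact: norm_continuous|exact: closed_le].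
have C0 : 0 <= C by apply: le_trans (gC 0).
pose f k x := k.+1%:R * (g (x + k.+1%:R^-1 *: e) - g x).
have mg : measurable_fun [set: borel] g by exact: continuous_measurable_borel.
have mgl : measurable_fun [set: leb] g by exact: continuous_measurable_lebesgue.
have muD : (mu D < +oo)%E by apply: (@bounded_lebesgue_lty _ _ _ (M + 1)).
have normM : M + 1 >= M by rewrite lerDl.
have gD x : ~ D x -> g x = 0.
  move=> /negP; rewrite -ltNge => xD; apply: gM; lra.
have ig : mu.-integrable [set: leb] (EFin \o g).
  exact: (integrable_bounded_support mD muD mgl gB gD).
have intf k : \int[mu]_x f k x = 0.
  have [igk Eg] := integral_shift (k.+1%:R^-1 *: e) mg ig.
  rewrite (RintegralZl _ measurableT (integrableB measurableT igk ig)).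
  by rewrite (RintegralB measurableT igk ig) Eg subrr mulr0.
have fcvg x : f k x @[k --> \oo] --> partial i g x.
  have /cvgrPdist_lt dgx : derivable g x e by exact: dg.
  apply/cvgrPdist_lt => eta eta0; have [d /= d0 dP] := dgx eta eta0.
  have [k0 _ k0P] := near_infty_natSinv_lt (PosNum d0).
  near=> k; rewrite /f -[X in X * _]invrK.
  rewrite [x + _]addrC; apply: dP => /=; last by rewrite invr_neq0.
  rewrite sub0r normrN ger0_norm ?invr_ge0//; apply: k0P => /=.
  by near: k; exact: nbhs_infty_ge.
have fC k x : `|f k x| <= C.
  have k0 : 0 < k.+1%:R^-1 :> R by rewrite invr_gt0.
  by rewrite normrM ger0_norm// -ler_pdivlMl// mulrC; exact: increment_le.
have fD k x : ~ D x -> f k x = 0.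
  have k0 : 0 < k.+1%:R^-1 :> R by rewrite invr_gt0.
  move=> /negP; rewrite -ltNge => xD.
  have e1 : `|e| <= 1.
    rewrite /Num.norm/= mx_normrE; apply: bigmax_le => // -[j l] _ /=.
    by rewrite mxE; case: (_ && _); rewrite ?normr1 ?normr0.
  have he : `|k.+1%:R^-1 *: e| <= 1.
    rewrite normrZ ger0_norm ?(ltW k0)// -[leRHS]mulr1; apply: ler_pM => //.
    by rewrite invf_le1// ler1n.
  rewrite /f !gM ?subrr ?mulr0//; first lra.
  have := lerB_normD x (k.+1%:R^-1 *: e); lra.
have mf k : measurable_fun [set: leb] (f k).
  have msh : measurable_fun [set: leb] (fun x => g (x + k.+1%:R^-1 *: e)).
    exact: (measurableT_comp mg (measurable_rV_shift (k.+1%:R^-1 *: e))).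
  exact: (measurable_scaleB k.+1%:R msh mgl).
exact: (Rintegral_lim_eq0 mD muD mf fC fD fcvg intf).
Unshelve. all: end_near.
Qed.
End partial_integral.

End translation.

(** * Functions with an integrable p-th power *)

Section Lp_functions.
Context d {T : measurableType d} {R : realType} (mu : {measure set T -> \bar R}).
Variables (D : set T) (mD : measurable D) (p : R) (p1 : 1 < p).
Implicit Types f g : T -> R.

Let p0 : 0 < p. Proof. exact: lt_trans p1. Qed.

Definition pintegrable f := measurable_fun D f /\
  mu.-integrable D (EFin \o (fun x => `|f x| `^ p)).

(** The p-th power of the L^p norm, on which convexity and convergence are
    expressed without taking roots. *)
Definition pint f : R := \int[mu]_(x in D) `|f x| `^ p.

Lemma measurable_norm_powR f : measurable_fun D f ->
  measurable_fun D (fun x => `|f x| `^ p).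
Proof.
move=> mf; apply: (measurableT_comp (measurable_powR p)).
exact: (measurableT_comp (@normr_measurable R setT) mf).
Qed.

Lemma integrable_le f g : measurable_fun D f -> mu.-integrable D (EFin \o g) ->
  (forall x, D x -> `|f x| <= g x) -> mu.-integrable D (EFin \o f).
Proof.
move=> mf ig fg; apply: le_integrable ig => //; first exact/measurable_EFinP.
by move=> x Dx; rewrite /= lee_fin (le_trans (fg x Dx))// ler_norm.
Qed.

Lemma integrable_comb (a b : R) f g : mu.-integrable D (EFin \o f) ->
  mu.-integrable D (EFin \o g) ->
  mu.-integrable D (EFin \o (fun x => a * f x + b * g x)).
Proof.
move=> i_f ig; have := integrableD mD (integrableZl mD a i_f) (integrableZl mD b ig).
by apply: eq_integrable => // x _ /=; rewrite EFinD !EFinM.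
Qed.

Lemma Rintegral_comb (a b : R) f g : mu.-integrable D (EFin \o f) ->
  mu.-integrable D (EFin \o g) ->
  \int[mu]_(x in D) (a * f x + b * g x) =
  a * \int[mu]_(x in D) f x + b * \int[mu]_(x in D) g x.
Proof.
move=> i_f ig; rewrite RintegralD//.
- by rewrite !RintegralZl.
- by apply: eq_integrable (integrableZl mD a i_f) => // x _ /=; rewrite EFinM.
- by apply: eq_integrable (integrableZl mD b ig) => // x _ /=; rewrite EFinM.
Qed.

(** Both integrals are unchanged when the exceptional null set is removed. *)
Lemma le_Rintegral_ae f g : mu.-integrable D (EFin \o f) ->
  mu.-integrable D (EFin \o g) -> {ae mu, forall x, D x -> f x <= g x} ->
  \int[mu]_(x in D) f x <= \int[mu]_(x in D) g x.
Proof.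
move=> i_f ig [A [mA A0 fgA]].
have mDA : measurable (D `\` A) by exact: measurableD.
have negl h : mu.-integrable D (EFin \o h) ->
    \int[mu]_(x in D) h x = \int[mu]_(x in D `\` A) h x.
  move=> ih; rewrite /Rintegral; congr fine.
  by apply: negligible_integral.
rewrite (negl _ i_f) (negl _ ig).
have sDA : D `\` A `<=` D by move=> x [].
apply: le_Rintegral => //; [exact: integrableS i_f|exact: integrableS ig|].
move=> x [Dx nAx]; apply: contrapT => nfg; apply: nAx; apply: fgA => /= h.
exact/nfg/h.
Qed.

Lemma pintegrable_comb (a b : R) f g : pintegrable f -> pintegrable g ->
  pintegrable (fun x => a * f x + b * g x).
Proof.
move=> [mf i_f] [mg ig].
have m_ : measurable_fun D (fun x => a * f x + b * g x).
  apply: measurable_funD; apply: measurable_funM => //; exact: measurable_cst.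
split => //.
have ic := integrable_comb (2 `^ p * `|a| `^ p) (2 `^ p * `|b| `^ p) i_f ig.
apply: (integrable_le (measurable_norm_powR m_) ic) => x _.
rewrite ger0_norm ?powR_ge0// -!mulrA -mulrDr -!powRM// -!normrM.
apply: le_trans (powR_add_le p0 (normr_ge0 _) (normr_ge0 _)).
by apply: (ge0_ler_powR (ltW p0)); rewrite ?nnegrE ?addr_ge0 ?ler_normD.
Qed.

Lemma pint_ge0 f : 0 <= pint f.
Proof. by apply: Rintegral_ge0 => x _; exact: powR_ge0. Qed.

Lemma pintegrableB f g : pintegrable f -> pintegrable g -> pintegrable (f \- g).
Proof.
move=> pf pg; have := pintegrable_comb 1 (-1) pf pg.
by rewrite (_ : (fun x => _) = f \- g)//; apply/funext => x; rewrite mul1r mulN1r.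
Qed.

Lemma pint_EFin f : pintegrable f ->
  (\int[mu]_(x in D) (`|f x| `^ p)%:E = (pint f)%:E)%E.
Proof. by move=> [_ i_f]; rewrite /pint /Rintegral fineK// integrable_fin_num. Qed.

Lemma pint_triangle f g h : pintegrable (f \- g) -> pintegrable (g \- h) ->
  pint (f \- h) <= 2 `^ p * (pint (f \- g) + pint (g \- h)).
Proof.
move=> fg gh.
have fh : pintegrable (f \- h).
  have := pintegrable_comb 1 1 fg gh.
  rewrite (_ : (fun x => _) = f \- h)//; apply/funext => x.
  by rewrite !mul1r /= addrA addrNK.
rewrite mulrDr -Rintegral_comb//; [|exact: fg.2|exact: gh.2].
apply: le_Rintegral => //; [exact: fh.2|exact: integrable_comb fg.2 gh.2|move=> x _].
rewrite -mulrDr; apply: le_trans (powR_add_le p0 (normr_ge0 _) (normr_ge0 _)).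
apply: (ge0_ler_powR (ltW p0)); rewrite ?nnegrE ?addr_ge0//.
have -> : (f \- h) x = (f \- g) x + (g \- h) x by rewrite /= addrA addrNK.
exact: ler_normD.
Qed.

Section complete.
Variable f : nat -> T -> R.
Hypothesis pf : forall k, pintegrable (f k).
Hypothesis f_cauchy : forall eta : R, 0 < eta -> exists k0, forall k l,
  (k0 <= k)%N -> (k0 <= l)%N -> pint (f k \- f l) <= eta.

Let w (j : nat) : R := ((2 ^ j)%:R) `^ p.

(* a subsequence along which 2^j |f_(j+1) - f_j| is summable in L^p *)
Let subseq_ex : exists s : nat -> nat, (forall j, (j <= s j)%N) /\
  forall j, w j * pint (f (s j.+1) \- f (s j)) <= 1 / (2 ^ j.+1)%:R.
Proof.
have w0 j : 0 < w j by rewrite powR_gt0// ltr0n expn_gt0.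
have /choice[K KP] : forall j, exists k0, forall k l, (k0 <= k)%N -> (k0 <= l)%N ->
    w j * pint (f k \- f l) <= 1 / (2 ^ j.+1)%:R.
  move=> j; have [|k0 k0P] := f_cauchy (eta := 1 / (2 ^ j.+1)%:R / w j).
    by rewrite !divr_gt0// ltr0n expn_gt0.
  by exists k0 => k l kk kl; rewrite mulrC -ler_pdivlMr// k0P.
exists (fun j => j + \sum_(i < j.+1) K i)%N; split => [j|j]; first exact: leq_addr.
have Kj : (K j <= \sum_(i < j.+1) K i)%N by rewrite big_ord_recr leq_addl.
apply: KP; rewrite (leq_trans Kj) ?leq_addl//.
by rewrite [X in (_ <= _ + X)%N]big_ord_recr/= addnCA leq_addr.
Qed.

(** The theorem of Riesz and Fischer. Along a subsequence whose increments are so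
    small that the sum H of 2^(jp) |f_(j+1) - f_j|^p is integrable, the increments
    are O(2^-j) at almost every point, so the subsequence converges there; the
    lemma of Fatou carries the Cauchy bounds to the limit. *)
Lemma pint_complete : exists2 g, pintegrable g & forall eta : R, 0 < eta ->
  exists k0, forall k, (k0 <= k)%N -> pint (f k \- g) <= eta.
Proof.
have [s [sj sP]] := subseq_ex.
pose h j x := w j * `|(f (s j.+1) \- f (s j)) x| `^ p.
have pd j := pintegrableB (pf (s j.+1)) (pf (s j)).
have mh j : measurable_fun D (h j).
  by apply: measurable_funM => //; apply: measurable_norm_powR; case: (pd j).
have h0 j x : 0 <= h j x by rewrite mulr_ge0 ?powR_ge0.
pose H x := (\sum_(j <oo) (h j x)%:E)%E.
have intH : (\int[mu]_(x in D) H x < +oo)%E.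
  rewrite integral_nneseries//; last 2 first.
    by move=> j; exact/measurable_EFinP.
    by move=> j x _; rewrite lee_fin.
  apply: (@le_lt_trans _ _ 1%:E); last exact: ltry.
  apply: le_trans (epsilon_trick0 xpredT ler01).
  apply: lee_nneseries => [j _ _|j _].
    by apply: integral_ge0 => x _; rewrite lee_fin.
  rewrite /h; under eq_integral do rewrite EFinM.
  rewrite ge0_integralZl_EFin//; first by rewrite pint_EFin// -EFinM lee_fin.
  - by apply/measurable_EFinP/measurable_norm_powR; case: (pd j).
  - exact: powR_ge0.
have H0 x : (0 <= H x)%E by apply: nneseries_ge0 => j _ _; rewrite lee_fin.
have mH : measurable_fun D H.
  apply: ge0_emeasurable_sum => //.
    by move=> j x Dx _; rewrite lee_fin.
  by move=> j _; exact/measurable_EFinP.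
have iH : mu.-integrable D H.
  apply/integrableP; split => //; apply: le_lt_trans intH.
  rewrite le_eqVlt; apply/orP; left; apply/eqP; apply: eq_integral => x _.
  by rewrite gee0_abs// H0.
have [A [mA A0 HA]] := integrable_ae mD iH.
have cv x : D x -> ~ A x -> cvgn (fun j => f (s j) x).
  move=> Dx nAx.
  have Hfin : H x \is a fin_num.
    by apply: contrapT => nfin; apply: nAx; apply: HA => /= /(_ Dx).
  pose c := fine (H x).
  have hc j : h j x <= c.
    rewrite -lee_fin /c fineK//.
    have := @nneseries_lim_ge R (fun j => (h j x)%:E) xpredT 0 j.+1.
    move=> /(_ (fun j _ _ => ltac:(by rewrite lee_fin))); apply: le_trans.
    by rewrite big_nat_recr//= leeDr// sume_ge0// => i _; rewrite lee_fin.
  have c0 : 0 <= c by exact: le_trans (hc 0%N).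
  pose v n := f (s n) x.
  have tel n : `|telescope v n| <= geometric (1 + c) 2^-1 n.
    have twon : 0 < (2 ^ n)%:R :> R by rewrite ltr0n expn_gt0.
    rewrite /geometric/= exprVn -natrX ler_pdivlMr// mulrC leNgt; apply/negP => big.
    have y1 : 1 <= (2 ^ n)%:R * `|telescope v n| by lra.
    have := hc n; have := le1r_powR y1 (ltW p1).
    by rewrite powRM ?(ltW twon)// /h /w /telescope/= /v; lra.
  have /normed_cvg : cvgn [normed series (telescope v)].
    apply: (series_le_cvg _ _ tel) => //.
      by move=> n; rewrite mulr_ge0 ?addr_ge0// exprn_ge0// invr_ge0.
    by apply: is_cvg_geometric_series; rewrite ger0_norm ?invr_ge0//; lra.
  move=> cs; have -> : (fun j => f (s j) x) = (fun n => v 0 + series (telescope v) n).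
    by apply/funext => n; exact: eq_sum_telescope.
  by apply: is_cvgD => //; exact: is_cvg_cst.
have mDA : measurable (D `\` A) by exact: measurableD.
have sDA : D `\` A `<=` D by move=> x [].
pose g x := limn (fun j => (f (s j) \_ (D `\` A)) x).
have fg x : (f (s j) \_ (D `\` A)) x @[j --> \oo] --> g x.
  suff : cvgn (fun j => (f (s j) \_ (D `\` A)) x) by [].
  have [DAx|nDAx] := pselect ((D `\` A) x).
    rewrite (_ : (fun j => _) = fun j => f (s j) x); first by case: DAx => *; exact: cv.
    by apply/funext => j; rewrite patchE mem_set.
  rewrite (_ : (fun j => _) = fun j => 0); first exact: is_cvg_cst.
  by apply/funext => j; rewrite patchE memNset.
have mfj j : measurable_fun D (f (s j) \_ (D `\` A)).
  apply: measurable_funTS; apply/(measurable_restrictT _ mDA).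
  exact: measurable_funS mD sDA (pf (s j)).1.
have mg : measurable_fun D g by apply: (measurable_fun_cvg mfj) => x _; exact: fg.
have fgD x : (D `\` A) x -> f (s j) x @[j --> \oo] --> g x.
  move=> DAx; have := fg x; rewrite (_ : (fun j => _) = fun j => f (s j) x)//.
  by apply/funext => j; rewrite /patch mem_set.
have fatou_bound k (eta : R) : (exists j0, forall j, (j0 <= j)%N -> pint (f k \- f (s j)) <= eta) ->
    (\int[mu]_(x in D) (`|(f k \- g) x| `^ p)%:E <= eta%:E)%E.
  move=> [j0 j0P].
  pose F j x := (`|(f k \- f (s j)) x| `^ p)%:E.
  have mF j : measurable_fun D (F j).
    by apply/measurable_EFinP/measurable_norm_powR; case: (pintegrableB (pf k) (pf (s j))).
  have F0 j x : (0 <= F j x)%E by rewrite lee_fin powR_ge0.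
  have mfg : measurable_fun D (fun x => (`|(f k \- g) x| `^ p)%:E).
    apply/measurable_EFinP/measurable_norm_powR/measurable_funB => //.
    by case: (pf k).
  rewrite (ge0_negligible_integral mA mD mfg _ A0); last first.
    by move=> x _; rewrite lee_fin powR_ge0.
  have -> : (\int[mu]_(x in D `\` A) (`|(f k \- g) x| `^ p)%:E =
      \int[mu]_(x in D `\` A) limn_einf (F ^~ x))%E.
    apply: eq_integral => x /set_mem DAx; apply/esym; apply: (cvg_limn_einf_sup _).1.
    apply: cvg_EFin; first by near=> j.
    have : (f k x - f (s j) x) @[j --> \oo] --> f k x - g x.
      by apply: cvgB; [exact: cvg_cst|exact: fgD].
    by move=> c; exact: (cvg_comp _ _ c (@continuous_norm_powR R p p1 (f k x - g x))).
  apply: (le_trans (fatou mu mDA (fun j => measurable_funS mD sDA (mF j)) _)).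
    by move=> j x _; exact: F0.
  rewrite limn_einf_lim; apply: lime_le; first exact: is_cvg_einfs.
  apply: nearW => j; apply: (@le_trans _ _ (\int[mu]_(x in D) F (maxn j j0) x)%E).
    apply: (@le_trans _ _ (\int[mu]_(x in D `\` A) F (maxn j j0) x)%E).
      by apply: ereal_inf_lbound; exists (maxn j j0) => //=; exact: leq_maxl.
    by apply: ge0_subset_integral => // x _; exact: F0.
  rewrite pint_EFin; last exact: pintegrableB.
  by rewrite lee_fin j0P// leq_maxr.
have near_g (eta : R) : 0 < eta -> exists k0, forall k, (k0 <= k)%N ->
    (\int[mu]_(x in D) (`|(f k \- g) x| `^ p)%:E <= eta%:E)%E.
  move=> /f_cauchy[k0 k0P]; exists k0 => k kk; apply: fatou_bound.
  by exists k0 => j jk; apply: k0P => //; exact: leq_trans (sj j).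
have pfg k (eta : R) : (\int[mu]_(x in D) (`|(f k \- g) x| `^ p)%:E <= eta%:E)%E ->
    pintegrable (f k \- g).
  move=> le_eta; have m_ : measurable_fun D (f k \- g).
    by apply: measurable_funB => //; case: (pf k).
  split => //; apply/integrableP; split.
    exact/measurable_EFinP/measurable_norm_powR.
  apply: le_lt_trans (ltry eta); apply: le_trans le_eta.
  rewrite le_eqVlt; apply/orP; left; apply/eqP; apply: eq_integral => x _.
  by rewrite /= ger0_norm// powR_ge0.
exists g.
  have [k0 /(_ k0 (leqnn _)) /pfg pg] := near_g 1 ltr01.
  have := pintegrableB (pf k0) pg; rewrite (_ : f k0 \- (f k0 \- g) = g)//.
  by apply/funext => x /=; rewrite opprB addrC addrNK.
move=> eta /near_g[k0 k0P]; exists k0 => k /k0P le_eta.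
by rewrite -lee_fin -pint_EFin//; exact: pfg le_eta.
Unshelve. all: end_near.
Qed.
End complete.

End Lp_functions.

(** * Complex matrices in real coordinates *)

Section real_coordinates.
Context {R : realType}.
Variables (N n : nat).
Implicit Types (A B : 'M[R]_(N + N, n)) (p : R).

(** A complex field is stored as a field of real matrices, so that the theory of
    real L^p functions applies to each entry. *)
Definition cplx A : 'M[R[i]]_(N, n) :=
  \matrix_(j, k) (A (lshift N j) k +i* A (rshift N j) k)%C.

(** A substitute for |A|^p, equivalent to it by [ppow_cnorm], whose uniform
    convexity is read off entry by entry from that of the power on the line. *)
Definition ppow p A : R := \sum_(q : 'I_(N + N) * 'I_n) `|A q.1 q.2| `^ p.

Lemma cplx_comb (a b : R) A B :
  cplx (a *: A + b *: B) = a%:C%C *: cplx A + b%:C%C *: cplx B.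
Proof.
apply/matrixP => j k; rewrite !mxE; apply/eqP; rewrite eq_complex /=.
by rewrite !mul0r !subr0 !addr0 !eqxx.
Qed.

Lemma cplxB A B : cplx (A - B) = cplx A - cplx B.
Proof.
have := cplx_comb 1 (-1) A B; rewrite rmorph1 rmorphN1.
by rewrite !scale1r !scaleN1r.
Qed.

Lemma cnorm_cplx_sqr A : cnorm (cplx A) ^+ 2 =
  \sum_(q : 'I_(N + N) * 'I_n) A q.1 q.2 ^+ 2.
Proof.
rewrite cnorm_sqr reinnerE -(pair_bigA _ (fun i k => A i k ^+ 2))/=.
rewrite big_split_ord/= -big_split; apply: eq_bigr => j _ /=.
by rewrite -big_split; apply: eq_bigr => k _ /=; rewrite !mxE.
Qed.

Lemma entry_le_cnorm A i k : `|A i k| <= cnorm (cplx A).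
Proof.
rewrite -(@ler_pXn2r _ 2) ?nnegrE ?cnorm_ge0// real_normK ?num_real//.
rewrite cnorm_cplx_sqr (bigD1 (i, k))//= lerDl.
by apply: sumr_ge0 => q _; exact: sqr_ge0.
Qed.

Lemma cnorm_le_sum A : cnorm (cplx A) <= \sum_(q : 'I_(N + N) * 'I_n) `|A q.1 q.2|.
Proof.
rewrite -(@ler_pXn2r _ 2) ?nnegrE ?cnorm_ge0 ?sumr_ge0//.
rewrite cnorm_cplx_sqr; elim: (index_enum _) => [|q s IHs].
  by rewrite !big_nil expr0n.
rewrite !big_cons; apply: le_trans (lerD (lexx _) IHs) _.
rewrite sqrrD real_normK ?num_real// addrAC lerDl mulrn_wge0// mulr_ge0//.
exact: sumr_ge0.
Qed.

Lemma ppow_ge0 p A : 0 <= ppow p A.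
Proof. by apply: sumr_ge0 => q _; exact: powR_ge0. Qed.

Lemma ppow_cnorm p : 0 < p -> exists2 K, 1 <= K & forall A,
  ppow p A <= K * cnorm (cplx A) `^ p /\ cnorm (cplx A) `^ p <= K * ppow p A.
Proof.
move=> p0.
have [K K0 KP] := @sum_powR_le R _ (index_enum ('I_(N + N) * 'I_n)%type) p p0.
pose m : R := \sum_(q : 'I_(N + N) * 'I_n) 1.
have m0 : 0 <= m by exact: sumr_ge0.
exists (1 + K + m) => [|A]; first by rewrite -addrA lerDl addr_ge0.
have c0 := powR_ge0 (cnorm (cplx A)) p; have q0 := ppow_ge0 p A; split.
  apply: (@le_trans _ _ (m * cnorm (cplx A) `^ p)).
    rewrite mulr_suml; apply: ler_sum => q _; rewrite mul1r.
    by apply: ge0_ler_powR; rewrite ?nnegrE ?cnorm_ge0 ?(ltW p0)// entry_le_cnorm.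
  by apply: ler_wpM2r => //; rewrite lerDr addr_ge0.
apply: (@le_trans _ _ (K * ppow p A)); last first.
  by apply: ler_wpM2r => //; rewrite addrAC lerDr addr_ge0.
apply: le_trans (KP (fun q => `|A q.1 q.2|) _) => //.
apply: ge0_ler_powR; rewrite ?nnegrE ?cnorm_ge0 ?sumr_ge0 ?(ltW p0)//.
exact: cnorm_le_sum.
Qed.

Lemma ppow0 p : 0 < p -> ppow p (0 : 'M[R]_(N + N, n)) = 0.
Proof.
by move=> p0; apply: big1 => q _; rewrite mxE normr0 powR0// gt_eqF.
Qed.

Lemma ppowN p A : ppow p (- A) = ppow p A.
Proof. by apply: eq_bigr => q _; rewrite mxE normrN. Qed.

Lemma ppowZ p a A : ppow p (a *: A) = `|a| `^ p * ppow p A.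
Proof.
by rewrite /ppow mulr_sumr; apply: eq_bigr => q _; rewrite mxE normrM powRM.
Qed.

Lemma ppow_convex p A B t : 1 <= p -> 0 <= t <= 1 ->
  ppow p ((1 - t) *: A + t *: B) <= (1 - t) * ppow p A + t * ppow p B.
Proof.
move=> p1 t01; rewrite /ppow !mulr_sumr -big_split; apply: ler_sum => q _.
by rewrite !mxE; exact: norm_powR_convex.
Qed.

Lemma ppow_uconvex p (eta : R) : 1 < p -> 0 < eta -> exists2 C, 0 < C & forall A B,
  ppow p (A - B) <= eta * (ppow p A + ppow p B) +
    C * (ppow p A / 2 + ppow p B / 2 - ppow p (2^-1 *: A + 2^-1 *: B)).
Proof.
move=> p1 eta0; have [C C0 CP] := powR_uconvex p1 eta0; exists C => // A B.
rewrite /ppow !mulr_suml -!big_split/= -sumrB !mulr_sumr -big_split/=.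
apply: ler_sum => q _; rewrite !mxE -mulrDr [2^-1 * _]mulrC; exact: CP.
Qed.
End real_coordinates.

(** * The functional on L^p fields *)

Section real_bounds.
Context {R : realType}.

Lemma half_bound (eta S s C v : R) : 0 < eta -> 0 < S -> 0 < C -> s <= S ->
  v <= eta / 2 / C -> eta / 2 / S * s + C * v <= eta.
Proof.
move=> eta0 S0 C0 sS vC; rewrite [leRHS](splitr eta); apply: lerD.
  by rewrite mulrAC ler_pdivrMr// ler_pM2l ?divr_gt0.
by rewrite mulrC -ler_pdivlMr.
Qed.

(* The factors 1 and -1 in the following bounds are those of linear combinations
   under an integral sign. *)
Lemma sum4_le (m u w g r : R) : u <= r -> w <= r -> g <= r ->
  1 * (1 * m + 1 * u) + 1 * (1 * w + 1 * g) <= m + `|r| + (`|r| + `|r|) + 1.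
Proof. by have := ler_norm r; lra. Qed.

Lemma sum2_le (u w r : R) : u <= r -> w <= r -> 1 * u + 1 * w <= `|r| + `|r| + 1.
Proof. by have := ler_norm r; lra. Qed.

Lemma sum1_le (u b r : R) : u <= r -> u + b <= `|r| + b + 1.
Proof. by have := ler_norm r; lra. Qed.

Lemma defect_le (u w v x : R) : u / 2 + w / 2 - v <= x ->
  1 * (2^-1 * u + 2^-1 * w) + -1 * v <= x.
Proof. by lra. Qed.
End real_bounds.

Section operator.
Context d {T : measurableType d} {R : realType} (mu : {measure set T -> \bar R}).
Variables (D : set T) (mD : measurable D) (muD : (mu D < +oo)%E).
Variables (N n : nat) (p eps c1 c2 nu M : R).
Hypothesis p1 : 1 < p.
Hypothesis eps01 : 0 <= eps <= 1.
Hypothesis hc : structure_constants p c1 c2.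
Hypothesis nu0 : 0 < nu.
Hypothesis M0 : 0 < M.
Variable a : T -> R[i].
Hypothesis ma : measurable_fun D (fun x => complex.Re (a x)) /\
  measurable_fun D (fun x => complex.Im (a x)).
Hypothesis aM : forall x, D x -> `|complex.Re (a x)| <= M /\ `|complex.Im (a x)| <= M.

Let elliptic x := nu < complex.Re (a x) - `|complex.Im (a x)| /\
  c2 * `|complex.Im (a x)| <= c1 * complex.Re (a x).
Hypothesis a_elliptic : {ae mu, forall x, D x -> elliptic x}.
Variable F : T -> 'M[R[i]]_(N, n).

Definition mx_measurable (X : T -> 'M[R[i]]_(N, n)) := forall j k,
  measurable_fun D (fun x => complex.Re (X x j k)) /\
  measurable_fun D (fun x => complex.Im (X x j k)).

Let Fp x := cnorm (F x) `^ (p / (p - 1)).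
Hypothesis mF : mx_measurable F.
Hypothesis iF : mu.-integrable D (EFin \o Fp).

Let p0 : 0 < p. Proof. exact: lt_trans p1. Qed.
Let p10 : 0 < p - 1. Proof. by rewrite subr_gt0. Qed.
Implicit Types (A B H : 'M[R]_(N + N, n)).

Definition pairing_density x A B : R :=
  reinner (a x *: flux p eps (cplx A) - F x) (cplx B).

(** Young's inequality for the conjugate exponent p / (p - 1), to be applied to the
    datum F. *)
Lemma flux_conj_young (k : R) (X Y : 'M[R[i]]_(N, n)) : 0 < k ->
  cnorm X * cnorm Y <= k `^ (p - 1) * cnorm Y `^ p + k^-1 * cnorm X `^ (p / (p - 1)).
Proof.
move=> k0; have := @powR_young R p k (cnorm X `^ (p - 1)^-1) (cnorm Y) p1 k0.
rewrite -!powRrM mulVf ?gt_eqF// powRr1 ?cnorm_ge0// [_^-1 * p]mulrC.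
by apply; rewrite ?powR_ge0 ?cnorm_ge0.
Qed.

(** The arguments A and F carry the small factor tau, so that the integrated bound
    is small once B is small in L^p, uniformly for A in bounded sets. *)
Lemma density_young tau : 0 < tau -> exists2 C, 0 <= C & forall x, D x -> forall A B,
  `|pairing_density x A B| <= tau * (1 + ppow p A + Fp x) + C * ppow p B.
Proof.
move=> tau0; have [K K1 KP] := @ppow_cnorm R N n p p0.
have K0 : 0 < K by exact: lt_le_trans K1.
have t0 : 0 < tau / (2 * M * K) by rewrite divr_gt0// !mulr_gt0.
have [C C0 CP] := @flux_young R N n p eps _ p1 eps01 t0.
have k0 : 0 < tau^-1 by rewrite invr_gt0.
exists ((2 * M * C + tau^-1 `^ (p - 1)) * K) => [|x Dx A B].
  by rewrite mulr_ge0 ?addr_ge0 ?mulr_ge0 ?powR_ge0// ltW.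
have [aR aI] := aM Dx.
rewrite /pairing_density reinnerBl; apply: le_trans (ler_normB _ _) _.
have h1 := normr_reinnerZl_le (flux p eps (cplx A)) (cplx B) aR aI.
have h2 := ler_wpM2l (ltW (mulr_gt0 (ltr0n R 2) M0)) (CP (cplx A) (cplx B)).
have h3 := le_trans (normr_reinner_le (F x) (cplx B)) (flux_conj_young (F x) (cplx B) k0).
rewrite invrK in h3.
apply: le_trans (lerD (le_trans h1 h2) h3) _.
have [_ kA] := KP A; have [_ kB] := KP B.
have e1 : 2 * M * (tau / (2 * M * K) * (1 + cnorm (cplx A) `^ p)) =
    tau * ((1 + cnorm (cplx A) `^ p) / K) by field; rewrite !gt_eqF.
rewrite mulrDr e1 -/(Fp x).
have e2 : (1 + cnorm (cplx A) `^ p) / K <= 1 + ppow p A.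
  by rewrite ler_pdivrMr// mulrDl mul1r lerD// mulrC.
have e4 := ler_wpM2l (ltW tau0) e2.
have e3 : 0 <= 2 * M * C + tau^-1 `^ (p - 1) by rewrite addr_ge0 ?powR_ge0 ?mulr_ge0// ltW.
have := lerD (lerD e4 (ler_wpM2l e3 kB)) (lexx (tau * Fp x)).
move: (tau^-1 `^ (p - 1)) (cnorm (cplx B) `^ p) (_ / K) (ppow p A) (ppow p B) (Fp x).
by move=> v b u pA pB f; congr (_ <= _); ring.
Qed.

Lemma density_ucontinuous tau : 0 < tau -> exists2 C, 0 <= C & forall x, D x ->
  forall A B H, `|pairing_density x A H - pairing_density x B H| <=
    tau * (1 + ppow p A + ppow p B + ppow p H) + C * ppow p (A - B).
Proof.
move=> tau0; have [K K1 KP] := @ppow_cnorm R N n p p0.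
have K0 : 0 < K by exact: lt_le_trans K1.
have t0 : 0 < tau / (2 * M * K) by rewrite divr_gt0// !mulr_gt0.
have [C C0 CP] := @flux_ucontinuous R N n p eps c1 c2 _ p1 eps01 hc t0.
exists (2 * M * C * K) => [|x Dx A B H].
  by rewrite !mulr_ge0// ltW.
have [aR aI] := aM Dx.
have -> : pairing_density x A H - pairing_density x B H =
    reinner (a x *: (flux p eps (cplx A) - flux p eps (cplx B))) (cplx H).
  by rewrite /pairing_density -reinnerBl opprB addrA addrNK scalerBr.
apply: le_trans (normr_reinnerZl_le _ _ aR aI) _.
have := ler_wpM2l (ltW (mulr_gt0 (ltr0n R 2) M0)) (CP (cplx A) (cplx B) (cplx H)).
move=> /le_trans; apply; rewrite -cplxB mulrDr.
have [_ kA] := KP A; have [_ kB] := KP B; have [_ kH] := KP H; have [_ kD] := KP (A - B).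
set S := 1 + _ + _ + _.
have -> : 2 * M * (tau / (2 * M * K) * S) = tau * (S / K).
  by field; rewrite !gt_eqF.
apply: lerD.
  rewrite ler_pM2l// ler_pdivrMr// /S !mulrDl mul1r.
  by rewrite !lerD// mulrC.
rewrite -!mulrA ler_pM2l// ler_pM2l// ler_wpM2l//.
Qed.

Lemma density_linear x A B H (b c : R) :
  pairing_density x A (b *: B + c *: H) =
  b * pairing_density x A B + c * pairing_density x A H.
Proof. by rewrite /pairing_density cplx_comb reinner_combr. Qed.

Lemma density_monotone x A B : elliptic x ->
  pairing_density x B (A - B) <= pairing_density x A (A - B).
Proof.
move=> [nua ca]; rewrite -subr_ge0.
have -> : pairing_density x A (A - B) - pairing_density x B (A - B) =
    reinner (a x *: (flux p eps (cplx A) - flux p eps (cplx B))) (cplx A - cplx B).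
  by rewrite /pairing_density -reinnerBl opprB addrA addrNK scalerBr cplxB.
apply: flux_monotone ca => //.
by apply: (le_trans (ltW (lt_trans nu0 nua))); rewrite gerBl.
Qed.

(** The constant k is such that Young's inequality spends exactly half of the
    coercivity of the flux on the term with F. *)
Lemma density_coercive : exists c C, [/\ 0 < c, 0 <= C & forall x, elliptic x ->
  forall A, c * ppow p A - C * (1 + Fp x) <= pairing_density x A A].
Proof.
have [K K1 KP] := @ppow_cnorm R N n p p0.
have K0 : 0 < K by exact: lt_le_trans K1.
have [c0 c00 c0P] := @flux_coercive R N n p eps p1 eps01.
pose k := (nu * c0 / 2) `^ (p - 1)^-1.
have k0 : 0 < k by rewrite powR_gt0// divr_gt0// mulr_gt0.
have kp : k `^ (p - 1) = nu * c0 / 2.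
  by rewrite /k -powRrM mulVf ?gt_eqF// powRr1// divr_ge0// mulr_ge0// ltW.
exists (nu * c0 / 2 / K), (nu + k^-1); split.
- by rewrite !divr_gt0// mulr_gt0.
- by rewrite addr_ge0 ?invr_ge0// ltW.
move=> x [nua _] A; rewrite /pairing_density reinnerBl.
have x0 := cnorm_ge0 (cplx A).
have h1 : nu * (c0 * cnorm (cplx A) `^ p - 1) <= reinner (a x *: flux p eps (cplx A)) (cplx A).
  apply: le_trans (reinnerZl_ge _ _ _).
  have fluxE : reinner (flux p eps (cplx A)) (cplx A) =
      cnorm (flux p eps (cplx A)) * cnorm (cplx A).
    by rewrite reinner_flux cnormZ ?powR_ge0// -cnorm_sqr expr2 mulrA.
  rewrite fluxE -mulrBl; have := c0P (cplx A); rewrite fluxE.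
  have : 0 <= cnorm (flux p eps (cplx A)) * cnorm (cplx A) by rewrite mulr_ge0 ?cnorm_ge0.
  move: (cnorm (flux _ _ _) * _) (c0 * _ - 1) => X Y X0 YX.
  apply: (@le_trans _ _ (nu * X)); first by rewrite ler_pM2l.
  by apply: ler_wpM2r => //; exact: ltW.
have h2 := le_trans (normr_reinner_le (F x) (cplx A)) (flux_conj_young (F x) (cplx A) k0).
rewrite kp -/(Fp x) in h2.
have h3 := le_trans (ler_norm _) h2.
have [kA _] := KP A.
have h4 : nu * c0 / 2 / K * ppow p A <= nu * c0 / 2 * cnorm (cplx A) `^ p.
  rewrite -mulrA ler_wpM2l//; first by rewrite divr_ge0// mulr_ge0// ltW.
  by rewrite ler_pdivrMl.
have Fp0 : 0 <= Fp x by exact: powR_ge0.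
have h5 : 0 <= nu * Fp x by rewrite mulr_ge0// ltW.
have h6 : 0 <= k^-1 by rewrite invr_ge0 ltW.
rewrite {1}mulrDl !mulrDr !mulr1; lra.
Qed.

Definition Lp_field (U : T -> 'M[R]_(N + N, n)) :=
  forall i k, pintegrable mu D p (fun x => U x i k).
Implicit Types U W G : T -> 'M[R]_(N + N, n).

Definition energy U : R := \int[mu]_(x in D) ppow p (U x).
(** The number T(U)[G] of the introduction. *)
Definition pairing U G : R := \int[mu]_(x in D) pairing_density x (U x) (G x).

Lemma integrable_bigsum (I : Type) (s : seq I) (f : I -> T -> R) :
  (forall i, mu.-integrable D (EFin \o f i)) ->
  mu.-integrable D (EFin \o (fun x => \sum_(i <- s) f i x)).
Proof.
move=> If; elim: s => [|i s IHs].
  apply: (@integrable_bounded _ _ _ _ _ mD muD 0) => [|x _].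
    by under eq_fun do rewrite big_nil; exact: measurable_cst.
  by rewrite big_nil normr0.
have := integrable_comb mD 1 1 (If i) IHs; apply: eq_integrable => // x _ /=.
by rewrite big_cons !mul1r.
Qed.

Lemma Rintegral_bigsum (I : Type) (s : seq I) (f : I -> T -> R) :
  (forall i, mu.-integrable D (EFin \o f i)) ->
  \int[mu]_(x in D) (\sum_(i <- s) f i x) = \sum_(i <- s) \int[mu]_(x in D) f i x.
Proof.
move=> If; elim: s => [|i s IHs].
  rewrite big_nil; under eq_Rintegral do rewrite big_nil.
  by rewrite Rintegral_cst// mul0r.
rewrite big_cons -IHs -RintegralD//; last exact: integrable_bigsum.
by apply: eq_Rintegral => x _; rewrite big_cons.
Qed.

Lemma integrable_ppow U : Lp_field U -> mu.-integrable D (EFin \o (fun x => ppow p (U x))).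
Proof. by move=> LU; apply: integrable_bigsum => q; case: (LU q.1 q.2). Qed.

Lemma energyE U : Lp_field U -> energy U =
  \sum_(q : 'I_(N + N) * 'I_n) pint mu D p (fun x => U x q.1 q.2).
Proof. by move=> LU; apply: Rintegral_bigsum => q; case: (LU q.1 q.2). Qed.

Lemma Lp_field_comb (b c : R) U W : Lp_field U -> Lp_field W ->
  Lp_field (b *: U + c *: W).
Proof.
move=> LU LW i k; have := pintegrable_comb mD p1 b c (LU i k) (LW i k).
by congr pintegrable; apply/funext => x; rewrite !mxE.
Qed.

Lemma Lp_fieldB U W : Lp_field U -> Lp_field W -> Lp_field (U - W).
Proof.
by move=> LU LW; have := Lp_field_comb 1 (-1) LU LW; rewrite scale1r scaleN1r.
Qed.

Lemma mx_measurable_cplx U : Lp_field U -> mx_measurable (fun x => cplx (U x)).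
Proof.
move=> LU j k; split.
- under eq_fun do rewrite mxE /=; by case: (LU (lshift N j) k).
- under eq_fun do rewrite mxE /=; by case: (LU (rshift N j) k).
Qed.

Lemma mx_measurable_iscale X : mx_measurable X -> mx_measurable (fun x => 'i%C *: X x).
Proof.
move=> mX j k; have [mR mI] := mX j k; split.
- rewrite (_ : (fun x => _) = \- (fun x => complex.Im (X x j k))); first exact: (measurableT_comp (@oppr_measurable R setT) mI).
  by apply/funext => x; rewrite mxE; rewrite /=; case: (X x j k) => u v /=; rewrite mul0r mul1r sub0r.
- rewrite (_ : (fun x => _) = fun x => complex.Re (X x j k))//.
  by apply/funext => x; rewrite mxE; case: (X x j k) => u v /=; rewrite mul0r mul1r add0r.
Qed.

Lemma measurable_reinner X Y : mx_measurable X -> mx_measurable Y ->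
  measurable_fun D (fun x => reinner (X x) (Y x)).
Proof.
move=> mX mY; under eq_fun do rewrite reinnerE.
apply: measurable_sum => j; apply: measurable_sum => k.
have [mX1 mX2] := mX j k; have [mY1 mY2] := mY j k.
by apply: measurable_funD; exact: measurable_funM.
Qed.

Lemma measurable_density U G : Lp_field U -> Lp_field G ->
  measurable_fun D (fun x => pairing_density x (U x) (G x)).
Proof.
move=> /mx_measurable_cplx mU /mx_measurable_cplx mG.
have mw : measurable_fun D (fun x => weight p eps (cplx (U x))).
  apply: (measurableT_comp (measurable_powR ((p - 2) / 2))).
  apply: measurable_funD; first exact: measurable_cst.
  by under eq_fun do rewrite cnorm_sqr; exact: measurable_reinner.
rewrite (_ : (fun x => _) = fun x =>
  complex.Re (a x) * (weight p eps (cplx (U x)) * reinner (cplx (U x)) (cplx (G x))) -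
  complex.Im (a x) * (weight p eps (cplx (U x)) * reinner (cplx (U x)) ('i%C *: cplx (G x))) -
  reinner (F x) (cplx (G x))); last first.
  by apply/funext => x; rewrite /pairing_density reinnerBl reinnerZl !reinner_flux.
have [mR mI] := ma.
apply: measurable_funB; last exact: measurable_reinner.
apply: measurable_funB; apply: measurable_funM => //; apply: measurable_funM => //.
  exact: measurable_reinner.
by apply: measurable_reinner => //; exact: mx_measurable_iscale.
Qed.

Let base x : R := 1 * 1 + 1 * Fp x.

Let i1 : mu.-integrable D (EFin \o (fun _ => 1 : R)).
Proof.
by apply: (@integrable_bounded _ _ _ _ _ mD muD 1) => // x _; rewrite normr1.
Qed.

Let ibase : mu.-integrable D (EFin \o base).
Proof. exact: integrable_comb. Qed.

(* an integrable majorant of the density, written as nested linear combinations *)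
Let young_bound tau C U G x :=
  tau * (1 * ppow p (U x) + 1 * base x) + C * ppow p (G x).

Let integrable_young tau C U G : Lp_field U -> Lp_field G ->
  mu.-integrable D (EFin \o young_bound tau C U G).
Proof.
move=> LU LG; apply: integrable_comb => //; last exact: integrable_ppow.
by apply: integrable_comb => //; exact: integrable_ppow.
Qed.

Let density_le tau C U G : (forall x, D x -> forall A B,
    `|pairing_density x A B| <= tau * (1 + ppow p A + Fp x) + C * ppow p B) ->
  forall x, D x -> `|pairing_density x (U x) (G x)| <= young_bound tau C U G x.
Proof.
move=> h x Dx; apply: le_trans (h x Dx _ _) _.
by rewrite /young_bound /base le_eqVlt; apply/orP; left; apply/eqP; ring.
Qed.

Lemma integrable_density U G : Lp_field U -> Lp_field G ->
  mu.-integrable D (EFin \o (fun x => pairing_density x (U x) (G x))).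
Proof.
move=> LU LG; have [C C0 CP] := density_young ltr01.
apply: (integrable_le mD (measurable_density LU LG) (integrable_young 1 C LU LG)).
exact: density_le.
Qed.

Let IB := \int[mu]_(x in D) base x.
Let Fp0 x : 0 <= Fp x. Proof. exact: powR_ge0. Qed.
Let IB0 : 0 <= IB.
Proof. by apply: Rintegral_ge0 => x _; rewrite /base !mul1r addr_ge0. Qed.

Lemma energy_ge0 U : 0 <= energy U.
Proof. by apply: Rintegral_ge0 => x _; exact: ppow_ge0. Qed.

Lemma pairing_young tau : 0 < tau -> exists2 C, 0 <= C & forall U G,
  Lp_field U -> Lp_field G ->
  `|pairing U G| <= tau * (energy U + IB) + C * energy G.
Proof.
move=> tau0; have [C C0 CP] := density_young tau0; exists C => // U G LU LG.
apply: le_trans (le_normr_Rintegral mD (integrable_density LU LG)) _.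
apply: (@le_trans _ _ (\int[mu]_(x in D) young_bound tau C U G x)).
  apply: le_Rintegral => //; last exact: density_le.
    exact: integrable_norm (integrable_density LU LG).
  exact: integrable_young.
have iU := integrable_ppow LU; have iG := integrable_ppow LG.
have i2 := integrable_comb mD 1 1 iU ibase.
by rewrite /young_bound (Rintegral_comb mD tau C i2 iG) (Rintegral_comb mD 1 1 iU ibase) !mul1r.
Qed.

Lemma pairing_bounded (r eta : R) : 0 < eta -> exists2 delta : R, 0 < delta &
  forall U G, Lp_field U -> Lp_field G -> energy U <= r -> energy G <= delta ->
  `|pairing U G| <= eta.
Proof.
move=> eta0; have S0 : 0 < `|r| + IB + 1 by rewrite ltr_wpDl// addr_ge0.
have t0 : 0 < eta / 2 / (`|r| + IB + 1) by rewrite !divr_gt0.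
have [C C0 CP] := pairing_young t0.
have C10 : 0 < C + 1 by rewrite ltr_wpDl.
exists (eta / 2 / (C + 1)) => [|U G LU LG Ur Gd]; first by rewrite !divr_gt0.
apply: le_trans (CP U G LU LG) _.
apply: le_trans (half_bound eta0 S0 C10 (sum1_le IB Ur) Gd); rewrite lerD2l.
by apply: ler_wpM2r; [exact: energy_ge0|rewrite lerDl].
Qed.

Lemma pairing_ucontinuous (r eta : R) : 0 < eta -> exists2 delta : R, 0 < delta &
  forall U W G, Lp_field U -> Lp_field W -> Lp_field G ->
  energy U <= r -> energy W <= r -> energy G <= r ->
  energy (U - W) <= delta -> `|pairing U G - pairing W G| <= eta.
Proof.
move=> eta0; pose m := \int[mu]_(x in D) (1 : R).
have m0 : 0 <= m by apply: Rintegral_ge0.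
pose S := m + `|r| + (`|r| + `|r|) + 1.
have S0 : 0 < S by rewrite ltr_wpDl// !addr_ge0.
have t0 : 0 < eta / 2 / S by rewrite !divr_gt0.
have [C C0 CP] := density_ucontinuous t0.
have C10 : 0 < C + 1 by rewrite ltr_wpDl.
exists (eta / 2 / (C + 1)) => [|U W G LU LW LG Ur Wr Gr UWd]; first by rewrite !divr_gt0.
have iUG := integrable_density LU LG; have iWG := integrable_density LW LG.
have iU := integrable_ppow LU; have iW := integrable_ppow LW.
have iG := integrable_ppow LG; have iUW := integrable_ppow (Lp_fieldB LU LW).
pose f x := eta / 2 / S * (1 * (1 * 1 + 1 * ppow p (U x)) +
  1 * (1 * ppow p (W x) + 1 * ppow p (G x))) + C * ppow p ((U - W) x).
have if1 := integrable_comb mD 1 1 i1 iU.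
have if2 := integrable_comb mD 1 1 iW iG.
have if12 := integrable_comb mD 1 1 if1 if2.
have iF' : mu.-integrable D (EFin \o f) by exact: integrable_comb.
have iB : mu.-integrable D (EFin \o (fun x =>
    pairing_density x (U x) (G x) - pairing_density x (W x) (G x))).
  by apply: eq_integrable (integrable_comb mD 1 (-1) iUG iWG) => // x _ /=;
    rewrite mul1r mulN1r.
rewrite /pairing -RintegralB//.
apply: le_trans (le_normr_Rintegral mD iB) _.
apply: (@le_trans _ _ (\int[mu]_(x in D) f x)).
  apply: le_Rintegral => //; first exact: integrable_norm iB.
  move=> x Dx; apply: le_trans (CP x Dx _ _ _) _.
  by rewrite /f le_eqVlt; apply/orP; left; apply/eqP; rewrite !mul1r !addrA.
rewrite /f Rintegral_comb// (Rintegral_comb mD 1 1 if1 if2).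
rewrite (Rintegral_comb mD 1 1 i1 iU).
rewrite (Rintegral_comb mD 1 1 iW iG).
apply: le_trans (half_bound eta0 S0 C10 (sum4_le m Ur Wr Gr) UWd); rewrite lerD2l.
by apply: ler_wpM2r; [exact: energy_ge0|rewrite lerDl].
Qed.

Lemma pairing_linear U G W (b c : R) : Lp_field U -> Lp_field G -> Lp_field W ->
  pairing U (b *: G + c *: W) = b * pairing U G + c * pairing U W.
Proof.
move=> LU LG LW; rewrite -Rintegral_comb//; [|exact: integrable_density..].
by apply: eq_Rintegral => x _; exact: density_linear.
Qed.

Lemma pairing_monotone U W : Lp_field U -> Lp_field W ->
  pairing W (U - W) <= pairing U (U - W).
Proof.
move=> LU LW; apply: le_Rintegral_ae => //.
- exact: integrable_density LW (Lp_fieldB LU LW).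
- exact: integrable_density LU (Lp_fieldB LU LW).
apply: filterS a_elliptic => x h Dx; exact: density_monotone (h Dx).
Qed.

Lemma pairing_coercive : exists r0, forall U, Lp_field U -> r0 <= energy U ->
  1 <= pairing U U.
Proof.
have [c [C [c0 C0 cP]]] := density_coercive.
exists ((1 + C * IB) / c) => U LU; rewrite ler_pdivrMr// => rU.
have iU := integrable_ppow LU.
have : \int[mu]_(x in D) (c * ppow p (U x) + (- C) * base x) <= pairing U U.
  apply: le_Rintegral_ae => //.
  - exact: integrable_comb.
  - exact: integrable_density.
  apply: filterS a_elliptic => x h Dx; apply: le_trans (cP x (h Dx) (U x)).
  by rewrite /base !mul1r mulNr.
rewrite Rintegral_comb// -/(energy U) -/IB; lra.
Qed.

Lemma energy0 : energy 0 = 0.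
Proof.
rewrite /energy; under eq_Rintegral do rewrite ppow0//.
by rewrite Rintegral_cst// mul0r.
Qed.

Lemma energyN U : energy (- U) = energy U.
Proof. by apply: eq_Rintegral => x _; exact: ppowN. Qed.

Lemma energy_convex U W (t : R) : Lp_field U -> Lp_field W -> 0 <= t <= 1 ->
  energy ((1 - t) *: U + t *: W) <= (1 - t) * energy U + t * energy W.
Proof.
move=> LU LW t01; have iU := integrable_ppow LU; have iW := integrable_ppow LW.
rewrite -Rintegral_comb//; apply: le_Rintegral => //.
- exact: integrable_ppow (Lp_field_comb (1 - t) t LU LW).
- exact: integrable_comb.
by move=> x _; apply: ppow_convex t01; exact: ltW.
Qed.

Lemma energy_double U : Lp_field U -> energy (2 *: U) <= 2 `^ p * energy U.
Proof.
move=> LU; rewrite -RintegralZl//; last exact: integrable_ppow.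
rewrite le_eqVlt; apply/orP; left; apply/eqP.
by apply: eq_Rintegral => x _; rewrite ppowZ ger0_norm.
Qed.

(** Uniform convexity of the L^p energy, for all p > 1, by integrating the pointwise
    inequality with eta scaled by the bound on the energies. *)
Lemma energy_uconvex (r eta : R) : 0 < eta -> exists2 delta : R, 0 < delta &
  forall U W, Lp_field U -> Lp_field W -> energy U <= r -> energy W <= r ->
  energy U / 2 + energy W / 2 - energy (2^-1 *: U + 2^-1 *: W) <= delta ->
  energy (U - W) <= eta.
Proof.
move=> eta0; have S0 : 0 < `|r| + `|r| + 1 by rewrite ltr_wpDl// addr_ge0.
have t0 : 0 < eta / 2 / (`|r| + `|r| + 1) by rewrite !divr_gt0.
have [C C0 CP] := @ppow_uconvex R N n p _ p1 t0.
exists (eta / 2 / C) => [|U W LU LW Ur Wr UWd]; first by rewrite !divr_gt0.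
have iU := integrable_ppow LU; have iW := integrable_ppow LW.
have iM := integrable_ppow (Lp_field_comb 2^-1 2^-1 LU LW).
have is1 := integrable_comb mD 1 1 iU iW.
have is2 := integrable_comb mD 2^-1 2^-1 iU iW.
have is3 := integrable_comb mD 1 (-1) is2 iM.
apply: (@le_trans _ _ (\int[mu]_(x in D) (eta / 2 / (`|r| + `|r| + 1) *
    (1 * ppow p (U x) + 1 * ppow p (W x)) +
    C * (1 * (2^-1 * ppow p (U x) + 2^-1 * ppow p (W x)) +
    (-1) * ppow p ((2^-1 *: U + 2^-1 *: W) x))))).
  apply: le_Rintegral => //.
  - exact: integrable_ppow (Lp_fieldB LU LW).
  - exact: integrable_comb.
  move=> x _; apply: le_trans (CP (U x) (W x)) _.
  by rewrite !mul1r mulN1r [2^-1 * _]mulrC [2^-1 * ppow _ _]mulrC.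
rewrite Rintegral_comb// (Rintegral_comb mD 1 1 iU iW) (Rintegral_comb mD 1 (-1) is2 iM).
rewrite (Rintegral_comb mD 2^-1 2^-1 iU iW).
exact: (half_bound eta0 S0 C0 (sum2_le Ur Wr) (defect_le UWd)).
Qed.
End operator.

(** * Norms, distances and products with bounded functions *)

Section Lnorm_pint.
Context d {T : measurableType d} {R : realType} (mu : {measure set T -> \bar R}).
Variables (D : set T) (mD : measurable D) (p : R) (p1 : 1 < p).
Implicit Types f g : T -> R.

Let p0 : 0 < p. Proof. exact: lt_trans p1. Qed.
Let pn0 : p != 0. Proof. by rewrite gt_eqF. Qed.

Let integral_restrict f :
  (\int[mu]_x (`|(EFin \o (f \_ D)) x| `^ p) = \int[mu]_(x in D) (`|f x| `^ p)%:E)%E.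
Proof.
rewrite [RHS]integral_mkcond; apply: eq_integral => x _ /=.
by rewrite !patchE; case: ifPn => // _; rewrite normr0 powR0.
Qed.

Lemma Lfun_pintegrable f : f \_ D \in Lfun mu p%:E <-> pintegrable mu D p f.
Proof.
split.
  move=> /andP[/[!inE] mf /=]; rewrite /finite_norm unlock /Lnorm integral_restrict => fin.
  have {}mf : measurable_fun D f by apply/(measurable_restrictT _ mD).
  split => //; apply/integrableP; split; first exact/measurable_EFinP/measurable_norm_powR.
  have := lty_poweRy (invr_neq0 pn0) fin; apply: le_lt_trans.
  rewrite le_eqVlt; apply/orP; left; apply/eqP; apply: eq_integral => x _ /=.
  by rewrite ger0_norm// powR_ge0.
move=> [mf i_f]; apply/andP; split.
  by rewrite inE /=; apply/(measurable_restrictT _ mD).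
rewrite inE /= /finite_norm unlock /Lnorm integral_restrict poweR_lty//.
rewrite pint_EFin//; first exact: ltry.
Qed.

Lemma Lnorm_pint f : pintegrable mu D p f ->
  (Lnorm mu p%:E (EFin \o (f \_ D)) = ((pint mu D p f) `^ p^-1)%:E)%E.
Proof. by move=> pf; rewrite unlock integral_restrict pint_EFin// poweR_EFin. Qed.

Lemma Lnorm_cvg0P (f : nat -> T -> R) : (forall k, pintegrable mu D p (f k)) ->
  Lnorm mu p%:E (EFin \o (f k \_ D)) @[k --> \oo] --> 0%E <->
  forall eta : R, 0 < eta -> exists k0, forall k, (k0 <= k)%N -> pint mu D p (f k) <= eta.
Proof.
move=> pf.
rewrite (_ : (fun k => _) = EFin \o (fun k => (pint mu D p (f k)) `^ p^-1)); last first.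
  by apply/funext => k; rewrite Lnorm_pint.
have pinv : 0 < p^-1 by rewrite invr_gt0.
have powK x : 0 <= x -> (x `^ p^-1) `^ p = x.
  by move=> x0; rewrite -powRrM mulVf// powRr1.
split.
  move=> /fine_cvgP[_] /cvgrPdist_lt h eta eta0.
  have e0 : 0 < eta `^ p^-1 by exact: powR_gt0.
  have [k0 _ k0P] := h _ e0; exists k0 => k kk; have := k0P k kk.
  rewrite /= sub0r normrN ger0_norm ?powR_ge0// => lt_e.
  rewrite -(powK _ (pint_ge0 _ _ _ _)) -(powK _ (ltW eta0)).
  by apply: (ge0_ler_powR (ltW p0)); rewrite ?nnegrE ?powR_ge0// ltW.
move=> h; apply/fine_cvgP; split; first exact: nearW.
apply/cvgrPdist_le => eta eta0; have [k0 k0P] := h _ (powR_gt0 p eta0).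
exists k0 => // k kk /=; rewrite sub0r normrN ger0_norm ?powR_ge0//.
have -> : eta = (eta `^ p) `^ p^-1 by rewrite -powRrM mulfV// powRr1// ltW.
by apply: (ge0_ler_powR (ltW pinv)); rewrite ?nnegrE ?pint_ge0 ?powR_ge0// k0P.
Qed.

(** Young's inequality with a free parameter k takes the place of Hoelder's: the
    term with psi is made small by k, then the one with f by delta. *)
Lemma integral_bounded_small (muD : (mu D < +oo)%E) (psi : T -> R) (B : R) :
  measurable_fun D psi -> (forall x, `|psi x| <= B) ->
  (forall f, pintegrable mu D p f -> mu.-integrable D (EFin \o (fun x => f x * psi x))) /\
  forall eta : R, 0 < eta -> exists2 delta : R, 0 < delta & forall f,
    pintegrable mu D p f -> pint mu D p f <= delta ->
    `|\int[mu]_(x in D) (f x * psi x)| <= eta.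
Proof.
move=> mpsi psiB; have p10 : 0 < p - 1 by rewrite subr_gt0.
have B0 : 0 <= B by rewrite (le_trans (normr_ge0 _) (psiB point)).
pose q x := `|psi x| `^ (p - 1)^-1.
pose c := B `^ (p / (p - 1)).
have young k x y : 0 < k -> `|y * psi x| <= k `^ (p - 1) * `|y| `^ p + k^-1 * c.
  move=> k0; rewrite normrM mulrC.
  have := @powR_young R p k (q x) `|y| p1 k0 (powR_ge0 _ _) (normr_ge0 _).
  rewrite /q -!powRrM mulVf ?gt_eqF// powRr1// => /le_trans; apply.
  rewrite lerD2l; apply: ler_wpM2l; first by rewrite invr_ge0 ltW.
  rewrite /c [p / _]mulrC; apply: ge0_ler_powR; rewrite ?nnegrE// ltW//.
  by rewrite mulr_gt0// invr_gt0.
have i1 : mu.-integrable D (EFin \o (fun _ => c)).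
  by apply: (@integrable_bounded _ _ _ _ _ mD muD `|c|).
have ib k f : pintegrable mu D p f -> mu.-integrable D
    (EFin \o (fun x => k `^ (p - 1) * `|f x| `^ p + k^-1 * c)).
  by move=> [_ i_f]; exact: (integrable_comb mD (k `^ (p - 1)) k^-1 i_f i1).
have ip f : pintegrable mu D p f -> mu.-integrable D (EFin \o (fun x => f x * psi x)).
  move=> pf; have [mf i_f] := pf.
  apply: (integrable_le mD _ (ib 1 f pf)); first exact: measurable_funM.
  by move=> x _; exact: young.
split => // eta eta0; pose m := \int[mu]_(x in D) c.
have m0 : 0 <= m by apply: Rintegral_ge0 => x _; exact: powR_ge0.
pose k := (m + 1) / (eta / 2).
have k0 : 0 < k by rewrite divr_gt0 ?divr_gt0// ltr_wpDl.
have kp0 : 0 < k `^ (p - 1) by exact: powR_gt0.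
exists (eta / 2 / k `^ (p - 1)) => [|f pf fd]; first by rewrite !divr_gt0.
have [mf i_f] := pf; have ifp := ip f pf.
apply: le_trans (le_normr_Rintegral mD ifp) _.
apply: (@le_trans _ _ (\int[mu]_(x in D) (k `^ (p - 1) * `|f x| `^ p + k^-1 * c))).
  apply: le_Rintegral => //; [exact: integrable_norm ifp|exact: ib|].
  by move=> x _; exact: young.
rewrite (Rintegral_comb mD (k `^ (p - 1)) k^-1 i_f i1) -/(pint mu D p f) -/m.
rewrite [leRHS](splitr eta); apply: lerD; first by rewrite mulrC -ler_pdivlMr.
rewrite /k invf_div mulrAC ler_pdivrMr ?ltr_wpDl// ler_pM2l ?divr_gt0//.
by rewrite lerDl.
Qed.
End Lnorm_pint.

(** * Test functions and the Poincare inequality *)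

Lemma measurable_sgr {R : realType} : measurable_fun [set: R] (@Num.sg R).
Proof.
apply: nondecreasing_measurable => // x y xy; case: (sgrP x) => [x0|x0|x0].
- by rewrite sgr_ge0 -x0.
- by rewrite gtr0_sg// (lt_le_trans x0).
- by case: sgrP => _; rewrite ?lexx// (le_trans (lerN10 _)).
Qed.

Lemma normr_sgM_le {R : realType} (y r : R) : `|Num.sg y * r| <= `|r|.
Proof.
by rewrite normrM normr_sg -[leRHS]mul1r ler_wpM2r//; case: eqP.
Qed.

(** The part of the bound that contains P amounts to half of P and moves to the
    other side. *)
Lemma absorb_half {R : realType} (m k s P Q : R) : m * k = 2^-1 ->
  1 * P + - m * (s * Q + k * P) <= 0 -> P <= 2 * (m * s) * Q.
Proof.
move=> mk; have -> : 1 * P + - m * (s * Q + k * P) = P - m * s * Q - (m * k) * P by ring.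
by rewrite mk -mulrA; lra.
Qed.

Section directional_derivative.
Context {R : realType} {n : nat}.

(** The reduction of directional derivatives to ordinary ones, which gives access
    to the chain rule for the nonsmooth function |t|^p. *)
Lemma is_derive_along (G : 'rV[R]_n -> R) (x v : 'rV[R]_n) (dG : R) :
  is_derive (0 : R) (1 : R) (fun t : R => G (x + t *: v)) dG -> is_derive x v G dG.
Proof.
move=> [dl dv].
have E : (fun h : R => h^-1 *: (((fun t : R => G (x + t *: v)) \o shift 0) (h *: (1 : R)) -
      G (x + (0 : R) *: v))) =
    (fun h : R => h^-1 *: ((G \o shift x) (h *: v) - G x)).
  apply/funext => h /=; rewrite scale0r !addr0; congr (_ *: (G _ - _)).
  by rewrite [h *: 1]mulr1 addrC.
by apply: DeriveDef; [move: dl|rewrite -dv]; rewrite /derivable /derive E.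
Qed.

Lemma partial_comb (i : 'I_n) (a b : R) (f g : 'rV[R]_n -> R) x :
  derivable f x (delta_mx 0 i) -> derivable g x (delta_mx 0 i) ->
  derivable (fun y => a * f y + b * g y) x (delta_mx 0 i) /\
  partial i (fun y => a * f y + b * g y) x = a * partial i f x + b * partial i g x.
Proof.
move=> df dg; have [d1 d2] := is_deriveD (is_deriveZ a (derivableP df)) (is_deriveZ b (derivableP dg)).
by split.
Qed.

Lemma continuous_comb (a b : R) (f g : 'rV[R]_n -> R) : continuous f -> continuous g ->
  continuous (fun x => a * f x + b * g x).
Proof.
move=> cf cg x.
have caf : {for x, continuous (fun x => a * f x)}.
  exact: (continuousM (@cst_continuous _ _ a x) (cf x)).
have cbg : {for x, continuous (fun x => b * g x)}.
  exact: (continuousM (@cst_continuous _ _ b x) (cg x)).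
exact: (continuousD caf cbg).
Qed.
End directional_derivative.

Section test_functions.
Context {R : realType} {n : nat}.
Variables (Omega : set 'rV[R]_n) (M : R).
Hypothesis OM : forall x, Omega x -> `|x| <= M.
Hypothesis Oopen : open Omega.
Notation leb := (rV_lebesgue R n).
Local Notation mu := (lebesgue_measure_rV R n).
Implicit Types f g phi psi : 'rV[R]_n -> R.

Lemma smooth_comb (a b : R) f g : smooth f -> smooth g ->
  (forall s, iter_partial s (fun x => a * f x + b * g x) =
     (fun x => a * iter_partial s f x + b * iter_partial s g x)) /\
  smooth (fun x => a * f x + b * g x).
Proof.
move=> sf sg.
have E s : iter_partial s (fun x => a * f x + b * g x) =
     (fun x => a * iter_partial s f x + b * iter_partial s g x).
  elim: s => // i s IHs; rewrite /= IHs; apply/funext => x.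
  by have [_ df] := sf s; have [_ dg] := sg s; have [] := partial_comb a b (df i x) (dg i x).
split; first exact: E.
move=> s; rewrite E; have [cf df] := sf s; have [cg dg] := sg s; split.
  exact: continuous_comb.
by move=> i x; have [] := partial_comb a b (df i x) (dg i x).
Qed.

Lemma test_function_comb (a b : R) f g : test_function Omega f ->
  test_function Omega g -> test_function Omega (fun x => a * f x + b * g x).
Proof.
move=> [sf cf fO] [sg cg gO].
have sub : fsupport (fun x => a * f x + b * g x) `<=` fsupport f `|` fsupport g.
  rewrite /fsupport -closureU; apply: closure_subset => x /= nz.
  have [fx0|fx0] := eqVneq (f x) 0; last by left.
  by right; apply: contraNneq nz => gx0; rewrite fx0 gx0 !mulr0 addr0.
split.
- by have [] := smooth_comb a b sf sg.
- apply: subclosed_compact sub; first exact: closed_closure.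
  exact: compactU.
- by move=> x /sub[/fO|/gO].
Qed.

Lemma partial_test_comb (a b : R) f g i : test_function Omega f ->
  test_function Omega g -> partial i (fun x => a * f x + b * g x) =
  (fun x => a * partial i f x + b * partial i g x).
Proof.
by move=> [sf _ _] [sg _ _]; have [/(_ [:: i])] := smooth_comb a b sf sg.
Qed.

Lemma test_function0 : test_function Omega (fun _ => 0).
Proof.
have E s : iter_partial s (fun _ => 0 : R) = (fun _ : 'rV[R]_n => 0).
  elim: s => // i s IHs; rewrite /= IHs; apply/funext => x.
  exact: derive_cst.
have F0 : fsupport (fun _ : 'rV[R]_n => 0 : R) = set0.
  rewrite /fsupport (_ : [set _ | _] = set0) ?closure0//.
  by apply/seteqP; split => x //=; rewrite eqxx.
split; rewrite ?F0//; last exact: compact0.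
move=> s; rewrite E; split => [|i x]; first exact: cst_continuous.
exact: derivable_cst.
Qed.

Lemma test_derivable phi i x : test_function Omega phi -> derivable phi x (delta_mx 0 i).
Proof. by move=> [s _ _]; have [_ /(_ i x)] := s [::]. Qed.

Lemma test_continuous phi : test_function Omega phi -> continuous phi.
Proof. by move=> [s _ _]; have [] := s [::]. Qed.

Lemma test_partial_continuous phi i : test_function Omega phi -> continuous (partial i phi).
Proof. by move=> [s _ _]; have [] := s [:: i]. Qed.

(** Off the closed support the function vanishes in a neighbourhood. *)
Lemma zero_off_support phi x : ~ fsupport phi x ->
  phi x = 0 /\ forall i, partial i phi x = 0.
Proof.
move=> nsx; have /= zero : \near x, phi x = 0.
  have : nbhs x (~` fsupport phi).
    by apply: open_nbhs_nbhs; split => //; apply: closed_openC; exact: closed_closure.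
  apply: filterS => y nsy; apply/eqP; apply: contrapT => /negP ny0.
  exact/nsy/subset_closure.
split; first exact: nbhs_singleton zero.
by move=> i; rewrite /partial (near_eq_derive (g := cst 0))//; exact: derive_cst.
Qed.

Lemma test_support phi x : test_function Omega phi -> ~ Omega x ->
  phi x = 0 /\ forall i, partial i phi x = 0.
Proof. by move=> [_ _ sO] nOx; apply: zero_off_support => /sO. Qed.

Lemma bounded_of_support f (K : set 'rV[R]_n) : continuous f -> compact K ->
  (forall x, ~ K x -> f x = 0) -> exists B, forall x, `|f x| <= B.
Proof.
move=> cf cK f0.
have /compact_bounded[B [_ BP]] : compact (f @` K).
  by apply: continuous_compact => //; exact: continuous_subspaceT.
exists (`|B| + 1) => x; have [Kx|/f0->] := pselect (K x).
  by apply: BP; [rewrite ltr_pwDr// ler_norm|exists x].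
by rewrite normr0 addr_ge0.
Qed.

Lemma test_bounded phi : test_function Omega phi -> exists B : R, 0 <= B /\ forall x,
  `|phi x| <= B /\ forall i, `|partial i phi x| <= B.
Proof.
move=> tphi; have [_ cK sO] := tphi.
have out x (nsx : ~ fsupport phi x) := zero_off_support nsx.
have [B0 B0P] := bounded_of_support (test_continuous tphi) cK (fun x h => (out x h).1).
have /choice[B BP] : forall i, exists B, forall x, `|partial i phi x| <= B.
  move=> i; apply: bounded_of_support (test_partial_continuous tphi) cK _ => x h.
  by have [_] := out x h; apply.
exists (`|B0| + \sum_i `|B i|); split; first by rewrite addr_ge0// sumr_ge0.
move=> x; split.
  by rewrite (le_trans (B0P x))// (le_trans (ler_norm _))// lerDl sumr_ge0.
move=> i; apply: le_trans (BP i x) _; apply: le_trans (ler_norm _) _.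
by rewrite (bigD1 i)//= addrCA lerDl addr_ge0// sumr_ge0.
Qed.

Lemma measurable_Omega : measurable (Omega : set leb).
Proof. exact: open_measurable_lebesgue. Qed.

Lemma lebesgue_Omega_lty : (mu Omega < +oo)%E.
Proof. exact: bounded_lebesgue_lty OM measurable_Omega. Qed.

Lemma continuous_pintegrable p f B : continuous f -> (forall x, `|f x| <= B) ->
  0 < p -> pintegrable mu (Omega : set leb) p f.
Proof.
move=> cf fB p0.
have mf : measurable_fun (Omega : set leb) f.
  exact: measurable_funTS (continuous_measurable_lebesgue cf).
split => //.
have fBp x : Omega x -> `| `|f x| `^ p | <= B `^ p.
  move=> _; rewrite ger0_norm ?powR_ge0//; apply: (ge0_ler_powR (ltW p0)); rewrite ?nnegrE//.
  exact: le_trans (fB x).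
exact: (integrable_bounded measurable_Omega lebesgue_Omega_lty (measurable_norm_powR p mf) fBp).
Qed.

Lemma test_pintegrable p phi : 0 < p -> test_function Omega phi ->
  pintegrable mu (Omega : set leb) p phi.
Proof.
move=> p0 tphi; have [B [_ BP]] := test_bounded tphi.
by apply: (@continuous_pintegrable p phi B) => [|x|//]; [exact: test_continuous|case: (BP x)].
Qed.

Lemma test_partial_pintegrable p phi i : 0 < p -> test_function Omega phi ->
  pintegrable mu (Omega : set leb) p (partial i phi).
Proof.
move=> p0 tphi; have [B [_ BP]] := test_bounded tphi.
apply: (@continuous_pintegrable p _ B) => [|x|//]; first exact: test_partial_continuous.
by case: (BP x).
Qed.

Lemma integral_partial_support (g : 'rV[R]_n -> R) i (B : R) : continuous g ->
  (forall x, derivable g x (delta_mx 0 i)) ->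
  (forall x, `|g x| <= B) -> (forall x, `|partial i g x| <= B) ->
  (forall x, ~ Omega x -> g x = 0 /\ partial i g x = 0) ->
  \int[mu]_(x in Omega) partial i g x = 0.
Proof.
move=> cg dg gB pgB g0.
have gM x : M < `|x| -> g x = 0.
  move=> Mx; apply: (g0 x _).1 => /OM; rewrite leNgt; exact/negP/negPn.
rewrite Rintegral_mkcond (_ : _ \_ _ = partial i g).
  exact: (integral_partial_eq0 cg dg gB pgB gM).
by apply/funext => x; rewrite patchE; case: ifPn => //; rewrite notin_setE => /g0[].
Qed.

(** The partial derivative of the product has integral zero. *)
Lemma test_integration_by_parts phi psi i : test_function Omega phi ->
  test_function Omega psi ->
  \int[mu]_(x in Omega) (phi x * partial i psi x) =
  - \int[mu]_(x in Omega) (partial i phi x * psi x).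
Proof.
move=> tphi tpsi; have [B1 [B10 B1P]] := test_bounded tphi.
have [B2 [B20 B2P]] := test_bounded tpsi.
have dphi x : derivable phi x (delta_mx 0 i) by exact: test_derivable.
have dpsi x : derivable psi x (delta_mx 0 i) by exact: test_derivable.
have cphi := test_continuous tphi; have cpsi := test_continuous tpsi.
have cpphi := test_partial_continuous (i := i) tphi.
have cppsi := test_partial_continuous (i := i) tpsi.
have pE x : partial i (fun x => phi x * psi x) x =
    phi x * partial i psi x + partial i phi x * psi x.
  have [_] := is_deriveM (derivableP (dphi x)) (derivableP (dpsi x)).
  by rewrite [partial i phi x * _]mulrC; exact.
have pB (u v : R) : `|u| <= B1 -> `|v| <= B2 -> `|u * v| <= B1 * B2.
  by move=> uB vB; rewrite normrM ler_pM.
have cM f g : continuous f -> continuous g -> continuous (fun x => f x * g x).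
  by move=> cf cg x; exact: (continuousM (cf x) (cg x)).
have iM f g : continuous f -> continuous g ->
    (forall x, `|f x| <= B1) -> (forall x, `|g x| <= B2) ->
    mu.-integrable (Omega : set leb) (EFin \o (fun x => f x * g x)).
  move=> cf cg fB gB; apply: (integrable_bounded measurable_Omega lebesgue_Omega_lty
    (measurable_funTS (continuous_measurable_lebesgue (cM _ _ cf cg)))
    (c := B1 * B2)) => x _; exact: pB.
have := @integral_partial_support (fun x => phi x * psi x) i (B1 * B2 + B1 * B2)
  (cM _ _ cphi cpsi).
have i1 := iM _ _ cphi cppsi (fun x => (B1P x).1) (fun x => (B2P x).2 i).
have i2 := iM _ _ cpphi cpsi (fun x => (B1P x).2 i) (fun x => (B2P x).1).
rewrite (funext pE) (RintegralD measurable_Omega i1 i2) => h.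
apply/eqP; rewrite -addr_eq0; apply/eqP; apply: h.
- move=> x; exact: derivableM.
- move=> x; apply: le_trans (pB _ _ (B1P x).1 (B2P x).1) _.
  by rewrite lerDl mulr_ge0.
- move=> x; apply: le_trans (ler_normD _ _) _; apply: lerD; apply: pB => //.
  + by have [] := B1P x.
  + by have [_] := B2P x; apply.
  + by have [_] := B1P x; apply.
  + by have [] := B2P x.
- move=> x nOx; have [p0 pp0] := test_support tphi nOx.
  by rewrite p0 pp0 !mul0r addr0.
Qed.

(** The partial derivative of x_i |phi|^p has integral zero, so the integral of
    |phi|^p is at most M1 p times that of |phi|^(p-1) |d_i phi|. Young's
    inequality absorbs half of the former. *)
Lemma poincare p i : 1 < p -> exists2 C, 0 <= C & forall phi, test_function Omega phi ->
  pint mu (Omega : set leb) p phi <= C * pint mu (Omega : set leb) p (partial i phi).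
Proof.
move=> p1; have p0 : 0 < p by lra.
pose M1 := `|M| + 1; have M10 : 0 < M1 by rewrite ltr_wpDl.
have OM1 x : Omega x -> `|x| <= M1.
  by move=> /OM /le_trans; apply; rewrite ler_wpDr// ler_norm.
(* the weight for which Young's inequality leaves M1 * p / k = 1 / 2 *)
pose k := 2 * (M1 * p); have k0 : 0 < k by rewrite !mulr_gt0.
exists (2 * (M1 * p * k `^ (p - 1))) => [|phi tphi].
  by rewrite !mulr_ge0 ?powR_ge0// ltW.
have [B [B0 BP]] := test_bounded tphi.
have dphi x : derivable phi x (delta_mx 0 i) by exact: test_derivable.
have cphi := test_continuous tphi.
pose G (x : 'rV[R]_n) := x 0 i * `|phi x| `^ p.
pose dG (x : 'rV[R]_n) := `|phi x| `^ p +
  x 0 i * (p * (Num.sg (phi x) * `|phi x| `^ (p - 1)) * partial i phi x).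
have xi (x : 'rV[R]_n) : `|x 0 i| <= `|x|.
  by rewrite {2}/Num.norm/= mx_normrE; apply: (le_bigmax _ (fun ij => `|x ij.1 ij.2|) (0, i)).
have isG x : is_derive x (delta_mx 0 i) G (dG x).
  apply: is_derive_along.
  have h1 := is_derive_line dphi x 0; rewrite scale0r addr0 in h1.
  have e0 : phi (x + (0 : R) *: delta_mx 0 i) = phi x by rewrite scale0r addr0.
  have h2 := @is_derive1_norm_powR R p (phi (x + (0 : R) *: delta_mx 0 i)) p1.
  have h3 := is_derive1_comp h2 h1; rewrite e0 in h3.
  have h4 : is_derive (0 : R) (1 : R) (fun t : R => x 0 i + t) 1.
    have := is_deriveD (is_derive_cst (x 0 i) (0 : R) (1 : R)) (is_derive_id (0 : R) (1 : R)).
    by rewrite add0r.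
  have := is_deriveM h4 h3.
  rewrite (_ : (fun t : R => G _) = (fun t : R => x 0 i + t) *
    ((fun x : R => `|x| `^ p) \o (fun t : R => phi (x + t *: delta_mx 0 i)))); last first.
    apply/funext => t; rewrite /G.
    have -> : (x + t *: (delta_mx 0 i : 'rV[R]_n)) 0 i = x 0 i + t.
      by rewrite !mxE !eqxx /= mulr1.
    by [].
  move=> h5; apply: (is_derive_eq h5); rewrite /dG /= scale0r !addr0.
  by rewrite [_ *: 1]mulr1 addrC.
have pGE x : partial i G x = dG x by case: (isG x).
have Gout x : ~ Omega x -> G x = 0 /\ dG x = 0.
  move=> nOx; have [ph0 pp0] := test_support tphi nOx.
  by rewrite /G /dG ph0 pp0 normr0 powR0 ?gt_eqF// !mulr0 addr0.
have Bp x : `|phi x| `^ p <= B `^ p.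
  by apply: (ge0_ler_powR (ltW p0)); rewrite ?nnegrE//; case: (BP x).
have Bp1 x : `|phi x| `^ (p - 1) <= B `^ (p - 1).
  by apply: ge0_ler_powR; rewrite ?nnegrE//; [lra|case: (BP x)].
pose C := M1 * B `^ p + (B `^ p + M1 * (p * B `^ (p - 1) * B)).
have C1 : 0 <= M1 * B `^ p by rewrite mulr_ge0 ?powR_ge0 ?(ltW M10).
have C2 : 0 <= B `^ p + M1 * (p * B `^ (p - 1) * B).
  by rewrite addr_ge0 ?powR_ge0// !mulr_ge0 ?powR_ge0 ?(ltW M10) ?(ltW p0).
have dGle x : Omega x -> `|x 0 i * (p * (Num.sg (phi x) * `|phi x| `^ (p - 1)) * partial i phi x)|
    <= M1 * (p * (`|phi x| `^ (p - 1) * `|partial i phi x|)).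
  move=> Ox; rewrite normrM; apply: ler_pM => //; first exact: le_trans (xi x) (OM1 _ Ox).
  rewrite normrM normrM (ger0_norm (ltW p0)) -!mulrA ler_pM2l//.
  apply: ler_wpM2r => //; apply: le_trans (normr_sgM_le _ _) _.
  by rewrite ger0_norm ?powR_ge0.
have cG : continuous G.
  move=> x; have cp := continuous_comp (cphi x) (@continuous_norm_powR R p p1 (phi x)).
  exact: (continuousM (@coord_continuous R 1 n 0 i x) cp).
have dGB x : Omega x -> `|dG x| <= B `^ p + M1 * (p * B `^ (p - 1) * B).
  move=> Ox; apply: le_trans (ler_normD _ _) _; apply: lerD.
    by rewrite ger0_norm ?powR_ge0.
  apply: le_trans (dGle x Ox) _; rewrite ler_pM2l// -mulrA ler_pM2l//.
  apply: ler_pM => //.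
  by have [_] := BP x; apply.
have int0 : \int[mu]_(x in Omega) dG x = 0.
  rewrite -(funext pGE); apply: (@integral_partial_support G i C) => //.
  - move=> x; have [Ox|nOx] := pselect (Omega x); last first.
      by rewrite (Gout x nOx).1 normr0 addr_ge0.
    rewrite ler_wpDr// normrM; apply: ler_pM => //; first exact: le_trans (xi x) (OM1 _ Ox).
    by rewrite ger0_norm ?powR_ge0.
  - move=> x; rewrite pGE; have [Ox|nOx] := pselect (Omega x); last first.
      by rewrite (Gout x nOx).2 normr0 addr_ge0.
    by apply: le_trans (dGB x Ox) _; rewrite lerDr.
  - by move=> x nOx; rewrite pGE; exact: Gout.
have pphi := test_pintegrable p0 tphi; have ppphi := test_partial_pintegrable i p0 tphi.
have i1 := integrable_comb measurable_Omega (k `^ (p - 1)) k^-1 ppphi.2 pphi.2.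
have i2 := integrable_comb measurable_Omega 1 (- (M1 * p)) pphi.2 i1.
have idG : mu.-integrable (Omega : set leb) (EFin \o dG).
  apply: (integrable_bounded measurable_Omega lebesgue_Omega_lty _ dGB).
  have mphi := continuous_measurable_lebesgue cphi.
  have mpp := continuous_measurable_lebesgue (test_partial_continuous (i := i) tphi).
  have mx := continuous_measurable_lebesgue (@coord_continuous R 1 n 0 i).
  apply: measurable_funTS; apply: (measurable_funD (measurable_norm_powR p mphi)).
  apply: (measurable_funM mx); apply: (fun h => measurable_funM h mpp).
  apply: (measurable_funM (measurable_cst p)).
  apply: (fun h => measurable_funM h (measurable_norm_powR (p - 1) mphi)).
  exact: (measurableT_comp measurable_sgr mphi).
have : \int[mu]_(x in Omega) (1 * `|phi x| `^ p + - (M1 * p) *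
    (k `^ (p - 1) * `|partial i phi x| `^ p + k^-1 * `|phi x| `^ p)) <=
    \int[mu]_(x in Omega) dG x.
  apply: (le_Rintegral measurable_Omega i2 idG) => x Ox.
  have := dGle x Ox; rewrite ler_norml => /andP[h _].
  have := powR_young p1 k0 (normr_ge0 (phi x)) (normr_ge0 (partial i phi x)).
  rewrite -(ler_pM2l p0) -(ler_pM2l M10) /dG => h2; rewrite mul1r lerD2l.
  by apply: le_trans h; rewrite mulNr lerN2 -mulrA.
rewrite int0 (Rintegral_comb measurable_Omega 1 (- (M1 * p)) pphi.2 i1).
rewrite (Rintegral_comb measurable_Omega (k `^ (p - 1)) k^-1 ppphi.2 pphi.2).
rewrite -/(pint mu _ p phi) -/(pint mu _ p (partial i phi)).
have kE : M1 * p * k^-1 = 2^-1 by rewrite /k invfM mulrCA mulfV ?mulr1// gt_eqF// mulr_gt0.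
exact: absorb_half.
Qed.
End test_functions.

(** * Limits of fields *)

Lemma finite_eventually (I : finType) (Q : I -> nat -> Prop) :
  (forall i, exists k0, forall k, (k0 <= k)%N -> Q i k) ->
  exists k0, forall k, (k0 <= k)%N -> forall i, Q i k.
Proof.
move=> /choice[k0 k0P]; exists (\max_i k0 i)%N => k kk i; apply: k0P.
exact: leq_trans (leq_bigmax i) kk.
Qed.

Section field_convergence.
Context d {T : measurableType d} {R : realType} (mu : {measure set T -> \bar R}).
Variables (D : set T) (mD : measurable D) (muD : (mu D < +oo)%E).
Variables (N n : nat) (p : R).
Hypothesis p1 : 1 < p.
Implicit Types U W : T -> 'M[R]_(N + N, n).

Lemma pint_le_energy U i k : Lp_field mu D p U ->
  pint mu D p (fun x => U x i k) <= energy mu D p U.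
Proof.
move=> LU; rewrite (energyE mD muD LU) (bigD1 (i, k))//= lerDl.
by apply: sumr_ge0 => q _; exact: pint_ge0.
Qed.

Lemma energy_cvgP (U : nat -> T -> 'M[R]_(N + N, n)) W :
  (forall k, Lp_field mu D p (U k)) -> Lp_field mu D p W ->
  (forall i j (eta : R), 0 < eta -> exists k0, forall k, (k0 <= k)%N ->
    pint mu D p ((fun x => U k x i j) \- (fun x => W x i j)) <= eta) ->
  forall eta : R, 0 < eta -> exists k0, forall k, (k0 <= k)%N ->
    energy mu D p (U k - W) <= eta.
Proof.
move=> LU LW cv eta eta0.
pose m := #|{: 'I_(N + N) * 'I_n}|.
have m0 : 0 < m.+1%:R :> R by rewrite ltr0n.
have [k0 k0P] := @finite_eventually _ (fun (q : 'I_(N + N) * 'I_n) k =>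
  pint mu D p ((fun x => U k x q.1 q.2) \- (fun x => W x q.1 q.2)) <= eta / m.+1%:R)
  (fun q => cv q.1 q.2 _ (divr_gt0 eta0 m0)).
exists k0 => k /k0P le_eta; rewrite (energyE mD muD (Lp_fieldB mD p1 (LU k) LW)).
apply: (@le_trans _ _ (\sum_(q : 'I_(N + N) * 'I_n) eta / m.+1%:R)).
  apply: ler_sum => q _; apply: le_trans (le_eta q).
  rewrite le_eqVlt; apply/orP; left; apply/eqP.
  by apply: eq_Rintegral => x _; rewrite /= !mxE.
rewrite sumr_const -[leLHS]mulr_natr -mulrA [_^-1 * _]mulrC mulrA ler_pdivrMr//.
by rewrite ler_pM2l// ler_nat.
Qed.

(** Completeness entry by entry. *)
Lemma field_complete (U : nat -> T -> 'M[R]_(N + N, n)) :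
  (forall k, Lp_field mu D p (U k)) ->
  (forall eta : R, 0 < eta -> exists k0, forall k l, (k0 <= k)%N -> (k0 <= l)%N ->
    energy mu D p (U k - U l) <= eta) ->
  exists2 W, Lp_field mu D p W & forall eta : R, 0 < eta -> exists k0, forall k,
    (k0 <= k)%N -> energy mu D p (U k - W) <= eta.
Proof.
move=> LU cU.
have /choice[w wP] : forall q : 'I_(N + N) * 'I_n, exists g : T -> R,
    pintegrable mu D p g /\ forall eta : R, 0 < eta -> exists k0, forall k, (k0 <= k)%N ->
      pint mu D p ((fun x => U k x q.1 q.2) \- g) <= eta.
  move=> q; have [eta eta0|g pg gP] := pint_complete mD p1 (f := fun k x => U k x q.1 q.2)
      (fun k => LU k q.1 q.2); last by exists g.
  have [k0 k0P] := cU eta eta0; exists k0 => k l kk kl.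
  apply: le_trans (k0P k l kk kl).
  apply: le_trans (pint_le_energy q.1 q.2 (Lp_fieldB mD p1 (LU k) (LU l))).
  rewrite le_eqVlt; apply/orP; left; apply/eqP.
  by apply: eq_Rintegral => x _; rewrite /= !mxE.
pose W x : 'M[R]_(N + N, n) := \matrix_(i, j) w (i, j) x.
have WE i j : (fun x => W x i j) = w (i, j) by apply/funext => x; rewrite mxE.
have LW : Lp_field mu D p W by move=> i j; rewrite WE; case: (wP (i, j)).
exists W => //; apply: energy_cvgP => // i j.
by rewrite WE; case: (wP (i, j)).
Qed.
End field_convergence.

Section weak_limit.
Context d {T : measurableType d} {R : realType} (mu : {measure set T -> \bar R}).
Variables (D : set T) (mD : measurable D) (muD : (mu D < +oo)%E).
Variables (N n : nat) (p eps c1 c2 nu M : R).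
Hypothesis p1 : 1 < p.
Hypothesis eps01 : 0 <= eps <= 1.
Hypothesis hc : structure_constants p c1 c2.
Hypothesis nu0 : 0 < nu.
Hypothesis M0 : 0 < M.
Variable a : T -> R[i].
Hypothesis ma : measurable_fun D (fun x => complex.Re (a x)) /\
  measurable_fun D (fun x => complex.Im (a x)).
Hypothesis aM : forall x, D x -> `|complex.Re (a x)| <= M /\ `|complex.Im (a x)| <= M.
Hypothesis a_elliptic : {ae mu, forall x, D x ->
  nu < complex.Re (a x) - `|complex.Im (a x)| /\
  c2 * `|complex.Im (a x)| <= c1 * complex.Re (a x)}.
Variable F : T -> 'M[R[i]]_(N, n).
Hypothesis mF : mx_measurable D F.
Hypothesis iF : mu.-integrable D (EFin \o (fun x => cnorm (F x) `^ (p / (p - 1)))).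
Variable P : (T -> 'M[R]_(N + N, n)) -> Prop.
Hypothesis P0 : P 0.
Hypothesis Pcomb : forall (b c : R) U W, P U -> P W -> P (b *: U + c *: W).
Hypothesis PL : forall U, P U -> Lp_field mu D p U.

(** P stands for the gradients of test functions. The approximate solutions in P
    converge to a field W, which by continuity of the functional in each argument
    solves the equation against the whole closure of P. *)
Lemma closure_solution : exists U : nat -> T -> 'M[R]_(N + N, n), exists W,
  [/\ forall k, P (U k), Lp_field mu D p W,
      forall eta : R, 0 < eta -> exists k0, forall k, (k0 <= k)%N ->
        energy mu D p (U k - W) <= eta &
      forall G, Lp_field mu D p G ->
        (forall eta : R, 0 < eta -> exists2 g, P g & energy mu D p (g - G) <= eta) ->
        pairing mu D p eps a F W G = 0].
Proof.
have [r0 r0P] := pairing_coercive mD muD p1 eps01 nu0 M0 ma aM a_elliptic mF iF.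
have psi_uconvex (r eta : R) : 0 < eta -> exists2 delta : R, 0 < delta &
    forall U W, P U -> P W -> energy mu D p U <= r -> energy mu D p W <= r ->
    energy mu D p U / 2 + energy mu D p W / 2 - energy mu D p (2^-1 *: U + 2^-1 *: W) <= delta ->
    energy mu D p (U - W) <= eta.
  move=> eta0; have [delta d0 dP] := energy_uconvex mD muD N n p1 r eta0.
  by exists delta => // U W PU PW; exact: dP (PL PU) (PL PW).
have T_bounded (r eta : R) : 0 < eta -> exists2 delta : R, 0 < delta &
    forall U G, P U -> P G -> energy mu D p U <= r -> energy mu D p G <= delta ->
    `|pairing mu D p eps a F U G| <= eta.
  move=> eta0; have [delta d0 dP] := pairing_bounded mD muD p1 eps01 M0 ma aM mF iF r eta0.
  by exists delta => // U W PU PW; exact: dP (PL PU) (PL PW).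
have T_ucontinuous (r eta : R) : 0 < eta -> exists2 delta : R, 0 < delta &
    forall U W G, P U -> P W -> P G -> energy mu D p U <= r -> energy mu D p W <= r ->
    energy mu D p G <= r -> energy mu D p (U - W) <= delta ->
    `|pairing mu D p eps a F U G - pairing mu D p eps a F W G| <= eta.
  move=> eta0.
  have [delta d0 dP] := pairing_ucontinuous mD muD p1 eps01 hc M0 ma aM mF iF r eta0.
  by exists delta => // U W G PU PW PG; exact: dP (PL PU) (PL PW) (PL PG).
have [U [PU [r Ur] cU TU]] := @minty_browder R _ P (energy mu D p)
  (pairing mu D p eps a F) (2 `^ p) r0 P0 Pcomb (fun U _ => energy_ge0 mu D p U)
  (energy0 mu mD N n p1) (fun U _ => energyN mu D p U)
  (fun U W t PU PW => energy_convex mD muD p1 (PL PU) (PL PW)) (powR_ge0 _ _)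
  (fun U PU => energy_double mD muD (PL PU)) psi_uconvex
  (fun U G W b c PU PG PW => pairing_linear mD muD p1 eps01 M0 ma aM mF iF b c
     (PL PU) (PL PG) (PL PW))
  (fun U W PU PW => pairing_monotone mD muD p1 eps01 hc nu0 M0 ma aM a_elliptic mF iF
     (PL PU) (PL PW))
  T_bounded T_ucontinuous (fun U PU => r0P U (PL PU)).
have LU k := PL (PU k).
have [W LW cW] := field_complete mD muD p1 LU cU.
exists U, W; split => // G LG dG.
have WG g : P g -> pairing mu D p eps a F W g = 0.
  move=> Pg; apply/eqP; rewrite -normr_le0; apply/ler_addgt0Pr => eta eta0; rewrite add0r.
  pose s := Num.max r (Num.max (energy mu D p W) (energy mu D p g)).
  have e20 : 0 < eta / 2 by rewrite divr_gt0.
  have [delta d0 dP] := pairing_ucontinuous mD muD p1 eps01 hc M0 ma aM mF iF s e20.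
  have [k1 k1P] := cW delta d0; have [k2 k2P] := TU g Pg _ e20.
  pose k := maxn k1 k2.
  have h1 := dP (U k) W g (LU k) LW (PL Pg).
  have h2 := k2P k (leq_maxr _ _).
  have h3 := k1P k (leq_maxl _ _).
  rewrite [leRHS](splitr eta).
  apply: le_trans (lerD h2 (h1 _ _ _ h3)); last 3 first.
  - by rewrite le_max Ur.
  - by rewrite !le_max lexx orbT.
  - by rewrite !le_max lexx !orbT.
  rewrite -[X in `|X| <= _](subKr (pairing mu D p eps a F (U k) g)); exact: ler_normB.
apply/eqP; rewrite -normr_le0; apply/ler_addgt0Pr => eta eta0; rewrite add0r.
have [delta d0 dP] := pairing_bounded mD muD p1 eps01 M0 ma aM mF iF (energy mu D p W) eta0.
have [g Pg gG] := dG delta d0.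
have := dP W (g - G) LW (Lp_fieldB mD p1 (PL Pg) LG) (lexx _) gG.
have := pairing_linear mD muD p1 eps01 M0 ma aM mF iF 1 (-1) LW (PL Pg) LG.
rewrite scale1r scaleN1r => ->.
by rewrite (WG g Pg) mulr0 add0r mulN1r normrN.
Qed.
End weak_limit.

(** * Limits of test functions in Sobolev spaces *)

Section sobolev_limits.
Context {R : realType} {n : nat}.
Variables (Omega : set 'rV[R]_n) (M p : R).
Hypothesis OM : forall x, Omega x -> `|x| <= M.
Hypothesis Oopen : open Omega.
Hypothesis p1 : 1 < p.
Notation leb := (rV_lebesgue R n).
Local Notation mu := (lebesgue_measure_rV R n).
Local Notation O := (Omega : set leb).
Implicit Types f g phi psi : 'rV[R]_n -> R.

Let mO : measurable O. Proof. exact: measurable_Omega. Qed.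
Let muO : (mu O < +oo)%E. Proof. exact: (@lebesgue_Omega_lty R n Omega M OM). Qed.
Let p0 : 0 < p. Proof. exact: lt_trans p1. Qed.

Lemma in_LpE f : in_Lp Omega p f <-> pintegrable mu O p f.
Proof. exact: (Lfun_pintegrable mu mO p1). Qed.

Lemma Lp_dist_cvg0P (f : nat -> 'rV[R]_n -> R) g :
  (forall k, pintegrable mu O p (f k)) -> pintegrable mu O p g ->
  Lp_dist Omega p (f k) g @[k --> \oo] --> 0%E <->
  forall eta : R, 0 < eta -> exists k0, forall k, (k0 <= k)%N ->
    pint mu O p (f k \- g) <= eta.
Proof.
move=> pf pg; have pd k := pintegrableB mO p1 (pf k) pg.
exact: (Lnorm_cvg0P mO p1 pd).
Qed.

(** Convergence in L^p implies weak convergence against bounded functions. *)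
Lemma integral_limit (f : nat -> 'rV[R]_n -> R) g psi (B : R) :
  (forall k, pintegrable mu O p (f k)) -> pintegrable mu O p g ->
  continuous psi -> (forall x, `|psi x| <= B) ->
  (forall eta : R, 0 < eta -> exists k0, forall k, (k0 <= k)%N ->
    pint mu O p (f k \- g) <= eta) ->
  forall eta : R, 0 < eta -> exists k0, forall k, (k0 <= k)%N ->
    `|\int[mu]_(x in Omega) (f k x * psi x) - \int[mu]_(x in Omega) (g x * psi x)| <= eta.
Proof.
move=> pf pg cpsi psiB cv eta eta0.
have mpsi : measurable_fun O psi.
  exact: measurable_funTS (continuous_measurable_lebesgue cpsi).
have [ip small] := integral_bounded_small mO p1 muO mpsi psiB.
have [delta d0 dP] := small eta eta0; have [k0 k0P] := cv delta d0.
exists k0 => k kk; have pd := pintegrableB mO p1 (pf k) pg.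
have := dP _ pd (k0P k kk); congr (`|_| <= _).
rewrite -(RintegralB mO (ip _ (pf k)) (ip _ pg)); apply: eq_Rintegral => x _.
by rewrite /= mulrBl.
Qed.

(** Integration by parts for phi k against a test function psi passes to the
    limit, because psi and its derivatives are bounded. *)
Lemma in_W01p_limit f (Df : 'I_n -> 'rV[R]_n -> R) (phi : nat -> 'rV[R]_n -> R) :
  pintegrable mu O p f -> (forall i, pintegrable mu O p (Df i)) ->
  (forall k, test_function Omega (phi k)) ->
  (forall eta : R, 0 < eta -> exists k0, forall k, (k0 <= k)%N ->
    pint mu O p (phi k \- f) <= eta) ->
  (forall i (eta : R), 0 < eta -> exists k0, forall k, (k0 <= k)%N ->
    pint mu O p (partial i (phi k) \- Df i) <= eta) ->
  in_W01p Omega p f Df.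
Proof.
move=> pf pDf tphi cf cDf.
have pphi k := test_pintegrable OM Oopen p0 (tphi k).
have ppphi i k := test_partial_pintegrable OM Oopen i p0 (tphi k).
split; last first.
  exists phi; split => // [|i]; first exact/(Lp_dist_cvg0P pphi pf).
  by apply/(Lp_dist_cvg0P (ppphi i) (pDf i)); exact: cDf.
split => [|i|i psi tpsi]; [exact/in_LpE|exact/in_LpE|].
have [B [_ BP]] := test_bounded tpsi.
apply/eqP; rewrite -addr_eq0 -normr_le0; apply/ler_addgt0Pr => eta eta0; rewrite add0r.
have e20 : 0 < eta / 2 by rewrite divr_gt0.
have [k1 k1P] := integral_limit pphi pf (test_partial_continuous (i := i) tpsi)
  (fun x => (BP x).2 i) cf e20.
have [k2 k2P] := integral_limit (ppphi i) (pDf i) (test_continuous tpsi)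
  (fun x => (BP x).1) (cDf i) e20.
pose k := maxn k1 k2.
have := k1P k (leq_maxl _ _); have := k2P k (leq_maxr _ _).
rewrite (test_integration_by_parts OM Oopen i (tphi k) tpsi).
move: (\int[mu]_(x in Omega) _) (\int[mu]_(x in Omega) _) (\int[mu]_(x in Omega) _).
move=> A I J; rewrite !ler_norml => /andP[? ?] /andP[? ?]; apply/andP; split; lra.
Qed.

Lemma in_W01p_approx f (Df : 'I_n -> 'rV[R]_n -> R) : in_W01p Omega p f Df ->
  (forall i, pintegrable mu O p (Df i)) /\
  forall eta : R, 0 < eta -> exists2 phi, test_function Omega phi &
    forall i, pint mu O p (partial i phi \- Df i) <= eta.
Proof.
move=> [[/in_LpE pf pDf _] [phi [tphi _ cv]]].
have {}pDf i : pintegrable mu O p (Df i) by exact/in_LpE.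
split=> // eta eta0.
have ppphi i k := test_partial_pintegrable OM Oopen i p0 (tphi k).
have [k0 k0P] := finite_eventually (fun i =>
  (Lp_dist_cvg0P (ppphi i) (pDf i)).1 (cv i) eta eta0).
by exists (phi k0) => // i; exact: k0P.
Qed.

Variable N : nat.

Definition grad_mx (phi : 'I_(N + N) -> 'rV[R]_n -> R) : leb -> 'M[R]_(N + N, n) :=
  fun x => \matrix_(i, k) partial k (phi i) x.

Definition test_gradient (U : leb -> 'M[R]_(N + N, n)) := exists2 phi,
  forall i, test_function Omega (phi i) & U = grad_mx phi.

Lemma test_gradient0 : test_gradient 0.
Proof.
exists (fun _ _ => 0) => [i|]; first exact: test_function0.
apply/funext => x; apply/matrixP => i k; rewrite !mxE.
by rewrite /partial derive_cst.
Qed.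

Lemma test_gradient_comb (b c : R) U W : test_gradient U -> test_gradient W ->
  test_gradient (b *: U + c *: W).
Proof.
move=> [phi tphi ->] [psi tpsi ->].
exists (fun i x => b * phi i x + c * psi i x) => [i|]; first exact: test_function_comb.
apply/funext => x; apply/matrixP => i k; rewrite !mxE.
by rewrite (partial_test_comb b c k (tphi i) (tpsi i)).
Qed.

Lemma test_gradient_Lp U : test_gradient U -> Lp_field mu O p U.
Proof.
move=> [phi tphi ->] i k.
rewrite (_ : (fun x => _) = partial k (phi i)); last by apply/funext => x; rewrite mxE.
exact: (test_partial_pintegrable OM Oopen k p0 (tphi i)).
Qed.

(** Convergence of the gradients suffices: by the Poincare inequality in one
    coordinate direction, the functions themselves form Cauchy sequences in
    L^p. *)
Lemma test_gradient_limit (U : nat -> leb -> 'M[R]_(N + N, n)) W : (0 < n)%N ->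
  (forall k, test_gradient (U k)) -> Lp_field mu O p W ->
  (forall eta : R, 0 < eta -> exists k0, forall k, (k0 <= k)%N ->
    energy mu O p (U k - W) <= eta) ->
  exists w : 'I_(N + N) -> 'rV[R]_n -> R, forall i,
    in_W01p Omega p (w i) (fun k x => W x i k).
Proof.
move=> n0 tU LW cW; pose i0 := Ordinal n0.
have LU k := test_gradient_Lp (tU k).
have /choice[phi phiP] : forall k, exists phi : 'I_(N + N) -> 'rV[R]_n -> R,
    (forall i, test_function Omega (phi i)) /\ U k = grad_mx phi.
  by move=> k; have [phi tphi ->] := tU k; exists phi.
have tphi k i := (phiP k).1 i.
have pcv i j (eta : R) : 0 < eta -> exists k0, forall k, (k0 <= k)%N ->
    pint mu O p (partial j (phi k i) \- (fun x => W x i j)) <= eta.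
  move=> eta0; have [k0 k0P] := cW eta eta0; exists k0 => k kk.
  apply: le_trans (k0P k kk).
  apply: le_trans (pint_le_energy mO muO i j (Lp_fieldB mO p1 (LU k) LW)).
  rewrite le_eqVlt; apply/orP; left; apply/eqP; apply: eq_Rintegral => x _.
  by rewrite (phiP k).2 /= !mxE.
have pphi i k := test_pintegrable OM Oopen p0 (tphi k i).
have [C C0 CP] := poincare OM Oopen i0 p1.
have cphi i (eta : R) : 0 < eta -> exists k0, forall k l, (k0 <= k)%N -> (k0 <= l)%N ->
    pint mu O p (phi k i \- phi l i) <= eta.
  move=> eta0.
  have e0 : 0 < eta / (C * (2 `^ p * 2) + 1).
    by rewrite divr_gt0// ltr_wpDl// !mulr_ge0// powR_ge0.
  have [k0 k0P] := pcv i i0 _ e0; exists k0 => k l kk kl.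
  have tkl := test_function_comb 1 (-1) (tphi k i) (tphi l i).
  have pE := partial_test_comb 1 (-1) i0 (tphi k i) (tphi l i).
  have := CP _ tkl; rewrite pE.
  rewrite (_ : (fun x => _) = phi k i \- phi l i); last first.
    by apply/funext => x; rewrite mul1r mulN1r.
  rewrite (_ : (fun x => _) = partial i0 (phi k i) \- partial i0 (phi l i)); last first.
    by apply/funext => x; rewrite mul1r mulN1r.
  move=> /le_trans; apply.
  have pk := pintegrableB mO p1 (test_partial_pintegrable OM Oopen i0 p0 (tphi k i)) (LW i i0).
  have pl := pintegrableB mO p1 (LW i i0) (test_partial_pintegrable OM Oopen i0 p0 (tphi l i)).
  have := pint_triangle mO p1 pk pl.
  have -> : pint mu O p ((fun x => W x i i0) \- partial i0 (phi l i)) =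
      pint mu O p (partial i0 (phi l i) \- (fun x => W x i i0)).
    by apply: eq_Rintegral => x _; rewrite /= distrC.
  move=> h; have h2 := lerD (k0P k kk) (k0P l kl).
  have h3 := le_trans h (ler_wpM2l (powR_ge0 2 p) h2).
  apply: le_trans (ler_wpM2l C0 h3) _.
  have q0 : 0 <= C * (2 `^ p * 2) by rewrite !mulr_ge0// powR_ge0.
  set e := eta / _; have -> : C * (2 `^ p * (e + e)) = C * (2 `^ p * 2) * e by ring.
  rewrite /e mulrA ler_pdivrMr ?ltr_wpDl// mulrC ler_pM2l//.
  by rewrite lerDl.
have /choice[w wP] : forall i, exists g : 'rV[R]_n -> R, pintegrable mu O p g /\
    forall eta : R, 0 < eta -> exists k0, forall k, (k0 <= k)%N ->
      pint mu O p (phi k i \- g) <= eta.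
  by move=> i; have [g pg gP] := pint_complete mO p1 (pphi i) (cphi i); exists g.
exists w => i; have [pw cw] := wP i.
exact: (@in_W01p_limit (w i) (fun k x => W x i k) (fun k => phi k i) pw (LW i)
  (fun k => tphi k i) cw (pcv i)).
Qed.

Lemma test_gradient_approx (G : leb -> 'M[R]_(N + N, n)) (w : 'I_(N + N) -> 'rV[R]_n -> R) :
  (forall i, in_W01p Omega p (w i) (fun k x => G x i k)) ->
  Lp_field mu O p G /\ forall eta : R, 0 < eta ->
    exists2 g, test_gradient g & energy mu O p (g - G) <= eta.
Proof.
move=> wG; have LG : Lp_field mu O p G.
  by move=> i k; have [pG _] := in_W01p_approx (wG i); exact: (pG k).
split => // eta eta0.
have inv0 m : 0 < m.+1%:R^-1 :> R by rewrite invr_gt0.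
have /choice[phi phiP] : forall m, exists phi : 'I_(N + N) -> 'rV[R]_n -> R,
    forall i, test_function Omega (phi i) /\
      forall k, pint mu O p (partial k (phi i) \- (fun x => G x i k)) <= m.+1%:R^-1.
  move=> m; have /choice[phi phiP] : forall i, exists phi, test_function Omega phi /\
      forall k, pint mu O p (partial k phi \- (fun x => G x i k)) <= m.+1%:R^-1.
    by move=> i; have [_ /(_ _ (inv0 m))[phi]] := in_W01p_approx (wG i); exists phi.
  by exists phi.
have tg m : test_gradient (grad_mx (phi m)).
  by exists (phi m) => // i; case: (phiP m i).
have cv i j (e : R) : 0 < e -> exists m0, forall m, (m0 <= m)%N ->
    pint mu O p ((fun x => grad_mx (phi m) x i j) \- (fun x => G x i j)) <= e.
  move=> e0; have [m0 _ m0P] := near_infty_natSinv_lt (PosNum e0).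
  exists m0 => m mm; have [_ /(_ j)] := phiP m i.
  rewrite (_ : (fun x => grad_mx _ x i j) = partial j (phi m i)); last first.
    by apply/funext => x; rewrite mxE.
  by move=> /le_trans; apply; apply/ltW/m0P.
have [m0 m0P] := energy_cvgP mO muO p1 (fun m => test_gradient_Lp (tg m)) LG cv eta0.
by exists (grad_mx (phi m0)) => //; exact: m0P.
Qed.
End sobolev_limits.

(** * The weak equation *)

Lemma ae_imply d (T : measurableType d) (R : realType) (mu : {measure set T -> \bar R})
    (A B : T -> Prop) : (forall x, A x -> B x) -> {ae mu, forall x, A x} ->
  {ae mu, forall x, B x}.
Proof. by move=> AB; apply: filterS. Qed.

Section realification.
Context {R : realType}.
Variables (N n : nat).
Implicit Types A B : 'M[R[i]]_(N, n).

Definition realify A : 'M[R]_(N + N, n) :=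
  col_mx (map_mx (@complex.Re R) A) (map_mx (@complex.Im R) A).

Lemma realifyK : cancel realify (@cplx R N n).
Proof.
move=> A; apply/matrixP => j k; rewrite mxE col_mxEu col_mxEd !mxE.
by case: (A j k).
Qed.

Lemma cinnerZl (z : R[i]) A B : cinner (z *: A) B = z * cinner A B.
Proof.
rewrite /cinner mulr_sumr; apply: eq_bigr => j _; rewrite mulr_sumr.
by apply: eq_bigr => k _; rewrite mxE mulrA.
Qed.

Lemma cinner_flux p eps (z : R[i]) A B :
  z * (weight p eps A)%:C%C * cinner A B = cinner (z *: flux p eps A) B.
Proof. by rewrite !cinnerZl mulrA. Qed.
End realification.

Section data.
Context d {T : measurableType d} {R : realType} (mu : {measure set T -> \bar R}).
Variables (D : set T) (mD : measurable D) (muD : (mu D < +oo)%E).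
Variables (N n : nat) (p : R).
Hypothesis p1 : 1 < p.
Let p0 : 0 < p. Proof. exact: lt_trans p1. Qed.

(** Integrability of the entries gives that of the norm, since all norms on
    matrices are equivalent. *)
Lemma integrable_cnorm_powR (X : T -> 'M[R[i]]_(N, n)) :
  Lp_field mu D p (fun x => realify (X x)) ->
  mx_measurable D X /\ mu.-integrable D (EFin \o (fun x => cnorm (X x) `^ p)).
Proof.
move=> LX; have XE x : cplx (realify (X x)) = X x by rewrite realifyK.
have mX : mx_measurable D X.
  by have := mx_measurable_cplx LX; rewrite (funext XE).
split=> //; have [K _ KP] := ppow_cnorm N n p0.
have m_ : measurable_fun D (fun x => cnorm (X x) `^ p).
  apply: (measurableT_comp (measurable_powR p)).
  rewrite (_ : (fun x => _) = fun x => reinner (X x) (X x) `^ 2^-1); last first.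
    by apply/funext => x; rewrite powR12_sqrt ?reinner_ge0.
  exact: (measurableT_comp (measurable_powR 2^-1) (measurable_reinner mX mX)).
have iK := integrable_comb mD K 0 (integrable_ppow mD muD LX) (integrable_ppow mD muD LX).
apply: (integrable_le mD m_ iK) => x _; rewrite mul0r addr0 ger0_norm ?powR_ge0//.
by have [_] := KP (realify (X x)); rewrite XE.
Qed.
End data.

Section equation.
Context d {T : measurableType d} {R : realType} (mu : {measure set T -> \bar R}).
Variables (D : set T) (mD : measurable D) (muD : (mu D < +oo)%E).
Variables (N n : nat) (p eps M : R).
Hypothesis p1 : 1 < p.
Hypothesis eps01 : 0 <= eps <= 1.
Hypothesis M0 : 0 < M.
Variable a : T -> R[i].
Hypothesis ma : measurable_fun D (fun x => complex.Re (a x)) /\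
  measurable_fun D (fun x => complex.Im (a x)).
Hypothesis aM : forall x, D x -> `|complex.Re (a x)| <= M /\ `|complex.Im (a x)| <= M.
Variable F : T -> 'M[R[i]]_(N, n).
Hypothesis mF : mx_measurable D F.
Hypothesis iF : mu.-integrable D (EFin \o (fun x => cnorm (F x) `^ (p / (p - 1)))).

(** The two integrals may be separated because the density with F = 0 is
    integrable too. *)
Lemma pairing_eq0 (W G : T -> 'M[R]_(N + N, n)) :
  Lp_field mu D p W -> Lp_field mu D p G -> pairing mu D p eps a F W G = 0 ->
  \int[mu]_(x in D) reinner (a x *: flux p eps (cplx (W x))) (cplx (G x)) =
  \int[mu]_(x in D) reinner (F x) (cplx (G x)).
Proof.
move=> LW LG WG.
have p'0 : p / (p - 1) != 0 by rewrite gt_eqF// divr_gt0 ?subr_gt0// (lt_trans _ p1).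
have c0 : cnorm (0 : 'M[R[i]]_(N, n)) = 0 by rewrite cnorm0.
have mF0 : mx_measurable D (fun _ : T => 0 : 'M[R[i]]_(N, n)).
  by move=> j k; split; apply: measurable_cst.
have iF0 : mu.-integrable D (EFin \o (fun _ : T =>
    cnorm (0 : 'M[R[i]]_(N, n)) `^ (p / (p - 1)))).
  apply: (integrable_bounded (c := 0) mD muD) => [|x _]; first exact: measurable_cst.
  by rewrite c0 powR0// normr0.
have i0 := integrable_density mD muD p1 eps01 M0 ma aM mF0 iF0 LW LG.
have iD := integrable_density mD muD p1 eps01 M0 ma aM mF iF LW LG.
have := Rintegral_comb mD 1 (-1) i0 iD; rewrite -/(pairing mu D p eps a F W G) WG.
rewrite mul1r mulr0 addr0 => h; transitivity (\int[mu]_(x in D)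
    pairing_density p eps a (fun _ => 0) x (W x) (G x)).
  by apply: eq_Rintegral => x _; rewrite /pairing_density subr0.
rewrite -h; apply: eq_Rintegral => x _.
by rewrite /pairing_density subr0 reinnerBl mul1r mulN1r opprB addrC subrK.
Qed.
End equation.

Section sobolev0_fields.
Context {R : realType} {n : nat}.
Variables (Omega : set 'rV[R]_n) (M p : R).
Hypothesis OM : forall x, Omega x -> `|x| <= M.
Hypothesis Oopen : open Omega.
Hypothesis p1 : 1 < p.
Local Notation mu := (lebesgue_measure_rV R n).

Lemma in_W01pN f (Df : 'I_n -> 'rV[R]_n -> R) : in_W01p Omega p f Df ->
  in_W01p Omega p (fun x => - f x) (fun k x => - Df k x).
Proof.
move=> [[pf pDf _] [phi [tphi cf cDf]]]; have p0 : 0 < p by exact: lt_trans p1.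
have {}pf := (in_LpE Oopen p1 f).1 pf.
have {}pDf i := (in_LpE Oopen p1 (Df i)).1 (pDf i).
have pN g : pintegrable mu (Omega : set (rV_lebesgue R n)) p g ->
    pintegrable mu (Omega : set (rV_lebesgue R n)) p (fun x => - g x).
  move=> pg; have := pintegrable_comb (measurable_Omega Oopen) p1 (-1) 0 pg pg.
  by congr pintegrable; apply/funext => x; rewrite mulN1r mul0r addr0.
have pphi k := test_pintegrable OM Oopen p0 (tphi k).
have ppphi i k := test_partial_pintegrable OM Oopen i p0 (tphi k).
have NE (g : 'rV[R]_n -> R) : (fun x => -1 * g x + 0 * g x) = (fun x : 'rV[R]_n => - g x).
  by apply/funext => x; rewrite mulN1r mul0r addr0.
have tN k : test_function Omega (fun x => - phi k x).
  by have := test_function_comb (-1) 0 (tphi k) (tphi k); rewrite NE.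
have pNE i k : partial i (fun x => - phi k x) = fun x => - partial i (phi k) x.
  by have := partial_test_comb (-1) 0 i (tphi k) (tphi k); rewrite !NE.
have pintN g h : pint mu (Omega : set (rV_lebesgue R n)) p
    ((fun x => - g x) \- (fun x => - h x)) =
    pint mu (Omega : set (rV_lebesgue R n)) p (g \- h).
  by apply: eq_Rintegral => x _; rewrite /= -opprD normrN.
apply: (in_W01p_limit OM Oopen p1 (pN _ pf) (fun i => pN _ (pDf i)) tN).
  move=> eta /(proj1 (Lp_dist_cvg0P Oopen p1 pphi pf) cf)[k0 k0P].
  by exists k0 => k kk; rewrite pintN; exact: k0P.
move=> i eta /(proj1 (Lp_dist_cvg0P Oopen p1 (ppphi i) (pDf i)) (cDf i))[k0 k0P].
by exists k0 => k kk; rewrite pNE pintN; exact: k0P.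
Qed.

(** The space is stable under multiplication by i, which exchanges real and
    imaginary parts up to a sign. *)
Lemma sobolev0_realify N (phi : sobolev Omega p N) : sobolev0 phi ->
  (forall i, in_W01p Omega p (fun x => realify (phi x) i 0)
     (fun k x => realify (grad phi x) i k)) /\
  (forall i, in_W01p Omega p (fun x => realify ('i%C *: phi x) i 0)
     (fun k x => realify ('i%C *: grad phi x) i k)).
Proof.
move=> phi0.
have ReI (z : R[i]) : complex.Re ('i%C * z) = - complex.Im z.
  by case: z => x y /=; rewrite mul0r mul1r sub0r.
have ImI (z : R[i]) : complex.Im ('i%C * z) = complex.Re z.
  by case: z => x y /=; rewrite mul0r mul1r add0r.
split=> i; case: (splitP i) => j ij.
- have -> : i = lshift N j by exact/val_inj.
  have [h _] := phi0 j; move: h; congr in_W01p.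
    by apply/funext => x; rewrite col_mxEu mxE.
  by apply/funext => k; apply/funext => x; rewrite col_mxEu mxE.
- have -> : i = rshift N j by exact/val_inj.
  have [_ h] := phi0 j; move: h; congr in_W01p.
    by apply/funext => x; rewrite col_mxEd mxE.
  by apply/funext => k; apply/funext => x; rewrite col_mxEd mxE.
- have -> : i = lshift N j by exact/val_inj.
  have [_ h] := phi0 j; move: (in_W01pN h); congr in_W01p.
    by apply/funext => x; rewrite col_mxEu !mxE ReI.
  by apply/funext => k; apply/funext => x; rewrite col_mxEu !mxE ReI.
- have -> : i = rshift N j by exact/val_inj.
  have [h _] := phi0 j; move: h; congr in_W01p.
    by apply/funext => x; rewrite col_mxEd !mxE ImI.
  by apply/funext => k; apply/funext => x; rewrite col_mxEd !mxE ImI.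
Qed.
End sobolev0_fields.

Theorem theorem5p3 (R : realType) (n N : nat) (hn : (2 <= n)%N)
    (hN : (1 <= N)%N) (Omega : set 'rV[R]_n) (hOopen : open Omega)
    (hObounded : bounded_set Omega)
    (p p' eps nu L c1 c2 : R) (hp : 1 < p) (hp' : p' = p / (p - 1))
    (heps : 0 <= eps <= 1) (hnu : 0 < nu) (hL : nu < L)
    (hc : structure_constants p c1 c2)
    (a : 'rV[R]_n -> R[i]) (ha : coefficient_class nu L c1 c2 Omega a)
    (F : 'rV[R]_n -> 'M[R[i]]_(N, n)) (hF : in_Lp_cmx Omega p' F) :
  exists u : sobolev Omega p N, sobolev0 u /\ weak_solution eps a F u.
Proof.
pose O := Omega : set (rV_lebesgue R n); pose mu := lebesgue_measure_rV R n.
have [M0 [_ /(_ (M0 + 1)) hM]] := hObounded.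
have OM x : Omega x -> `|x| <= M0 + 1 by apply: hM; rewrite ltrDl.
have mO : measurable O by exact: measurable_Omega.
have muO : (mu O < +oo)%E by exact: (lebesgue_Omega_lty OM hOopen).
have [maR maI [M aM] a_ae] := ha.
have Mpos : 0 < `|M| + 1 by rewrite ltr_wpDl.
have aM1 x : O x -> `|complex.Re (a x)| <= `|M| + 1 /\ `|complex.Im (a x)| <= `|M| + 1.
  move=> /aM[h1 h2]; have h := ler_norm M.
  by split; [apply: le_trans h1 _|apply: le_trans h2 _]; rewrite (le_trans h)// lerDl.
have a_elliptic : {ae mu, forall x, O x -> nu < complex.Re (a x) - `|complex.Im (a x)| /\
    c2 * `|complex.Im (a x)| <= c1 * complex.Re (a x)}.
  apply: ae_imply a_ae => x h /h[h1 _ h3]; split => //.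
  by rewrite -subr_ge0; apply/ltW/(lt_trans hnu).
have p'1 : 1 < p' by rewrite hp' ltr_pdivlMr ?subr_gt0// mul1r ltrBlDr ltrDl.
have LF : Lp_field mu O p' (fun x => realify (F x)).
  move=> i k; case: (splitP i) => j ij.
    have -> : i = lshift N j by exact/val_inj.
    have [/(in_LpE hOopen p'1) h _] := hF j k; move: h; congr pintegrable.
    by apply/funext => x; rewrite col_mxEu mxE.
  have -> : i = rshift N j by exact/val_inj.
  have [_ /(in_LpE hOopen p'1) h] := hF j k; move: h; congr pintegrable.
  by apply/funext => x; rewrite col_mxEd mxE.
have [mF iF] := integrable_cnorm_powR mO muO p'1 LF; rewrite hp' in iF.
have [U [W [tU LW UW WG]]] := @closure_solution _ _ _ mu O mO muO N n p eps c1 c2 nu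
  (`|M| + 1) hp heps hc hnu Mpos a (conj maR maI) aM1 a_elliptic F mF iF
  (test_gradient Omega (N := N)) (test_gradient0 Omega N)
  (fun b c U W => @test_gradient_comb _ _ _ N b c U W)
  (fun U => @test_gradient_Lp _ _ _ _ _ OM hOopen hp N U).
have [w wP] := test_gradient_limit OM hOopen hp (ltnW hn) tU LW UW.
pose u x : 'cV[R[i]]_N := \col_j (w (lshift N j) x +i* w (rshift N j) x)%C.
have uRe j : in_W01p Omega p (fun x => complex.Re (u x j 0))
    (fun k x => complex.Re (cplx (W x) j k)).
  move: (wP (lshift N j)); congr in_W01p; first by apply/funext => x; rewrite mxE.
  by apply/funext => k; apply/funext => x; rewrite mxE.
have uIm j : in_W01p Omega p (fun x => complex.Im (u x j 0))
    (fun k x => complex.Im (cplx (W x) j k)).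
  move: (wP (rshift N j)); congr in_W01p; first by apply/funext => x; rewrite mxE.
  by apply/funext => k; apply/funext => x; rewrite mxE.
exists (Sobolev (fun j => (uRe j).1) (fun j => (uIm j).1)); split; first by [].
move=> phi /(sobolev0_realify OM hOopen hp)[phiRe phiIm].
have eq_int (X : 'rV[R]_n -> 'M[R[i]]_(N, n)) (v : 'I_(N + N) -> 'rV[R]_n -> R) :
    (forall i, in_W01p Omega p (v i) (fun k x => realify (X x) i k)) ->
    \int[mu]_(x in Omega) reinner (a x *: flux p eps (cplx (W x))) (X x) =
    \int[mu]_(x in Omega) reinner (F x) (X x).
  move=> vX; have [LX dX] := test_gradient_approx OM hOopen hp vX.
  have := pairing_eq0 mO muO hp heps Mpos (conj maR maI) aM1 mF iF LW LX (WG _ LX dX).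
  by under eq_Rintegral do rewrite realifyK;
     under [in X in _ = X -> _]eq_Rintegral do rewrite realifyK.
rewrite /cintegral; congr (_ +i* _)%C.
  under eq_Rintegral do rewrite cinner_flux.
  exact: (eq_int _ _ phiRe).
under eq_Rintegral do rewrite cinner_flux Im_cinnerE.
under [RHS]eq_Rintegral do rewrite Im_cinnerE.
exact: (eq_int _ _ phiIm).
Qed.
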